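(* Let $\mathfrak g=\mathfrak{so}(2r)$, $r\geq4$ (type $\mathrm D_r$), let $\lambda$ be a dominant integral weight, and put $\boldsymbol\Lambda=(\lambda,\omega_1)$, $\boldsymbol z=(0,1)$. Let $\boldsymbol l$ be one of the following tuples: $(\underbrace{1,\dots,1}_{k_1},0,\dots,0)$ with $k_1\in\{0,\dots,r-2,r\}$ (length label $l=k_1$); $(\underbrace{1,\dots,1}_{r-2},1,0)$ (label $l=r-1$); $(\underbrace{1,\dots,1}_{r-2},0,1)$ (label $l=\overline{r-1}$); $(\underbrace{1,\dots,1}_{k_2},2,\dots,2,1,1)$ with $0\leq k_2\leq r-2$ (label $l=2r-2-k_2$). If $\boldsymbol l$ is not admissible then the Bethe ansatz equation associated to $\boldsymbol\Lambda,\boldsymbol z,\boldsymbol l$ has no solutions. If $\boldsymbol l$ is admissible then it has exactly one solution, represented by the following $r$-tuple $\boldsymbol y^{(l)}$ (empty sums are $0$, empty products are $1$). (i) For $l=0,\dots,r-1$: $\boldsymbol y^{(l)}=(x-c_1^{(l)},\dots,x-c_l^{(l)},1,\dots,1)$ with $$c_j^{(l)}=\prod_{i=1}^j\frac{\lambda_i+\dots+\lambda_l+l-i}{\lambda_i+\dots+\lambda_l+l-i+1}.$$ (ii) For $l=\overline{r-1}$: $\boldsymbol y^{(\overline{r-1})}=(x-c_1,\dots,x-c_{r-2},1,x-c_r)$ with $$c_j=\prod_{i=1}^j\frac{\lambda_i+\dots+\lambda_{r-2}+\lambda_r+r-1-i}{\lambda_i+\dots+\lambda_{r-2}+\lambda_r+r-i}\quad(1\leq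 j\leq r-2),\qquad c_r=\frac{\lambda_r}{\lambda_r+1}\,c_{r-2}.$$ (iii) For $l=r$: $\boldsymbol y^{(r)}=(x-c_1^{(r)},\dots,x-c_r^{(r)})$ with $$c_j^{(r)}=\prod_{i=1}^j\frac{\lambda_i+\dots+\lambda_r+r-i}{\lambda_i+\dots+\lambda_r+r+1-i}\quad(1\leq j\leq r-2),\qquad c_{r-1}^{(r)}=\frac{\lambda_{r-1}}{\lambda_{r-1}+1}\,c_{r-2}^{(r)},\qquad c_r^{(r)}=\frac{\lambda_r}{\lambda_r+1}\,c_{r-2}^{(r)}.$$ (iv) For $l=r+1,\dots,2r-2$: $$\boldsymbol y^{(l)}=\big(x-c_1^{(l)},\dots,x-c_{2r-l-2}^{(l)},(x-a_{2r-l-1}^{(l)})(x-b_{2r-l-1}^{(l)}),\dots,(x-a_{r-2}^{(l)})(x-b_{r-2}^{(l)}),x-c_{r-1}^{(l)},x-c_r^{(l)}\big).$$ Write $$p_i=\sum_{m=i}^{2r-2-l}\lambda_m+2\sum_{m=2r-l-1}^{r-2}\lambda_m+\lambda_{r-1}+\lambda_r+l-i,\qquad P_i=\frac{p_i}{p_i+1}\qquad(1\leq i\leq 2r-l-2),$$ $$q_i=\sum_{m=2r-1-l}^{i}\lambda_m+2\sum_{m=i+1}^{r-2}\lambda_m+\lambda_{r-1}+\lambda_r+l-i-1,\qquad Q_i=\frac{q_i}{q_i+1}\qquad(2r-1-l\leq i\leq r-2),$$ $$\rho_i=\sum_{m=2r-l-1}^{i}\lambda_m+l+i+1-2r,\qquad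 R_i=\frac{\rho_i}{\rho_i+1}\qquad(2r-1-l\leq i\leq r-2),$$ $$X=\frac{\sum_{m=2r-1-l}^{r-2}\lambda_m+\lambda_{r-1}+l-r}{\sum_{m=2r-1-l}^{r-2}\lambda_m+\lambda_{r-1}+l-r+1},\qquad Y=\frac{\sum_{m=2r-1-l}^{r-2}\lambda_m+\lambda_{r}+l-r}{\sum_{m=2r-1-l}^{r-2}\lambda_m+\lambda_{r}+l-r+1},$$ $$M=2\sum_{m=2r-l-1}^{r-2}\lambda_m+\lambda_{r-1}+\lambda_r+2l-2r.$$ Then $c_j^{(l)}=\prod_{i=1}^jP_i$ for $1\leq j\leq 2r-l-2$, $$c_{r-1}^{(l)}=X\prod_{i=1}^{2r-2-l}P_i\prod_{i=2r-1-l}^{r-2}Q_i,\qquad c_r^{(l)}=Y\prod_{i=1}^{2r-2-l}P_i\prod_{i=2r-1-l}^{r-2}Q_i,$$ and for $k=2r-1-l,\dots,r-2$ $$a_k^{(l)}b_k^{(l)}=\Big(\prod_{i=1}^{2r-l-2}P_i\Big)^2\ \prod_{i=2r-1-l}^{r-2}Q_i\ \prod_{i=2r-1-l}^{k-1}Q_i\ \prod_{i=k}^{r-2}R_i\ \cdot X\,Y,$$ $$a_k^{(l)}+b_k^{(l)}=\prod_{i=1}^{2r-l-2}P_i\ \prod_{i=2r-1-l}^{k-1}Q_i\ \Big(\frac{M}{M+1}+\frac{M+2}{M+1}\ X\,Y\prod_{i=k}^{r-2}Q_i\ \prod_{i=k}^{r-2}R_i\Big).$$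
   Context: Type $\mathrm D_r$ conventions: simple roots $\alpha_1,\dots,\alpha_r$ (standard numbering), coroots $\alpha_i^\vee$, fundamental weights $\omega_i$ with $\langle\omega_j,\alpha_i^\vee\rangle=\delta_{ij}$. The invariant form on $\mathfrak h^*$ has $(\alpha_i,\alpha_i)=2$ for all $i$, $(\alpha_i,\alpha_{i-1})=-1$ for $2\leq i\leq r-1$, $(\alpha_r,\alpha_{r-2})=-1$, and all other products of distinct simple roots zero (in particular $(\alpha_r,\alpha_{r-1})=0$). Write $\lambda_i=\langle\lambda,\alpha_i^\vee\rangle$. $V_\mu$ is the irreducible module of highest weight $\mu$. Bethe ansatz equation. Given weights $\boldsymbol\Lambda=(\Lambda_1,\dots,\Lambda_n)$, distinct complex numbers $\boldsymbol z=(z_1,\dots,z_n)$ and nonnegative integers $\boldsymbol l=(l_1,\dots,l_r)$, let $L=l_1+\dots+l_r$, and let $c:\{1,\dots,L\}\to\{1,\dots,r\}$ be the non-decreasing function with $\#c^{-1}(i)=l_i$. The Bethe ansatz equation associated to $\boldsymbol\Lambda,\boldsymbol z,\boldsymbol l$ is the system for $\boldsymbol t=(t_1,\dots,t_L)\in\mathbb C^L$ $$-\sum_{s=1}^n\frac{(\alpha_{c(i)},\Lambda_s)}{t_i-z_s}+\sum_{j\ne i}\frac{(\alpha_{c(i)},\alpha_{c(j)})}{t_i-t_j}=0,\qquad i=1,\dots,L,$$ where terms with zero numerator are omitted and all denominators with nonzero numerator are required to be nonzero. Solutions that differ by a permutation of coordinates preserving $c$ are identified. A solution $\boldsymbol t$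 is represented by the $r$-tuple $\boldsymbol y=(y_1,\dots,y_r)$, $y_i(x)=\prod_{j:\,c(j)=i}(x-t_j)$. Admissibility. The tuple $\boldsymbol l$ is admissible if $V_{\lambda+\omega_1-\sum_i l_i\alpha_i}$ is a summand of $V_\lambda\otimes V_{\omega_1}$. For the tuples in the claim, with label $l\in\{0,1,\dots,r-1,\overline{r-1},r,\dots,2r-2\}$, this holds iff $l=0$; or $1\leq l\leq r-1$ and $\lambda_l>0$; or $l=\overline{r-1}$ and $\lambda_r>0$; or $l=r$ and $\lambda_{r-1}>0$, $\lambda_r>0$; or $r+1\leq l\leq 2r-2$ and $\lambda_{2r-l-1}>0$. *)

(* Defs.v *)
From mathcomp Require Import all_boot all_order all_fingroup all_algebra.
From mathcomp Require Import zify ring reals.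
From mathcomp.real_closed Require Import complex mxtens.

Set Implicit Arguments.
Unset Strict Implicit.
Unset Printing Implicit Defensive.

Import Order.TTheory GRing.Theory Num.Theory.
Local Open Scope ring_scope.

(* Nodes of the Dynkin diagram are natural numbers 1, ..., r.  The dual h^*   *)
(* of the Cartan subalgebra is 'rV_r with the orthonormal basis eps 1, ...,   *)
(* eps r of the standard realization of the root system D_r.                  *)

Definition eps (C : numFieldType) (r k : nat) : 'rV[C]_r :=
  \row_(j < r) (j.+1 == k)%:R.

Definition inv_form (C : numFieldType) (r : nat) (u v : 'rV[C]_r) : C :=
  \sum_(j < r) u 0 j * v 0 j.

Definition alpha (C : numFieldType) (r i : nat) : 'rV[C]_r :=
  if i == r then eps C r r.-1 + eps C r r else eps C r i - eps C r i.+1.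

(* <mu, alpha_i^\vee> *)
Definition dynkin (C : numFieldType) (r : nat) (mu : 'rV[C]_r) (i : nat) : C :=
  2 * inv_form mu (alpha C r i) / inv_form (alpha C r i) (alpha C r i).

Definition dominant_integral (C : numFieldType) (r : nat) (mu : 'rV[C]_r) :=
  forall i, (1 <= i <= r)%N -> exists k : nat, dynkin mu i = k%:R.

Definition omega1 (C : numFieldType) (r : nat) : 'rV[C]_r := eps C r 1.

(* so(2r) is taken with respect to the symmetric form of matrix so_gram, for  *)
(* which cartan x = diag(x_1, .., x_r, -x_1, .., -x_r) runs over a Cartan     *)
(* subalgebra and eps k is the k-th coordinate function x |-> x_k on it.      *)

Definition so_gram (C : numFieldType) (r : nat) : 'M[C]_(r + r) :=
  block_mx 0 1%:M 1%:M 0.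

Definition so (C : numFieldType) (r : nat) (X : 'M[C]_(r + r)) : Prop :=
  X^T *m so_gram C r + so_gram C r *m X = 0.

Definition lie (C : numFieldType) (d : nat) (X Y : 'M[C]_d) : 'M[C]_d :=
  X *m Y - Y *m X.

Definition cartan (C : numFieldType) (r : nat) (x : 'rV[C]_r) :
    'M[C]_(r + r) :=
  block_mx (diag_mx x) 0 0 (- diag_mx x).

Definition elem_mx (C : numFieldType) (r i j : nat) : 'M[C]_r :=
  \matrix_(a < r, b < r) ((a.+1 == i) && (b.+1 == j))%:R.

Definition root_vector (C : numFieldType) (r i : nat) : 'M[C]_(r + r) :=
  if i == r
  then block_mx 0 (elem_mx C r r.-1 r - elem_mx C r r r.-1) 0 0
  else block_mx (elem_mx C r i i.+1) 0 0 (- elem_mx C r i.+1 i).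

(* A finite-dimensional so(2r)-module is 'cV_d with X acting as rho X; the    *)
(* values of rho outside so(2r) are irrelevant.                               *)

Definition so_module (C : numFieldType) (r d : nat)
    (rho : 'M[C]_(r + r) -> 'M[C]_d) : Prop :=
  (forall (a : C) X Y, so X -> so Y -> rho (a *: X + Y) = a *: rho X + rho Y)
  /\ (forall X Y, so X -> so Y -> rho (lie X Y) = lie (rho X) (rho Y)).

Definition irreducible_module (C : numFieldType) (r d : nat)
    (rho : 'M[C]_(r + r) -> 'M[C]_d) : Prop :=
  (0 < d)%N /\
  forall U : {vspace 'cV[C]_d},
    (forall X, so X -> forall v, v \in U -> rho X *m v \in U) ->
    U = 0%VS \/ U = fullv.

Definition highest_weight_vector (C : numFieldType) (r d : nat)
    (rho : 'M[C]_(r + r) -> 'M[C]_d) (mu : 'rV[C]_r) (v : 'cV[C]_d) : Prop :=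
  [/\ v != 0,
      forall i, (1 <= i <= r)%N -> rho (root_vector C r i) *m v = 0 &
      forall x, rho (cartan x) *m v = inv_form mu x *: v].

(* rho is a model of V_mu, which is unique up to isomorphism *)
Definition irreducible_of_highest_weight (C : numFieldType) (r d : nat)
    (mu : 'rV[C]_r) (rho : 'M[C]_(r + r) -> 'M[C]_d) : Prop :=
  [/\ so_module rho, irreducible_module rho &
      exists v, highest_weight_vector rho mu v].

Definition tensor_module (C : numFieldType) (r d1 d2 : nat)
    (rho1 : 'M[C]_(r + r) -> 'M[C]_d1) (rho2 : 'M[C]_(r + r) -> 'M[C]_d2)
    (X : 'M[C]_(r + r)) : 'M[C]_(d1 * d2) :=
  rho1 X *t 1%:M + 1%:M *t rho2 X.

(* inclusion and projection of a direct summand, both so(2r)-equivariant *)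
Definition summand (C : numFieldType) (r d1 d : nat)
    (rho1 : 'M[C]_(r + r) -> 'M[C]_d1) (rho : 'M[C]_(r + r) -> 'M[C]_d) : Prop :=
  exists (inc : 'M[C]_(d, d1)) (prj : 'M[C]_(d1, d)),
    [/\ prj *m inc = 1%:M,
        forall X, so X -> inc *m rho1 X = rho X *m inc &
        forall X, so X -> prj *m rho X = rho1 X *m prj].

(* A tuple (l_1, .., l_r) is a sequence of size r, with l_i = nth 0 l i.-1.   *)

Definition target_weight (C : numFieldType) (r : nat) (lam : 'rV[C]_r)
    (l : seq nat) : 'rV[C]_r :=
  lam + omega1 C r - \sum_(1 <= i < r.+1) alpha C r i *+ nth 0%N l i.-1.

(* Only finite-dimensional modules occur: for a weight mu that is not         *)
(* dominant integral, V_mu is infinite-dimensional and hence is not a summand *)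
(* of the finite-dimensional module V_lam (x) V_omega1.                       *)
Definition admissible (C : numFieldType) (r : nat) (lam : 'rV[C]_r)
    (l : seq nat) : Prop :=
  exists (d1 d2 d3 : nat) (rho1 : 'M[C]_(r + r) -> 'M[C]_d1)
    (rho2 : 'M[C]_(r + r) -> 'M[C]_d2) (rho3 : 'M[C]_(r + r) -> 'M[C]_d3),
    [/\ irreducible_of_highest_weight lam rho1,
        irreducible_of_highest_weight (omega1 C r) rho2,
        irreducible_of_highest_weight (target_weight lam l) rho3 &
        summand rho3 (tensor_module rho1 rho2)].

Definition colors (l : seq nat) : seq nat :=
  flatten [seq nseq (nth 0%N l i.-1) i | i <- iota 1 (size l)].

(* the function c, extended by 0 outside its domain; positions count from 0 *)
Definition color (l : seq nat) (j : nat) : nat := nth 0%N (colors l) j.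

(* Division by 0 yields 0, so the terms with zero numerator contribute 0      *)
(* whatever their denominator.                                                *)
Definition bethe_solution (C : numFieldType) (r n : nat)
    (Lam : n.-tuple 'rV[C]_r) (z : n.-tuple C) (l : seq nat)
    (t : 'I_(sumn l) -> C) : Prop :=
  let al (i : 'I_(sumn l)) := alpha C r (color l i) in
  [/\ forall i s, inv_form (al i) (tnth Lam s) != 0 -> t i != tnth z s,
      forall i j, j != i -> inv_form (al i) (al j) != 0 -> t i != t j &
      forall i,
        - (\sum_(s < n) inv_form (al i) (tnth Lam s) / (t i - tnth z s))
        + \sum_(j < sumn l | j != i) inv_form (al i) (al j) / (t i - t j) = 0].

Definition same_solution (C : numFieldType) (l : seq nat)
    (t t' : 'I_(sumn l) -> C) : Prop :=
  exists s : 'S_(sumn l),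
    (forall j, color l (s j) = color l j) /\ (forall j, t j = t' (s j)).

Definition representing_poly (C : numFieldType) (l : seq nat)
    (t : 'I_(sumn l) -> C) (i : nat) : {poly C} :=
  \prod_(j < sumn l | color l j == i) ('X - (t j)%:P).

(* LabBar is the label \overline{r-1} *)
Inductive label := Lab of nat | LabBar.

Inductive labelled_tuple (r : nat) : label -> seq nat -> Prop :=
| Tuple_ones k1 of (k1 <= r - 2)%N || (k1 == r) :
    labelled_tuple r (Lab k1) (nseq k1 1%N ++ nseq (r - k1) 0%N)
| Tuple_r1 :
    labelled_tuple r (Lab (r - 1)) (nseq (r - 2) 1%N ++ [:: 1%N; 0%N])
| Tuple_r1bar :
    labelled_tuple r LabBar (nseq (r - 2) 1%N ++ [:: 0%N; 1%N])
| Tuple_twos k2 of (k2 <= r - 2)%N :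
    labelled_tuple r (Lab (2 * r - 2 - k2))
      (nseq k2 1%N ++ nseq (r - 2 - k2) 2%N ++ [:: 1%N; 1%N]).

(* x / (x + 1): every factor P_i, Q_i, R_i, X, Y, .. has this shape *)
Definition shift_ratio (C : numFieldType) (x : C) : C := x / (x + 1).

Definition sum_from_to (C : numFieldType) (L : nat -> C) (a b : nat) : C :=
  \sum_(a <= m < b.+1) L m.

(* In the formulas below L i stands for lambda_i.  The subtractions whose     *)
(* result is not an index are made in C, since subtraction truncates on nat.  *)

Definition coef_i (C : numFieldType) (L : nat -> C) (l j : nat) : C :=
  \prod_(1 <= i < j.+1) ((sum_from_to L i l + l%:R - i%:R)
                         / (sum_from_to L i l + l%:R - i%:R + 1)).

Definition coef_ii (C : numFieldType) (L : nat -> C) (r j : nat) : C :=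
  \prod_(1 <= i < j.+1)
    ((sum_from_to L i (r - 2) + L r + r%:R - 1 - i%:R)
     / (sum_from_to L i (r - 2) + L r + r%:R - i%:R)).

Definition coef_iii (C : numFieldType) (L : nat -> C) (r j : nat) : C :=
  \prod_(1 <= i < j.+1)
    ((sum_from_to L i r + r%:R - i%:R)
     / (sum_from_to L i r + r%:R + 1 - i%:R)).

Definition facP (C : numFieldType) (L : nat -> C) (r l i : nat) : C :=
  shift_ratio (sum_from_to L i (2 * r - 2 - l)
               + 2 * sum_from_to L (2 * r - l - 1) (r - 2)
               + L r.-1 + L r + l%:R - i%:R).

Definition facQ (C : numFieldType) (L : nat -> C) (r l i : nat) : C :=
  shift_ratio (sum_from_to L (2 * r - 1 - l) i
               + 2 * sum_from_to L i.+1 (r - 2)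
               + L r.-1 + L r + l%:R - i%:R - 1).

Definition facR (C : numFieldType) (L : nat -> C) (r l i : nat) : C :=
  shift_ratio (sum_from_to L (2 * r - l - 1) i
               + l%:R + i%:R + 1 - 2 * r%:R).

Definition facX (C : numFieldType) (L : nat -> C) (r l : nat) : C :=
  shift_ratio (sum_from_to L (2 * r - 1 - l) (r - 2) + L r.-1 + l%:R - r%:R).

Definition facY (C : numFieldType) (L : nat -> C) (r l : nat) : C :=
  shift_ratio (sum_from_to L (2 * r - 1 - l) (r - 2) + L r + l%:R - r%:R).

Definition numM (C : numFieldType) (L : nat -> C) (r l : nat) : C :=
  2 * sum_from_to L (2 * r - l - 1) (r - 2) + L r.-1 + L r
  + 2 * l%:R - 2 * r%:R.

Definition represents_i (C : numFieldType) (L : nat -> C) (r l : nat)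
    (y : nat -> {poly C}) : Prop :=
  (forall j, (1 <= j <= l)%N -> y j = 'X - (coef_i L l j)%:P)
  /\ (forall j, (l < j <= r)%N -> y j = 1).

Definition represents_ii (C : numFieldType) (L : nat -> C) (r : nat)
    (y : nat -> {poly C}) : Prop :=
  [/\ forall j, (1 <= j <= r - 2)%N -> y j = 'X - (coef_ii L r j)%:P,
      y r.-1 = 1 &
      y r = 'X - (L r / (L r + 1) * coef_ii L r (r - 2))%:P].

Definition represents_iii (C : numFieldType) (L : nat -> C) (r : nat)
    (y : nat -> {poly C}) : Prop :=
  [/\ forall j, (1 <= j <= r - 2)%N -> y j = 'X - (coef_iii L r j)%:P,
      y r.-1 = 'X - (L r.-1 / (L r.-1 + 1) * coef_iii L r (r - 2))%:P &
      y r = 'X - (L r / (L r + 1) * coef_iii L r (r - 2))%:P].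

Definition represents_iv (C : numFieldType) (L : nat -> C) (r l : nat)
    (y : nat -> {poly C}) : Prop :=
  let P := facP L r l in let Q := facQ L r l in let R := facR L r l in
  let X := facX L r l in let Y := facY L r l in let M := numM L r l in
  let k0 := (2 * r - 1 - l)%N in
  let prodP := \prod_(1 <= i < k0) P i in
  let prodQ := \prod_(k0 <= i < r.-1) Q i in
  [/\ forall j, (1 <= j <= 2 * r - l - 2)%N ->
        y j = 'X - (\prod_(1 <= i < j.+1) P i)%:P,
      forall k, (k0 <= k <= r - 2)%N -> exists a b : C,
        [/\ y k = ('X - a%:P) * ('X - b%:P),
            a * b = prodP ^+ 2 * prodQ * \prod_(k0 <= i < k) Q i
                    * \prod_(k <= i < r.-1) R i * X * Y &
            a + b = prodP * \prod_(k0 <= i < k) Q i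
                    * (M / (M + 1)
                       + (M + 2) / (M + 1) * X * Y
                         * \prod_(k <= i < r.-1) Q i
                         * \prod_(k <= i < r.-1) R i)],
      y r.-1 = 'X - (X * prodP * prodQ)%:P &
      y r = 'X - (Y * prodP * prodQ)%:P].

Definition represents (C : numFieldType) (L : nat -> C) (r : nat) (lab : label)
    (y : nat -> {poly C}) : Prop :=
  match lab with
  | Lab l => if (l < r)%N then represents_i L r l y
             else if l == r then represents_iii L r y
             else represents_iv L r l y
  | LabBar => represents_ii L r y
  end.

(* Consistency of the realization with the usual conventions for D_r.         *)

Lemma inv_formDl (C : numFieldType) (r : nat) (u v w : 'rV[C]_r) :
  inv_form (u + v) w = inv_form u w + inv_form v w.
Proof.
by rewrite -big_split; apply: eq_bigr => j _; rewrite mxE mulrDl.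
Qed.

Lemma inv_formNl (C : numFieldType) (r : nat) (u w : 'rV[C]_r) :
  inv_form (- u) w = - inv_form u w.
Proof.
by rewrite -sumrN; apply: eq_bigr => j _; rewrite mxE mulNr.
Qed.

Lemma inv_formC (C : numFieldType) (r : nat) (u v : 'rV[C]_r) :
  inv_form u v = inv_form v u.
Proof. by apply: eq_bigr => j _; rewrite mulrC. Qed.

Lemma inv_formDr (C : numFieldType) (r : nat) (u v w : 'rV[C]_r) :
  inv_form w (u + v) = inv_form w u + inv_form w v.
Proof. by rewrite inv_formC inv_formDl !(inv_formC w). Qed.

Lemma inv_formNr (C : numFieldType) (r : nat) (u w : 'rV[C]_r) :
  inv_form w (- u) = - inv_form w u.
Proof. by rewrite inv_formC inv_formNl (inv_formC w). Qed.

Lemma inv_form_eps (C : numFieldType) (r i j : nat) : (1 <= i <= r)%N ->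
  inv_form (eps C r i) (eps C r j) = (i == j)%:R.
Proof.
case: i => // i /= lt_ir; rewrite /inv_form (bigD1 (Ordinal lt_ir)) //=.
rewrite big1 => [|k ne_ki]; last first.
  rewrite !mxE eqSS; case: eqP => [e|]; last by rewrite mul0r.
  by case/eqP: ne_ki; apply: val_inj.
by rewrite !mxE /= eqxx mul1r addr0.
Qed.

Lemma inv_form_alpha (C : numFieldType) (r i j : nat) :
  (4 <= r)%N -> (1 <= i <= r)%N -> (1 <= j <= i)%N ->
  inv_form (alpha C r i) (alpha C r j) =
    if i == j then 2
    else if (i < r)%N && (i == j.+1) then -1
    else if (i == r) && (j == r - 2)%N then -1 else 0.
Proof.
move=> r4 i_bd j_bd; have E a b := @inv_form_eps C r a b.
rewrite /alpha; case: (ltnP i r) => ?;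
  case: (eqVneq i r) => [ei|ni]; case: (eqVneq j r) => [ej|nj];
  rewrite !(inv_formDl, inv_formDr, inv_formNl, inv_formNr) !E; try lia;
  do ![case: (@eqP nat _ _) => ?] => //=; try lia; ring.
Qed.

Lemma dynkin_omega1 (C : numFieldType) (r i : nat) :
  (4 <= r)%N -> (1 <= i <= r)%N -> dynkin (omega1 C r) i = (i == 1%N)%:R.
Proof.
move=> r4 i_bd; rewrite /dynkin inv_form_alpha ?leqnn ?andbT //; last lia.
rewrite eqxx mulrAC divff ?pnatr_eq0 // mul1r /omega1 /alpha.
case: eqP => [ei|ni]; rewrite !(inv_formDr, inv_formNr) !inv_form_eps; try lia;
  do ![case: (@eqP nat _ _) => ?] => //=; try lia; ring.
Qed.

Lemma so_cartan (C : numFieldType) (r : nat) (x : 'rV[C]_r) : so (cartan x).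
Proof.
rewrite /so /cartan /so_gram tr_block_mx !mulmx_block.
rewrite !(trmx0, mulmx0, mul0mx, mulmx1, mul1mx, addr0, add0r).
by rewrite add_block_mx linearN /= tr_diag_mx !addr0 subrr addNr block_mx0.
Qed.

Lemma trmx_elem_mx (C : numFieldType) (r i j : nat) :
  (elem_mx C r i j)^T = elem_mx C r j i.
Proof. by apply/matrixP => a b; rewrite !mxE andbC. Qed.

Lemma so_root_vector (C : numFieldType) (r i : nat) : so (root_vector C r i).
Proof.
rewrite /so /root_vector /so_gram; case: eqP => _;
  rewrite tr_block_mx !mulmx_block
    !(trmx0, mulmx0, mul0mx, mulmx1, mul1mx, addr0, add0r) add_block_mx.
  rewrite linearB /= !trmx_elem_mx !addr0 addrC addrA subrK subrr.
  by rewrite block_mx0.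
by rewrite linearN /= !trmx_elem_mx !addr0 subrr addNr block_mx0.
Qed.

Lemma diag_elem_mx (C : numFieldType) (r i j : nat) (x : 'rV[C]_r) :
  diag_mx x *m elem_mx C r i j = inv_form x (eps C r i) *: elem_mx C r i j.
Proof.
apply/matrixP => a b; rewrite mul_diag_mx !mxE.
case: (@eqP nat _ i) => [ea|_]; last by rewrite !mulr0.
case: (@eqP nat _ j) => _; rewrite ?mulr0 // !mulr1 /inv_form (bigD1 a) //=.
rewrite mxE ea eqxx mulr1 big1 ?addr0 // => c ne_ca; rewrite mxE -ea eqSS.
by case: eqP => [e|_]; [case/eqP: ne_ca; apply: val_inj | rewrite mulr0].
Qed.

Lemma elem_diag_mx (C : numFieldType) (r i j : nat) (x : 'rV[C]_r) :
  elem_mx C r i j *m diag_mx x = inv_form x (eps C r j) *: elem_mx C r i j.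
Proof.
by apply: trmx_inj; rewrite trmx_mul linearZ /= tr_diag_mx trmx_elem_mx
  diag_elem_mx.
Qed.

Lemma lie_cartan_root_vector (C : numFieldType) (r i : nat) (x : 'rV[C]_r) :
  lie (cartan x) (root_vector C r i) =
  inv_form x (alpha C r i) *: root_vector C r i.
Proof.
rewrite /lie /cartan /root_vector /alpha; case: eqP => _;
  rewrite !mulmx_block !(mulmx0, mul0mx, addr0, add0r) opp_block_mx
    add_block_mx scale_block_mx !(scaler0, oppr0, subr0);
  rewrite !(mulmxBr, mulmxBl, mulNmx, mulmxN) !(diag_elem_mx, elem_diag_mx)
    !(inv_formDr, inv_formNr);
  congr block_mx; apply/matrixP => a b; rewrite !mxE; ring.
Qed.

Lemma size_colors (l : seq nat) : size (colors l) = sumn l.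
Proof.
rewrite /colors size_flatten; congr sumn.
apply: (@eq_from_nth _ 0%N) => [|i]; rewrite !size_map size_iota // => lt_il.
by rewrite (nth_map [::]) ?(nth_map 0%N) ?size_map ?size_iota // nth_iota //
  size_nseq.
Qed.

Lemma count_colors (l : seq nat) (i : nat) : (1 <= i <= size l)%N ->
  count_mem i (colors l) = nth 0%N l i.-1.
Proof.
move=> i_bd; rewrite /colors count_flatten -map_comp sumnE big_map.
have i_in : i \in iota 1 (size l) by rewrite mem_iota; lia.
rewrite (bigD1_seq i) ?iota_uniq //=.
rewrite count_nseq /= eqxx mul1n big1 ?addn0 // => k /negPf ne_ki.
by rewrite count_nseq /= ne_ki mul0n.
Qed.

Lemma sorted_colors (l : seq nat) : sorted leq (colors l).
Proof.
rewrite /colors; move: (size l) 1%N => n m.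
elim: n m => //= n IHn m.
set s := flatten _; have {IHn} : sorted leq s by apply: IHn.
have : all (leq m) s.
  apply/allP => k /flattenP[_ /mapP[i + ->]]; rewrite mem_iota => /andP[lt_mi _].
  by move=> /nseqP[-> _]; apply: ltnW.
elim: (nth _ _ _) => //= p IHp m_s s_sorted.
rewrite (path_sortedE leq_trans) IHp // andbT all_cat m_s andbT.
by apply/allP => k /nseqP[-> _].
Qed.

Lemma size_labelled_tuple (r : nat) (lab : label) (l : seq nat) :
  (4 <= r)%N -> labelled_tuple r lab l -> size l = r.
Proof.
by move=> r4 []; intros; rewrite !size_cat ?size_nseq /=; lia.
Qed.

(* Main.v *)
(* At a node carrying one variable u, next to a chain already solved, the     *)
(* Bethe equation says that u is x / (x + 1) times the preceding variable;    *)
(* such ratios propagate from the leaves of the diagram towards omega_1.  At  *)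
(* a node carrying two variables a, b (y = (x - a)(x - b)) with label n <> 0, *)
(* the two Bethe equations mean that there is a linear polynomial x - d, the  *)
(* reproduction of y, with                                                    *)
(*   (n + 1) y (x - d) + x y - x y' (x - d) = n (product of neighbours).      *)
(* Replacing y by x - d adds n + 1 to the labels of the neighbours; doing so  *)
(* for the doubled nodes one after the other, from the first one outwards,    *)
(* leaves a diagram with one variable per node, and the sums and products of  *)
(* the pairs are recovered from the coefficients of these identities.         *)
(*                                                                            *)
(* For admissibility, V_mu is cut out of tensor products of exterior and spin *)
(* modules, all unitary, so that adjoints turn an equivariant embedding into  *)
(* a projection.  On these modules contraction and Clifford multiplication    *)
(* give equivariant maps to the tensor product with the vector module, which  *)
(* lead from highest weight mu + eps_k to highest weight mu; their adjoints   *)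
(* lead back.  Conversely, when the condition on the labels of lambda fails,  *)
(* the target weight has a label -1, which sl_2-theory excludes.              *)
Require Import Defs.
From mathcomp Require Import all_boot all_order all_fingroup all_algebra.
From mathcomp Require Import ring zify.
From mathcomp Require Import boolp reals.
From mathcomp.real_closed Require Import complex mxtens.
Set Implicit Arguments.
Unset Strict Implicit.
Unset Printing Implicit Defensive.
Import Order.TTheory GRing.Theory Num.Theory.
Local Open Scope ring_scope.

(** Both sides of the theorem are compared with [label_condition], an explicit positivity condition
    on the labels of lambda. [admissible_label_condition] and [label_condition_admissible] identify
    it with admissibility; [classify] identifies it with solvability of the Bethe equation and shows
    that every solution has the stated form. Uniqueness follows: the formulas determine the
    polynomials ([represents_inj]), and these determine the coordinates up to a permutation
    preserving colours ([same_solution_of_polys]).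

    On the Bethe side, [bethe_solutionE] replaces the coordinates by one list of roots per node, the
    point 1 becoming the root of an extra node 0. If every node carries at most one root,
    elimination starts at the ends of the diagram away from node 0: a leaf of label x next to e has
    root x/(x+1) times e, and it acts on e like x+1 additional units of label. Parameters therefore
    add up along the diagram, and the roots are products of ratios. A leaf of label 0 would feel a
    single nonzero force, which is impossible; hence the condition.

    If the nodes k+1, ..., r-2 carry two roots, the equations at such a node say that y and x^(n+1)
    (x - d) have Wronskian n x^n times the product of the neighbours ([reproduction_exists]). At a
    root of a neighbour the pair may then be traded for the single point d and n+1 units of label
    ([reproduction_at_root]). Going outwards this produces the centers d; coming back from the
    leaves, their ratios are found ([step_ratio_fork], [step_ratio_double]), and then the sum and
    product of each pair from those of the next one ([reproduction_quad_pair]). The last lemma is an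
    equivalence, so it also gives existence, where positivity of all parameters keeps the roots
    nonzero and apart. The delicate point of the outward pass is a root at 0 on a node of label 0,
    where the equation has no pole at 0; [no_double_node_at_zero], [reproduction_step] and
    [double_leaf_nonzero] deal with it.

    On the module side the target weight is lambda plus or minus some eps_k ([target_weightE]).
    Necessity is sl_2-theory ([highest_weight_pairing]). For sufficiency, [linked_modules] builds
    irreducible unitary modules of highest weights mu + eps_k and mu joined by a nonzero equivariant
    map, which [summand_of_ops] splits; [vector_ops_adjoint] reverses its direction. *)

(** * Algebra at a single node *)

(* [lia] would case-split on every boolean hypothesis about field elements. *)
Ltac nlia :=
  repeat match goal with
  | C : Num.NumField.type, H : ?P |- _ =>
      lazymatch P with context [C] => clear H end
  end; lia.

Section NodeAlgebra.
Variable C : numFieldType.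
Implicit Types (n lam x u v w e d a b : C).

(** Multiplied by x^n, this is the Wronskian identity W(y, x^(n+1) (x - d)) = n x^n (x - e)(x -
    a')(x - b') with y = (x - a)(x - b). It is quantified over field elements because it is used by
    evaluating it at roots. *)
Definition reproduction n e a b d a' b' : Prop := forall x,
  (n + 1) * ((x - a) * (x - b) * (x - d)) + x * (x - a) * (x - b)
    - x * ((x - a) + (x - b)) * (x - d)
  = n * ((x - e) * (x - a') * (x - b')).

Lemma prod_eq0_imp (p q : C) : p != 0 -> p * q = 0 -> q = 0.
Proof. by move=> p0 /eqP; rewrite mulf_eq0 (negPf p0) => /eqP. Qed.

(** Both sides of the identity are cubics with leading coefficient n. The choice of [d] makes them
    agree at a, the equation at a makes this agreement double, so they differ by a multiple h of (x
    - a)^2, and the equation at b gives n (b - a)^3 h = 0. *)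
Lemma reproduction_exists n e a b a' b' :
  a != b -> a != 0 -> b != 0 -> n != 0 ->
  a != e -> a != a' -> a != b' -> b != e -> b != a' -> b != b' ->
  n / a + (1 / (a - e) + 1 / (a - a') + 1 / (a - b')) = 2 / (a - b) ->
  n / b + (1 / (b - e) + 1 / (b - a') + 1 / (b - b')) = 2 / (b - a) ->
  exists d, reproduction n e a b d a' b'.
Proof.
move=> ab a0 b0 n0 ae aa' ab' be ba' bb' Ea Eb.
have clear u v : u != v -> u != 0 -> u != e -> u != a' -> u != b' ->
  n / u + (1 / (u - e) + 1 / (u - a') + 1 / (u - b')) = 2 / (u - v) ->
  n * ((u - e) * (u - a') * (u - b')) * (u - v)
  + u * (u - v) * ((u - a') * (u - b') + (u - e) * (u - b') + (u - e) * (u - a'))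
  = 2 * u * ((u - e) * (u - a') * (u - b')).
  move=> uv u0 ue ua ub E; apply/eqP; rewrite -subr_eq0.
  have -> : n * ((u - e) * (u - a') * (u - b')) * (u - v)
  + u * (u - v) * ((u - a') * (u - b') + (u - e) * (u - b') + (u - e) * (u - a'))
   - 2 * u * ((u - e) * (u - a') * (u - b')) =
   (n / u + (1 / (u - e) + 1 / (u - a') + 1 / (u - b')) - 2 / (u - v)) *
   (u * (u - v) * ((u - e) * (u - a') * (u - b'))).
     by field; rewrite !subr_eq0 uv u0 ue ua ub.
  by rewrite E subrr mul0r.
move/clear: Ea => {}/(_ ab a0 ae aa' ab') Ea.
have ba : b != a by rewrite eq_sym.
move/clear: Eb => {}/(_ ba b0 be ba' bb') Eb.
have ab1 : a - b != 0 by rewrite subr_eq0.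
pose G x := (x - e) * (x - a') * (x - b').
pose G' x := (x - a') * (x - b') + (x - e) * (x - b') + (x - e) * (x - a').
pose d := a + n * G a / (a * (a - b)).
have nGa : n * G a = - a * (a - b) * (a - d).
  by rewrite /d; field; rewrite a0 ab1.
(* The derivative at a of the difference of the two sides. *)
pose H' := (a - d) * (n * (a - b) - 2 * a) - n * G' a.
have H'0 : H' = 0.
  apply: (@prod_eq0_imp (a * (a - b))); first by rewrite mulf_neq0.
  have -> : a * (a - b) * H' = - (n * G a) * (n * (a - b) - 2 * a)
     - n * (a * (a - b) * G' a) by rewrite nGa /H'; ring.
  have -> : a * (a - b) * G' a = 2 * a * G a - n * G a * (a - b).
    by rewrite -[2 * a * G a]Ea /G /G'; ring.
  ring.
pose h := n * (e + a' + b') - ((n + 1) * (a + b) + (n - 1) * d).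
have H x : (n + 1) * ((x - a) * (x - b) * (x - d)) + x * (x - a) * (x - b)
    - x * ((x - a) + (x - b)) * (x - d) - n * G x = h * (x - a) ^+ 2.
  have -> : (n + 1) * ((x - a) * (x - b) * (x - d)) + x * (x - a) * (x - b)
    - x * ((x - a) + (x - b)) * (x - d) - n * G x = h * (x - a) ^+ 2
     + (- a * (a - b) * (a - d) - n * G a) + (x - a) * H'.
    rewrite /h /H' /G /G'; ring.
  by rewrite nGa H'0; ring.
exists d => x; apply/eqP; rewrite -subr_eq0 H; apply/eqP.
suff -> : h = 0 by ring.
have h1 : n * G b = - b * (b - a) * (b - d) - h * (b - a) ^+ 2.
  by rewrite -H; ring.
have h2 : n * G' b = (b - d) * (n * (b - a) - 2 * b) - 2 * h * (b - a).
  rewrite -[RHS]subr0 -H'0 /H' /h /G'; ring.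
have : n * (n * G b) * (b - a) + b * (b - a) * (n * G' b) = 2 * b * (n * G b).
  transitivity (n * (n * G b * (b - a) + b * (b - a) * G' b)); first by ring.
  by rewrite Eb /G; ring.
rewrite h1 h2 => E.
apply: (@prod_eq0_imp (n * (b - a) ^+ 3)).
  by rewrite mulf_neq0 // expf_neq0 // subr_eq0.
apply/eqP; rewrite -oppr_eq0 -(subrr (2 * b * (- b * (b - a) * (b - d) - h * (b - a) ^+ 2))) -{1}E.
by apply/eqP; ring.
Qed.

(* For a monic cubic G, (a - b) (G' a + G' b) - 2 (G a - G b) = (a - b) ^ 3. *)
Lemma no_double_node_at_zero a b e a' b' :
  a != b ->
  a != e -> a != a' -> a != b' -> b != e -> b != a' -> b != b' ->
  1 / (a - e) + 1 / (a - a') + 1 / (a - b') = 2 / (a - b) ->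
  1 / (b - e) + 1 / (b - a') + 1 / (b - b') = 2 / (b - a) -> False.
Proof.
move=> ab ae aa' ab' be ba' bb' Ea Eb.
have ba : b != a by rewrite eq_sym.
have clear u v : u != v -> u != e -> u != a' -> u != b' ->
  1 / (u - e) + 1 / (u - a') + 1 / (u - b') = 2 / (u - v) ->
  (u - v) * ((u - a') * (u - b') + (u - e) * (u - b') + (u - e) * (u - a'))
  = 2 * ((u - e) * (u - a') * (u - b')).
  move=> uv ue ua ub E; apply/eqP; rewrite -subr_eq0.
  have -> :
  (u - v) * ((u - a') * (u - b') + (u - e) * (u - b') + (u - e) * (u - a'))
   - 2 * ((u - e) * (u - a') * (u - b')) =
   (1 / (u - e) + 1 / (u - a') + 1 / (u - b') - 2 / (u - v)) *
   ((u - v) * ((u - e) * (u - a') * (u - b'))).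
     by field; rewrite !subr_eq0 uv ue ua ub.
  by rewrite E subrr mul0r.
move/clear: Ea => {}/(_ ab ae aa' ab') Ea.
move/clear: Eb => {}/(_ ba be ba' bb') Eb.
have : (a - b) ^+ 3 = 0.
  transitivity ((a - b) * ((a - a') * (a - b') + (a - e) * (a - b') + (a - e) * (a - a'))
    - 2 * ((a - e) * (a - a') * (a - b'))
    - ((b - a) * ((b - a') * (b - b') + (b - e) * (b - b') + (b - e) * (b - a'))
    - 2 * ((b - e) * (b - a') * (b - b')))); first by ring.
  by rewrite Ea Eb !subrr.
by move/eqP; rewrite expf_eq0 /= subr_eq0 (negPf ab).
Qed.

(** The cubic terms agree automatically, so the values at 0, 1 and -1 suffice to separate the three
    remaining coefficients. *)
Lemma reproduction_coef n e a b d a' b' :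
  reproduction n e a b d a' b' <->
  [/\ (n + 1) * (a + b) + (n - 1) * d = n * (e + (a' + b')),
      (n + 2) * (a * b) + n * (a + b) * d = n * (a' * b' + e * (a' + b')) &
      (n + 1) * (a * b) * d = n * e * (a' * b')].
Proof.
split=> [H|[H2 H1 H0] x].
  have E0 : (n + 1) * (a * b) * d = n * e * (a' * b').
    by apply: oppr_inj; transitivity (n * ((0 - e) * (0 - a') * (0 - b')));
      [rewrite -H|]; ring.
  have := H 1; have := H (-1) => E1 E2; split=> //.
    apply: (@mulfI _ (- 2)); first by rewrite oppr_eq0 pnatr_eq0.
    transitivity (n * ((1 - e) * (1 - a') * (1 - b'))
      + n * ((- 1 - e) * (- 1 - a') * (- 1 - b'))
      + 2 * (n * e * (a' * b'))); last by ring.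
    by rewrite -E0 -E1 -E2; ring.
  apply: (@mulfI _ 2); first by rewrite pnatr_eq0.
  transitivity (n * ((1 - e) * (1 - a') * (1 - b'))
    - n * ((- 1 - e) * (- 1 - a') * (- 1 - b')) - 2 * n); last by ring.
  by rewrite -E1 -E2; ring.
transitivity (n * x ^+ 3 - n * (e + (a' + b')) * x ^+ 2
   + n * (a' * b' + e * (a' + b')) * x - n * e * (a' * b')); last by ring.
by rewrite -H2 -H1 -H0; ring.
Qed.

Lemma reproductionC n e a b d a' b' :
  reproduction n e a b d a' b' -> reproduction n e a b d b' a'.
Proof. by move=> H x; rewrite H; ring. Qed.

(** At a root of the right-hand side the identity, divided by u (u - a)(u - b)(u - d), becomes an
    equality of forces. A neighbour thus cannot distinguish the pair a, b from the single point d
    with n+1 more units of label. *)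
Lemma reproduction_at_root n e a b d a' b' u :
  reproduction n e a b d a' b' -> [\/ u = e, u = a' | u = b'] ->
  u != 0 -> u != a -> u != b ->
  u != d /\ 1 / (u - a) + 1 / (u - b) = (n + 1) / u + 1 / (u - d).
Proof.
move=> H uE u0 ua ub.
have {uE} E : (n + 1) * ((u - a) * (u - b) * (u - d)) + u * (u - a) * (u - b)
    - u * ((u - a) + (u - b)) * (u - d) = 0.
  by rewrite H; case: uE => ->; rewrite !subrr !(mul0r, mulr0).
have ud : u != d.
  apply/eqP => ud; move: E; rewrite ud subrr !mulr0 add0r subr0 -ud.
  by apply/eqP; rewrite !mulf_neq0 // subr_eq0.
split=> //; apply/eqP; rewrite eq_sym -subr_eq0.
rewrite (_ : _ - _ = ((n + 1) * ((u - a) * (u - b) * (u - d))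
    + u * (u - a) * (u - b) - u * ((u - a) + (u - b)) * (u - d))
    / (u * (u - a) * (u - b) * (u - d))); first by rewrite E mul0r.
by field; rewrite !subr_eq0 u0 ua ub ud.
Qed.

(** The degenerate case of the induction: the center d and one root of the next node, whose label is
    0, both lie at 0. A reproduction of the next node still exists, with center -e. *)
Lemma reproduction_step_at_zero n e a b b' a'' b'' :
  0 < n -> reproduction n e a b 0 0 b' -> e != 0 -> a * b != 0 ->
  b' != 0 -> b' != a -> b' != b ->
  a'' != 0 -> b'' != 0 -> b' != a'' -> b' != b'' ->
  1 / (0 - a) + 1 / (0 - b) + (1 / (0 - a'') + 1 / (0 - b'')) = 2 / (0 - b') ->
  1 / (b' - a) + 1 / (b' - b) + (1 / (b' - a'') + 1 / (b' - b'')) =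
    2 / (b' - 0) ->
  reproduction (n + 1) 0 0 b' (- e) a'' b''.
Proof.
move=> n0 H e0 ab0 b'0 b'a b'b a''0 b''0 ba'' bb'' E0 E1.
have [_] := reproduction_at_root H (Or33 _ _ erefl) b'0 b'a b'b.
rewrite !subr0 => K.
move: (ab0); rewrite mulf_eq0 negb_or => /andP[a0 b0].
have nn : n != 0 by rewrite gt_eqF.
have nn2 : n + 2 != 0 by rewrite gt_eqF // addr_gt0.
have [c2 c1 _] := (reproduction_coef _ _ _ _ _ _ _).1 H.
have {c2} c2 : (n + 1) * (a + b) = n * (e + b').
  by rewrite -[b' in RHS]add0r -c2; ring.
have {c1} c1 : (n + 2) * (a * b) = n * e * b'.
  by transitivity (n * (0 * b' + e * (0 + b'))); [rewrite -c1|]; ring.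
have A : (n + 2) * b' ^+ 2 - (n + 1) * (a'' + b'') * b' + n * (a'' * b'') = 0.
  rewrite K subr0 in E1; apply/eqP.
  rewrite (_ : _ + _ = ((n + 1) / b' + 1 / b' + (1 / (b' - a'') + 1 / (b' - b''))
     - 2 / b') * (b' * (b' - a'') * (b' - b''))); last first.
    by field; rewrite !subr_eq0 b'0 ba'' bb''.
  by rewrite E1 subrr mul0r.
have B : b' * ((a + b) * (a'' * b'') + (a'' + b'') * (a * b)) =
         2 * (a * b) * (a'' * b'').
  apply/eqP; rewrite -subr_eq0.
  rewrite (_ : _ - _ = - (1 / (0 - a) + 1 / (0 - b) + (1 / (0 - a'') + 1 / (0 - b''))
     - 2 / (0 - b')) * (b' * a * b * a'' * b'')); last first.
    by field; rewrite ?sub0r ?oppr_eq0 b'0 a0 b0 a''0 b''0.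
  by rewrite E0 subrr oppr0 mul0r.
have p'' : a'' * b'' = - e * b'.
  apply/eqP; rewrite -subr_eq0; apply/eqP.
  (* [A] is the equation at b' and [B] the one at 0; eliminating a'' + b'' between them, with a + b
     and ab taken from [c2] and [c1], leaves this multiple of a'' b'' + e b'. *)
  apply: (@prod_eq0_imp (n * (n + 2) * b' ^+ 2)).
    by rewrite !mulf_neq0 // expf_neq0.
  transitivity (b' * ((n + 2) * ((n + 1) * (a + b)) * (a'' * b'')
      + (n + 1) * (a'' + b'') * ((n + 2) * (a * b)))
    - 2 * (n + 1) * ((n + 2) * (a * b)) * (a'' * b'')
    + n * e * b' * ((n + 2) * b' ^+ 2 - (n + 1) * (a'' + b'') * b'
                    + n * (a'' * b''))).
    by rewrite c1 c2; ring.
  rewrite A mulr0 addr0.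
  transitivity ((n + 1) * (n + 2) *
   (b' * ((a + b) * (a'' * b'') + (a'' + b'') * (a * b)) -
      2 * (a * b) * (a'' * b''))); first by ring.
  by rewrite B subrr mulr0.
have s'' : (n + 1) * (a'' + b'') = (n + 2) * b' - n * e.
  apply: (mulIf b'0); apply/eqP; rewrite eq_sym -subr_eq0 -A p''.
  by apply/eqP; ring.
apply/reproduction_coef; split; last by ring.
  by rewrite (add0r (a'' + b'')) s''; ring.
by rewrite p''; ring.
Qed.

(** If a'b' is nonzero, the previous pair is traded for d and [reproduction_exists] applies with
    label n + lam + 1. The coefficients of the given identity show that a'b' = 0 happens only for d
    = 0 and e nonzero; the next center is then -e, so the invariant d = 0 -> ab != 0 holds again,
    vacuously. *)
Lemma reproduction_step n lam e a b d a' b' a'' b'' :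
  0 < n -> 0 <= lam -> reproduction n e a b d a' b' ->
  (d = 0 -> a * b != 0) ->
  a' != b' -> a' != a -> a' != b -> b' != a -> b' != b ->
  a' != a'' -> a' != b'' -> b' != a'' -> b' != b'' ->
  (lam != 0 -> a' != 0) -> (lam != 0 -> b' != 0) ->
  lam / a' + (1 / (a' - a) + 1 / (a' - b) + (1 / (a' - a'') + 1 / (a' - b'')))
    = 2 / (a' - b') ->
  lam / b' + (1 / (b' - a) + 1 / (b' - b) + (1 / (b' - a'') + 1 / (b' - b'')))
    = 2 / (b' - a') ->
  exists d', reproduction (n + lam + 1) d a' b' d' a'' b'' /\
    (d' = 0 -> a' * b' != 0).
Proof.
move=> n0 l0 H inv ab' aa ab ba bb aa'' ab'' ba'' bb'' la lb Ea Eb.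
have nn : n != 0 by rewrite gt_eqF.
have nl : n + lam + 1 != 0.
  by rewrite gt_eqF // addr_gt0 // (lt_le_trans n0) // lerDl.
have [_ _ c0] := (reproduction_coef _ _ _ _ _ _ _).1 H.
have nn1 : n + 1 != 0 by rewrite gt_eqF // addr_gt0.
have generic : a' * b' != 0 ->
    exists d', reproduction (n + lam + 1) d a' b' d' a'' b'' /\
    (d' = 0 -> a' * b' != 0).
  move=> p0; move: (p0); rewrite mulf_eq0 negb_or => /andP[a'0 b'0].
  have [a'd Ka] := reproduction_at_root H (Or32 _ _ erefl) a'0 aa ab.
  have [b'd Kb] := reproduction_at_root H (Or33 _ _ erefl) b'0 ba bb.
  have [||d' H'] := @reproduction_exists (n + lam + 1) d a' b' a'' b''
    ab' a'0 b'0 nl a'd aa'' ab'' b'd ba'' bb''.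
  - by rewrite -Ea Ka; ring.
  - by rewrite -Eb Kb; ring.
  by exists d'; split=> // _; rewrite a'0 b'0.
case: (eqVneq d 0) => [d0|d0]; last first.
  (* For d nonzero, the constant coefficient turns a root at 0 in the new pair into one in the old
     pair, and neighbouring roots would collide. *)
  have abd p q : a' * b' = 0 -> p != a -> p != b -> q != a -> q != b ->
      a' * b' = p * q -> False.
    move=> ab0 pa pb qa qb pq; move: c0; rewrite ab0 mulr0 => /eqP.
    rewrite !mulf_eq0 (negPf d0) (negPf nn1) /= orbF => /orP[] /eqP z.
      by move/eqP: ab0; rewrite pq mulf_eq0 -z (negPf pa) (negPf qa).
    by move/eqP: ab0; rewrite pq mulf_eq0 -z (negPf pb) (negPf qb).
  by apply: generic; apply/eqP => /abd/(_ aa ab ba bb) []; ring.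
have p0 := inv d0; case: (eqVneq e 0) => [e0|e0].
  apply: generic; have [_ c1 _] := (reproduction_coef _ _ _ _ _ _ _).1 H.
  apply/eqP => p; move: c1; rewrite d0 e0 p !(mulr0, mul0r, addr0) => /eqP.
  by rewrite mulf_eq0 (negPf p0) gt_eqF // addr_gt0.
rewrite {}d0 {inv} in H c0 *.
have p : a' * b' = 0.
  by apply: (@prod_eq0_imp (n * e)); rewrite ?mulf_neq0 // -c0 mulr0.
exists (- e); split; last by move/eqP; rewrite oppr_eq0 (negPf e0).
move/eqP: p; rewrite mulf_eq0 => /orP[] /eqP z; subst.
  have lam0 : lam = 0 by apply/eqP/negP => /negP/la; rewrite eqxx.
  rewrite lam0 addr0; rewrite lam0 mul0r add0r in Ea; rewrite lam0 mul0r add0r in Eb.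
  rewrite eq_sym in ab'; rewrite ![0 == _]eq_sym in aa'' ab''.
  exact: (reproduction_step_at_zero n0 H).
have lam0 : lam = 0 by apply/eqP/negP => /negP/lb; rewrite eqxx.
rewrite lam0 addr0; rewrite lam0 mul0r add0r in Ea; rewrite lam0 mul0r add0r in Eb.
rewrite ![0 == _]eq_sym in ba'' bb''.
have := reproduction_step_at_zero n0 (reproductionC H) e0 p0 ab' aa ab ba'' bb''
  aa'' ab'' Eb Ea.
by move=> G x; rewrite -G; ring.
Qed.

(* [step_ratio x e d] says d / e = x / (x + 1). *)
Definition step_ratio x e d : Prop := (x + 1) * d = x * e.

Lemma step_ratio_neq0 x e d : 0 < x -> step_ratio x e d -> d != 0 -> e != 0.
Proof.
rewrite /step_ratio => x0 E d0; apply/eqP => e0; move/eqP: E.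
by rewrite e0 mulr0 mulf_eq0 (negPf d0) orbF gt_eqF // addr_gt0.
Qed.

Lemma step_ratioE x e d : 0 <= x -> step_ratio x e d -> d = x / (x + 1) * e.
Proof.
move=> x0 E; have x1 : x + 1 != 0 by rewrite gt_eqF // ltr_wpDl.
by apply: (mulfI x1); rewrite E; field.
Qed.

(** With lam = 0 only the force 1/(u - e) remains, and it cannot vanish. *)
Lemma chain_leaf lam e u :
  (lam != 0 -> u != 0) -> u != e -> lam / u + 1 / (u - e) = 0 ->
  [/\ lam != 0, u != 0 & step_ratio lam e u].
Proof.
move=> lu ue; have ue0 : u - e != 0 by rewrite subr_eq0.
case: (eqVneq lam 0) => [->|l0].
  by rewrite mul0r add0r => /eqP; rewrite mul1r invr_eq0 (negPf ue0).
move=> E; have u0 := lu l0; split=> //; rewrite /step_ratio.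
apply/eqP; rewrite -subr_eq0.
rewrite (_ : _ - _ = (lam / u + 1 / (u - e)) * (u * (u - e))).
  by rewrite E mul0r.
by field; rewrite ue0 u0.
Qed.

(** Since u - w = u/(x+1), the solved neighbour w contributes the force (x+1)/u and merges with the
    label; what is left is the equation of a leaf. *)
Lemma chain_node lam x e u w :
  0 <= x -> u != 0 -> u != e -> step_ratio x u w ->
  lam / u + (1 / (u - e) + 1 / (u - w)) = 0 -> step_ratio (x + lam + 1) e u.
Proof.
move=> x0 u0 ue Ew; have ue0 : u - e != 0 by rewrite subr_eq0.
have x1 : x + 1 != 0 by rewrite gt_eqF // ltr_wpDl.
have -> : 1 / (u - w) = (x + 1) / u.
  rewrite (step_ratioE x0 Ew) (_ : u - _ = u / (x + 1)); last by field.
  by field; rewrite x1 u0.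
move=> E; rewrite /step_ratio; apply/eqP; rewrite -subr_eq0.
rewrite (_ : _ - _ = (lam / u + (1 / (u - e) + (x + 1) / u)) * (u * (u - e))).
  by rewrite E mul0r.
by field; rewrite ue0 u0.
Qed.

Lemma chain_fork lam x y e u w w' :
  0 <= x -> 0 <= y -> u != 0 -> u != e -> step_ratio x u w -> step_ratio y u w' ->
  lam / u + (1 / (u - e) + 1 / (u - w) + 1 / (u - w')) = 0 ->
  step_ratio (x + y + lam + 2) e u.
Proof.
move=> x0 y0 u0 ue Ew Ew'; have ue0 : u - e != 0 by rewrite subr_eq0.
have y1 : y + 1 != 0 by rewrite gt_eqF // ltr_wpDl.
have -> : 1 / (u - w') = (y + 1) / u.
  rewrite (step_ratioE y0 Ew') (_ : u - _ = u / (y + 1)); last by field.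
  by field; rewrite y1 u0.
move=> E; rewrite (_ : x + y + lam + 2 = x + (lam + (y + 1)) + 1); last by ring.
by apply: (chain_node x0 u0 ue Ew); rewrite -E; ring.
Qed.

(** A leaf root t at 0 makes d = 0 by the constant coefficient, then a + b = 0 by its own equation,
    and t' = -e by the quadratic coefficient. The equation of the other leaf becomes a positive
    multiple of e^2 equal to 0, while the invariant makes e nonzero. *)
Lemma double_leaf_nonzero n lam' e a b d t t' :
  0 < n -> 0 <= lam' -> reproduction n e a b d t t' ->
  (d = 0 -> a * b != 0) ->
  t != a -> t != b -> t' != a -> t' != b ->
  1 / (t - a) + 1 / (t - b) = 0 ->
  lam' / t' + (1 / (t' - a) + 1 / (t' - b)) = 0 ->
  t != 0.
Proof.
move=> n0 l0 H inv ta tb t'a t'b E E'; apply/eqP => t0; rewrite {}t0 in H ta tb E.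
have nn : n != 0 by rewrite gt_eqF.
have nn1 : n + 1 != 0 by rewrite gt_eqF // addr_gt0.
have nn2 : n + 2 != 0 by rewrite gt_eqF // addr_gt0.
have [_ _ c0] := (reproduction_coef _ _ _ _ _ _ _).1 H.
have a0 : a != 0 by rewrite eq_sym.
have b0 : b != 0 by rewrite eq_sym.
have d0 : d = 0.
  apply: (@prod_eq0_imp ((n + 1) * (a * b))); first by rewrite !mulf_neq0.
  by rewrite c0; ring.
have p0 := inv d0; rewrite {}d0 {inv c0} in H.
have [c2 c1 _] := (reproduction_coef _ _ _ _ _ _ _).1 H.
have e0 : e != 0.
  apply/eqP => e0; move: c1; rewrite e0 !(mulr0, mul0r, addr0) => /eqP.
  by rewrite mulf_eq0 (negPf p0) (negPf nn2).
have s0 : a + b = 0.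
  apply/eqP; rewrite (_ : a + b = - (1 / (0 - a) + 1 / (0 - b)) * (a * b)).
    by rewrite E oppr0 mul0r.
  by field; rewrite ?sub0r ?oppr_eq0 a0 ?b0.
have t'E : t' = - e.
  apply/eqP; rewrite -subr_eq0; apply/eqP; apply: (prod_eq0_imp nn).
  transitivity (n * (e + (0 + t'))); first by ring.
  by rewrite -c2 s0; ring.
have t'0 : t' != 0 by rewrite t'E oppr_eq0.
have bE : b = - a by apply/eqP; rewrite -addr_eq0 addrC s0.
have pE : (n + 2) * a ^+ 2 = n * e ^+ 2.
  apply: oppr_inj; transitivity (n * (0 * t' + e * (0 + t'))).
    by rewrite -c1 bE; ring.
  by rewrite t'E; ring.
have : (lam' * 2 / (n + 2) + 2) * e ^+ 2 = 0.
  have -> : (lam' * 2 / (n + 2) + 2) * e ^+ 2 =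
     lam' * (e ^+ 2 - (n * e ^+ 2) / (n + 2)) + 2 * e ^+ 2 by field.
  rewrite -pE.
  transitivity ((lam' / t' + (1 / (t' - a) + 1 / (t' - b))) *
     (t' * (t' - a) * (t' - b))); last by rewrite E' mul0r.
  have f1 : - e - a != 0 by rewrite subr_eq0 -t'E.
  have f2 : - e + a != 0 by rewrite -[a]opprK subr_eq0 -t'E -bE.
  by rewrite bE t'E opprK; field; rewrite f1 f2 nn2 ?oppr_eq0 e0.
apply/eqP; rewrite mulf_neq0 ?expf_neq0 // gt_eqF //.
by rewrite ltr_wpDl // divr_ge0 ?mulr_ge0 // addr_ge0 // ltW.
Qed.

Lemma double_leaf n lam e a b d t t' :
  t != 0 -> reproduction n e a b d t t' -> t != a -> t != b ->
  lam / t + (1 / (t - a) + 1 / (t - b)) = 0 ->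
  step_ratio (lam + n + 1) d t.
Proof.
move=> t0 H ta tb; have [td ->] := reproduction_at_root H (Or32 _ _ erefl) t0 ta tb.
have td0 : t - d != 0 by rewrite subr_eq0.
move=> E; rewrite /step_ratio; apply/eqP; rewrite -subr_eq0.
rewrite (_ : _ - _ = (lam / t + ((n + 1) / t + 1 / (t - d))) * (t * (t - d))).
  by rewrite E mul0r.
by field; rewrite ?td0 t0.
Qed.

(** With G the product of the neighbours, this reads (n+2) G(d) = d G'(d): the point d solves the
    Bethe equation of its node with the reflected label -n-2. *)
Lemma reproduction_bethe n e a b d a' b' : n != 0 ->
  reproduction n e a b d a' b' ->
  (n + 2) * ((d - e) * ((d - a') * (d - b'))) =
  d * ((d - a') * (d - b') + (d - e) * (d - a' + (d - b'))).
Proof.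
move=> n0 /reproduction_coef[c2 c1 c0]; apply: (mulfI n0).
transitivity ((n + 2) * (n * d ^+ 3 - n * (e + (a' + b')) * d ^+ 2
  + n * (a' * b' + e * (a' + b')) * d - n * e * (a' * b'))); first by ring.
transitivity (d * (3 * n * d ^+ 2 - 2 * (n * (e + (a' + b'))) * d
  + n * (a' * b' + e * (a' + b')))); last by ring.
by rewrite -c2 -c1 -c0; ring.
Qed.

(** The same elimination as in [chain_fork], for the reflected label -n-2 of d: the new parameter is
    x + y + (-n-2) + 2. *)
Lemma step_ratio_fork n x y e a b d t t' :
  0 < n -> 0 <= x -> 0 <= y -> d != 0 -> reproduction n e a b d t t' ->
  step_ratio x d t -> step_ratio y d t' -> step_ratio (x + y - n) e d.
Proof.
move=> n0 x0 y0 d0 H /(step_ratioE x0) tE /(step_ratioE y0) t'E.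
have x1 : x + 1 != 0 by rewrite gt_eqF // ltr_wpDl.
have y1 : y + 1 != 0 by rewrite gt_eqF // ltr_wpDl.
have := reproduction_bethe (lt0r_neq0 n0) H.
have -> : d - t = d / (x + 1) by rewrite tE; field.
have -> : d - t' = d / (y + 1) by rewrite t'E; field.
move=> E; rewrite /step_ratio.
apply: (@mulfI _ (d ^+ 2 / ((x + 1) * (y + 1)))).
  by rewrite mulf_neq0 ?invr_eq0 ?mulf_neq0 // expf_neq0.
apply/eqP; rewrite -subr_eq0; apply/eqP.
transitivity (d * (d / (x + 1) * (d / (y + 1)) +
         (d - e) * (d / (x + 1) + d / (y + 1))) -
      (n + 2) * ((d - e) * (d / (x + 1) * (d / (y + 1))))).
  by field; rewrite x1 y1.
by rewrite E subrr.
Qed.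

(** At x = d the reproduction of the next node converts the forces of a' and b' on d into (n + lam +
    2)/d + 1/(d - d'), that is (n + lam + q + 3)/d. With the reflected label -n-2 of d this leaves
    the parameter q + lam + 1. *)
Lemma step_ratio_double n lam q e a b d a' b' d' a'' b'' :
  0 < n -> 0 <= q -> d != 0 -> a' != b' ->
  reproduction n e a b d a' b' ->
  reproduction (n + lam + 1) d a' b' d' a'' b'' ->
  step_ratio q d d' -> step_ratio (q + lam + 1) e d.
Proof.
move=> n0 q0 d0 ab' H H' /(step_ratioE q0) d'E.
have q1 : q + 1 != 0 by rewrite gt_eqF // ltr_wpDl.
have := reproduction_bethe (lt0r_neq0 n0) H.
set Y := (d - a') * (d - b'); set Y1 := d - a' + (d - b') => E.
have E' : (n + lam + q + 3) * Y = d * Y1.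
  apply: (@mulfI _ (d / (q + 1))); first by rewrite mulf_neq0 ?invr_eq0.
  apply/eqP; rewrite -subr_eq0; apply/eqP.
  have := H' d; rewrite subrr !mul0r mulr0 d'E.
  by move=> K; rewrite -{}[RHS]K /Y /Y1; field.
(* If d equals one of a', b', then [E'] makes it equal to the other as well. *)
have Y0 : Y != 0.
  apply/eqP => Y0; move: E'; rewrite Y0 mulr0 => /esym/(prod_eq0_imp d0).
  move/eqP: Y0; rewrite /Y /Y1 mulf_eq0 => /orP[] /eqP z; rewrite z.
    rewrite add0r => /eqP; rewrite subr_eq0 => /eqP w.
    by move/eqP: z ab'; rewrite subr_eq0 w eq_sym => /eqP ->; rewrite eqxx.
  rewrite addr0 => /eqP; rewrite subr_eq0 => /eqP w.
  by move/eqP: z ab'; rewrite subr_eq0 w => /eqP ->; rewrite eqxx.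
rewrite /step_ratio; apply: (mulfI Y0); apply/eqP; rewrite -subr_eq0; apply/eqP.
transitivity (d * Y + (d - e) * ((n + lam + q + 3) * Y) -
  (n + 2) * ((d - e) * Y)); first by ring.
by rewrite E E'; ring.
Qed.

(** The shape common to all doubled nodes in the theorem: e is the preceding center, M does not
    depend on the node, and Z accumulates the factors X, Y, Q_i and R_i from the leaves inwards. *)
Definition quad_pair M Z e a b : Prop :=
  a + b = e * (M + (M + 2) * Z) / (M + 1) /\ a * b = e ^+ 2 * Z.

(** The quadratic and constant coefficients of the reproduction determine a + b and ab from the next
    pair; the linear one then holds by itself because M = n + q. One direction serves uniqueness,
    the other existence. *)
Lemma reproduction_quad_pair n q Z e a b a' b' :
  0 < n -> 0 < q -> e != 0 ->
  let Q := q / (q + 1) in let R := n / (n + 1) in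
  quad_pair (n + q) Z (Q * e) a' b' ->
  quad_pair (n + q) (Q * R * Z) e a b <-> reproduction n e a b (Q * e) a' b'.
Proof.
move=> n0 q0 e0 Q R [s' p'].
have n1 : n + 1 != 0 by rewrite gt_eqF // addr_gt0.
have q1 : q + 1 != 0 by rewrite gt_eqF // addr_gt0.
have M1 : n + q + 1 != 0 by rewrite gt_eqF // !addr_gt0.
split=> [[s p]|/reproduction_coef[c2 _ c0]].
  apply/reproduction_coef; split; rewrite ?s ?p ?s' ?p' /Q /R;
    by field; rewrite ?n1 ?q1 ?M1.
have Q0 : Q != 0 by rewrite mulf_neq0 ?invr_eq0 // gt_eqF.
split; last first.
  apply: (@mulfI _ ((n + 1) * (Q * e))); first by rewrite mulf_neq0 ?n1 // (mulf_neq0 Q0 e0).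
  transitivity ((n + 1) * (a * b) * (Q * e)); first by ring.
  rewrite c0 p' /Q /R.
  by field; rewrite ?n1 ?q1.
apply: (mulfI n1); apply: (addIr ((n - 1) * (Q * e))); rewrite c2 s' /Q /R.
by field; rewrite ?n1 ?q1 ?M1.
Qed.

Lemma quad_pair_nonzero M Z e a b :
  0 < Z -> e != 0 -> quad_pair M Z e a b -> (a != 0) && (b != 0).
Proof.
move=> Z0 e0 [_ p]; rewrite -negb_or -mulf_eq0 p.
by rewrite mulf_neq0 ?expf_neq0 // gt_eqF.
Qed.

Lemma quad_pair_center M Z e a b :
  0 <= M -> Z != 1 -> e != 0 -> quad_pair M Z e a b -> (e != a) && (e != b).
Proof.
move=> M0 Z1 e0 [s p]; have M1 : M + 1 != 0 by rewrite gt_eqF // ltr_wpDl.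
rewrite -!(subr_eq0 e) -negb_or -mulf_eq0.
have -> : (e - a) * (e - b) = e ^+ 2 / (M + 1) * (1 - Z).
  transitivity (e ^+ 2 - e * (a + b) + a * b); first by ring.
  by rewrite s p; field.
by rewrite !mulf_neq0 ?invr_eq0 ?expf_neq0 // subr_eq0 eq_sym.
Qed.

Lemma shift_ratio_bounds x : 0 < x -> 0 < x / (x + 1) < 1.
Proof.
move=> x0; have x1 : 0 < x + 1 by rewrite addr_gt0.
by rewrite divr_gt0 //= ltr_pdivrMr // mul1r ltrDl.
Qed.

(** The discriminant is a nonzero multiple of (1 - QRZ)(M^2 - (M+2)^2 QRZ). The second factor is
    positive because Z < 1 and M^2 (q+1)(n+1) - (M+2)^2 qn = (M+1)(n-q)^2. *)
Lemma quad_pair_distinct n q Z e a b :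
  0 < n -> 0 < q -> 0 < Z < 1 -> e != 0 ->
  quad_pair (n + q) (q / (q + 1) * (n / (n + 1)) * Z) e a b -> a != b.
Proof.
move=> n0 q0 /andP[Z0 Z1] e0 [s p].
set QR := _ * (n / _) in s p; set M := n + q in s p.
have M0 : 0 < M by rewrite addr_gt0.
have M1 : M + 1 != 0 by rewrite gt_eqF // ltr_pwDl.
have [/andP[Q0 Q1] /andP[R0 R1]] := (shift_ratio_bounds q0, shift_ratio_bounds n0).
have QR0 : 0 < QR by rewrite mulr_gt0.
have QR1 : QR < 1 by rewrite mulr_ilt1 // ltW.
have QRZ : QR * Z < QR by rewrite gtr_pMr.
rewrite -subr_eq0 -[_ == 0](expf_eq0 _ 2).
have -> : (a - b) ^+ 2 =
    e ^+ 2 / (M + 1) ^+ 2 * ((1 - QR * Z) * (M ^+ 2 - (M + 2) ^+ 2 * (QR * Z))).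
  transitivity ((a + b) ^+ 2 - 4 * (a * b)); first by ring.
  by rewrite s p; field.
rewrite !mulf_neq0 ?invr_eq0 ?expf_neq0 //.
  by rewrite subr_eq0 eq_sym lt_eqF // (lt_trans QRZ).
rewrite subr_eq0 gt_eqF //.
apply: (@lt_le_trans _ _ ((M + 2) ^+ 2 * QR)).
  by rewrite ltr_pM2l // exprn_gt0 // addr_gt0.
rewrite /QR mulf_div mulrA ler_pdivrMr ?mulr_gt0 ?addr_gt0 // -subr_ge0.
have -> : M ^+ 2 * ((q + 1) * (n + 1)) - (M + 2) ^+ 2 * (q * n) =
   (M + 1) * (n - q) ^+ 2 by rewrite /M; ring.
apply: mulr_ge0; first by rewrite ltW // addr_gt0.
by apply: real_exprn_even_ge0; rewrite // rpredB // realE ltW.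
Qed.

(** Converse of [reproduction_exists] at one root: the value of the identity at a shows that no
    neighbour lies there, and its derivative divided by its value is the Bethe equation. *)
Lemma reproduction_node n e a b d a' b' :
  reproduction n e a b d a' b' -> a != b -> a != 0 -> a != d ->
  [/\ n != 0, a != e, a != a' & a != b'] /\
  n / a + (1 / (a - e) + 1 / (a - a') + 1 / (a - b')) = 2 / (a - b).
Proof.
move=> H ab a0 ad.
have E : n * ((a - e) * (a - a') * (a - b')) = - a * (a - b) * (a - d).
  by rewrite -H; ring.
have : n * ((a - e) * (a - a') * (a - b')) != 0.
  by rewrite E !mulf_neq0 ?oppr_eq0 // subr_eq0.
rewrite !mulf_eq0 !negb_or !subr_eq0 => /andP[n0 /andP[/andP[ae aa] ab']].
split=> //; have [c2 c1 c0] := (reproduction_coef _ _ _ _ _ _ _).1 H.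
have E' : n * ((a - a') * (a - b') + (a - e) * (a - b') + (a - e) * (a - a')) =
   (a - d) * (n * (a - b) - 2 * a).
  transitivity (3 * n * a ^+ 2 - 2 * (n * (e + (a' + b'))) * a
    + n * (a' * b' + e * (a' + b'))); first by ring.
  by rewrite -c2 -c1; ring.
have -> : 1 / (a - e) + 1 / (a - a') + 1 / (a - b') =
  n * ((a - a') * (a - b') + (a - e) * (a - b') + (a - e) * (a - a')) /
  (n * ((a - e) * (a - a') * (a - b'))).
  by field; rewrite n0 !subr_eq0 ae aa ab'.
by rewrite E E'; field; rewrite a0 !subr_eq0 ab ad.
Qed.

Lemma reproduction_center n e a b d a' b' :
  n != 0 -> d != e -> d != a' -> d != b' ->
  reproduction n e a b d a' b' -> (a != d) && (b != d).
Proof.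
move=> n0 de da db H; rewrite -!(subr_eq0 _ d) -negb_or -mulf_eq0.
have : d * ((a - d) * (b - d)) = n * ((d - e) * (d - a') * (d - b')).
  by rewrite -H; ring.
move=> E; apply/eqP => z; move: E; rewrite z mulr0 => /esym/eqP.
by apply/negP; rewrite !mulf_neq0 // subr_eq0.
Qed.

End NodeAlgebra.

(** * The Bethe ansatz equation as a system on the Dynkin diagram *)

Lemma uniq_map_inj (T1 T2 : eqType) (f : T1 -> T2) (s : seq T1) :
  uniq (map f s) -> {in s &, injective f}.
Proof.
elim: s => //= x s IH /andP[xs /IH inj] y z.
rewrite !inE => /orP[/eqP->|ys] /orP[/eqP->|zs] // e; last exact: inj.
  by move: xs; rewrite e map_f.
by move: xs; rewrite -e map_f.
Qed.

Section BetheSystem.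
Variables (C : numFieldType) (r : nat).
Hypothesis r4 : (4 <= r)%N.

Definition nbr_nodes c : seq nat :=
  if (c == r) || (c == r.-1) then [:: (r - 2)%N]
  else if c == (r - 2)%N then [:: (r - 3)%N; r.-1; r]
  else [:: c.-1; c.+1].

Definition nbrs (T : nat -> seq C) c : seq C :=
  flatten [seq T k | k <- nbr_nodes c].

(** The sum over [own] includes w = u, whose term is 2/0 = 0. A root 0 is allowed when lam = 0, in
    accordance with the omission of terms with zero numerator. *)
Definition node_eq (lam : C) (own nbr : seq C) : Prop :=
  [/\ uniq own, forall u, u \in own -> u \notin nbr,
      lam != 0 -> 0 \notin own &
      forall u, u \in own ->
        lam / u + \sum_(w <- nbr) 1 / (u - w) = \sum_(w <- own) 2 / (u - w)].

(* Node 0 carries the single variable 1, the position of omega_1. *)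
Definition bethe_system (L : nat -> C) (T : nat -> seq C) : Prop :=
  T 0%N = [:: 1] /\
  forall c, (1 <= c <= r)%N -> node_eq (L c) (T c) (nbrs T c).

Lemma sum_nbr_nodes c c' : (1 <= c <= r)%N ->
  \sum_(k <- nbr_nodes c) (c' == k)%:R = (c' \in nbr_nodes c)%:R :> C.
Proof.
move=> c_bd; have un : uniq (nbr_nodes c).
  by rewrite /nbr_nodes; do 2?case: ifP => ?; rewrite /= ?inE; lia.
rewrite -count_uniq_mem // -natr_sum; congr _%:R.
by elim: (nbr_nodes c) => [|k s IH]; rewrite ?big_nil // big_cons IH eq_sym.
Qed.

Lemma inv_form_alpha_nbr c c' : (1 <= c <= r)%N -> (1 <= c' <= r)%N ->
  inv_form (alpha C r c) (alpha C r c') =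
  2 * (c' == c)%:R - (c' \in nbr_nodes c)%:R.
Proof.
move=> c_bd c'_bd.
have -> : inv_form (alpha C r c) (alpha C r c') =
    if c == c' then 2 else if c' \in nbr_nodes c then -1 else 0.
  have E : c != c' -> (c' \in nbr_nodes c) =
      ((maxn c c' < r)%N && (maxn c c' == (minn c c').+1)) ||
      ((maxn c c' == r) && (minn c c' == r - 2)%N).
    by rewrite /nbr_nodes; do 2?case: ifP => ?; rewrite !inE; lia.
  have iE a b : (1 <= a <= b)%N -> (b <= r)%N -> a != b ->
     inv_form (alpha C r b) (alpha C r a) =
     if ((b < r)%N && (b == a.+1)) || ((b == r) && (a == r - 2)%N) then -1 else 0.
    move=> ab br ne; rewrite inv_form_alpha //; last by lia.
    by rewrite eq_sym (negPf ne); case: ((b < r)%N && _).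
  case: eqVneq => [<-|ne]; first by rewrite inv_form_alpha ?eqxx //; lia.
  rewrite (E ne); case: (leqP c' c) => cc.
    by rewrite iE //; lia.
  by rewrite inv_formC iE //; lia.
rewrite eq_sym; case: eqP => [->|_]; last by case: (_ \in _) => /=; ring.
have -> : c \in nbr_nodes c = false; last by rewrite /=; ring.
by rewrite /nbr_nodes; do 2?case: ifP => ?; rewrite !inE; lia.
Qed.

Lemma mem_nbr_nodes c c' : (1 <= c <= r)%N -> (1 <= c' <= r)%N ->
  c' != c -> (inv_form (alpha C r c) (alpha C r c') != 0) = (c' \in nbr_nodes c).
Proof.
move=> c_bd c'_bd cc; rewrite inv_form_alpha_nbr // (negPf cc) mulr0 sub0r oppr_eq0.
by rewrite pnatr_eq0 eqb0 negbK.
Qed.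

Lemma inv_form_alpha_self c : (1 <= c <= r)%N ->
  inv_form (alpha C r c) (alpha C r c) = 2.
Proof. by move=> c_bd; rewrite inv_form_alpha ?eqxx //; lia. Qed.

Lemma dynkinE (lam : 'rV[C]_r) c : (1 <= c <= r)%N ->
  dynkin lam c = inv_form lam (alpha C r c).
Proof.
move=> c_bd; rewrite /dynkin inv_form_alpha_self // mulrAC divff ?mul1r //.
by rewrite pnatr_eq0.
Qed.

Section Positions.
Variables (l : seq nat).
Hypothesis lr : size l = r.

Definition node_roots (t : 'I_(sumn l) -> C) (c : nat) : seq C :=
  if c is 0%N then [:: 1]
  else [seq t j | j : 'I_(sumn l) <- enum 'I_(sumn l) & color l j == c].

Lemma color_bounds (j : 'I_(sumn l)) : (1 <= color l j <= r)%N.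
Proof.
have : color l j \in colors l by rewrite mem_nth // size_colors.
rewrite -lr => /flattenP[_ /mapP[i + ->]]; rewrite mem_iota => i_bd.
by move/nseqP => [-> _]; lia.
Qed.

Lemma mem_node_roots (t : 'I_(sumn l) -> C) c u : (0 < c)%N ->
  reflect (exists2 j : 'I_(sumn l), color l j = c & u = t j) (u \in node_roots t c).
Proof.
case: c => // c _; apply: (iffP mapP) => -[j].
  by rewrite mem_filter => /andP[/eqP jc _] ->; exists j.
by move=> jc ->; exists j; rewrite // mem_filter jc eqxx mem_enum.
Qed.

Lemma sum_node_roots (t : 'I_(sumn l) -> C) c (F : C -> C) :
  \sum_(w <- node_roots t c) F w =
  \sum_(j < sumn l) (color l j == c)%:R * F (t j) + (c == 0%N)%:R * F 1.
Proof.
case: c => [|c] /=.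
  rewrite big_seq1 mul1r big1 ?add0r // => j _.
  by have := color_bounds j; case: eqP => [->//|_]; rewrite mul0r.
rewrite mul0r addr0 big_map big_filter big_enum_cond big_mkcond /=.
by apply: eq_bigr => j _; case: eqP; rewrite ?mul1r ?mul0r.
Qed.

Lemma sum_nbrs (t : 'I_(sumn l) -> C) c (F : C -> C) : (1 <= c <= r)%N ->
  \sum_(w <- nbrs (node_roots t) c) F w =
  \sum_(j < sumn l) (color l j \in nbr_nodes c)%:R * F (t j)
    + (c == 1%N)%:R * F 1.
Proof.
move=> c_bd; rewrite /nbrs big_flatten big_map.
under eq_bigr => k _ do rewrite sum_node_roots.
rewrite big_split exchange_big /=; congr (_ + _).
  by apply: eq_bigr => j _; rewrite -sum_nbr_nodes // mulr_suml.
rewrite -mulr_suml; congr (_ * _).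
under eq_bigr => k _ do rewrite eq_sym.
rewrite sum_nbr_nodes //; congr (nat_of_bool _)%:R.
by rewrite /nbr_nodes; do 2?case: ifP => ?; rewrite !inE; lia.
Qed.

(** The point z = 0 contributes the label term; the point z = 1 is paired with alpha_1 only, hence
    acts exactly like a root sitting at a node 0 next to node 1. *)
Lemma bethe_force (lam : 'rV[C]_r) (t : 'I_(sumn l) -> C) c (u : C) : (1 <= c <= r)%N ->
  - (\sum_(s < 2) inv_form (alpha C r c) (tnth [tuple lam; omega1 C r] s)
       / (u - tnth [tuple (0 : C); 1] s))
  + \sum_(j < sumn l) inv_form (alpha C r c) (alpha C r (color l j)) / (u - t j) =
  \sum_(w <- node_roots t c) 2 / (u - w)
  - (dynkin lam c / u + \sum_(w <- nbrs (node_roots t) c) 1 / (u - w)).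
Proof.
move=> c_bd; rewrite sum_node_roots sum_nbrs // !big_ord_recl big_ord0 /=.
rewrite !(tnth_nth 0) /= subr0 [inv_form _ lam]inv_formC [inv_form _ (omega1 _ _)]inv_formC.
rewrite -!dynkinE // dynkin_omega1 // (gtn_eqF (proj1 (andP c_bd))) mul0r !addr0.
have -> : \sum_(j < sumn l) inv_form (alpha C r c) (alpha C r (color l j)) / (u - t j) =
   \sum_(j < sumn l) (color l j == c)%:R * (2 / (u - t j)) -
   \sum_(j < sumn l) (color l j \in nbr_nodes c)%:R * (1 / (u - t j)).
  rewrite -sumrB; apply: eq_bigr => j _.
  by rewrite inv_form_alpha_nbr ?color_bounds // mulrBl mul1r mulrA [2 * _]mulrC.
by rewrite mulrA mulr1; ring.
Qed.

Lemma bethe_solutionE (lam : 'rV[C]_r) (t : 'I_(sumn l) -> C) :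
  bethe_solution [tuple lam; omega1 C r] [tuple (0 : C); 1] t <->
  bethe_system (dynkin lam) (node_roots t).
Proof.
(* Division by 0 gives 0, so the index j = i may be restored to the sum. *)
have self (i : 'I_(sumn l)) : inv_form (alpha C r (color l i)) (alpha C r (color l i)) / (t i - t i) = 0.
  by rewrite subrr invr0 mulr0.
have drop (i : 'I_(sumn l)) :
    \sum_(j < sumn l | j != i)
       inv_form (alpha C r (color l i)) (alpha C r (color l j)) / (t i - t j) =
    \sum_(j < sumn l)
       inv_form (alpha C r (color l i)) (alpha C r (color l j)) / (t i - t j).
  by rewrite [RHS](bigD1 i) //= self add0r.
split=> [[tz tt E]|[_ H]].
  split=> // c c_bd; have c0 : (0 < c)%N by lia.
  split.
  - case: c c_bd c0 => // c c_bd _; rewrite map_inj_in_uniq ?filter_uniq -?enumT ?enum_uniq // => i j.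
    rewrite !mem_filter => /andP[/eqP ic _] /andP[/eqP jc _] ij.
    apply/eqP/negPn/negP => ne; have := tt j i ne.
    by rewrite ic jc inv_form_alpha_self // ij pnatr_eq0 eqxx => /(_ isT).
  - move=> _ /(mem_node_roots _ _ c0)[i ic ->].
    apply/negP => /flattenP[_ /mapP[k kc ->]].
    case: k kc => [|k] kc.
      rewrite inE => /eqP ti; have := tz i (lift ord0 ord0).
      rewrite !(tnth_nth 0) /= ti eqxx ic inv_formC -dynkinE // dynkin_omega1 //.
      have -> : c = 1%N by move: kc; rewrite /nbr_nodes; do 2?case: ifP => ?; rewrite !inE; lia.
      by rewrite eqxx oner_eq0 => /(_ isT).
    move=> /(mem_node_roots _ _ (ltn0Sn k))[j jk tij].
    have kb : (1 <= k.+1 <= r)%N by rewrite -jk color_bounds.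
    have kc' : k.+1 != c.
      by apply/negP => /eqP e; move: kc; rewrite e /nbr_nodes; do 2?case: ifP => ?; rewrite !inE; lia.
    have ji : j != i by apply: contra kc' => /eqP e; rewrite -jk e ic.
    have := tt i j ji; rewrite ic jk mem_nbr_nodes // kc => /(_ isT).
    by rewrite tij eqxx.
  - move=> Lc; apply/negP => /(mem_node_roots _ _ c0)[i ic ti].
    have := tz i ord0; rewrite !(tnth_nth 0) /= -ti eqxx ic inv_formC -dynkinE //.
    by move=> /(_ Lc).
  move=> _ /(mem_node_roots _ _ c0)[i ic ->].
  have := E i; rewrite /= drop.
  by rewrite ic bethe_force // => /eqP; rewrite subr_eq0 => /eqP.
have {}H (i : 'I_(sumn l)) := H _ (color_bounds i).
have ci0 (i : 'I_(sumn l)) : (0 < color l i)%N by case/andP: (color_bounds i).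
have mem (i : 'I_(sumn l)) : t i \in node_roots t (color l i) by apply/(mem_node_roots _ _ (ci0 i)); exists i.
split.
- move=> i s; have [_ nb L0 _] := H i.
  case: s => [[|[|//]] ?]; rewrite !(tnth_nth 0) /= inv_formC -dynkinE ?color_bounds //.
    by move=> /L0; apply: contra => /eqP <-; apply: mem.
  rewrite dynkin_omega1 ?color_bounds // pnatr_eq0 eqb0 negbK => /eqP c1.
  apply: contra (nb _ (mem i)) => /eqP ->; rewrite c1 /nbrs /nbr_nodes.
  do 2?case: ifP => ?; try lia.
  by rewrite /= inE eqxx.
- move=> i j ji; have [un nb _ _] := H i.
  case: (eqVneq (color l j) (color l i)) => [cc _|cc].
    move: un; have := mem i; have := mem j; rewrite cc.
    case Ec: (color l i) (ci0 i) => [//|c] _ _ _ /uniq_map_inj inj.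
    apply: contra ji => /eqP tij; apply/eqP/inj => //.
      by rewrite mem_filter mem_enum cc Ec eqxx.
    by rewrite mem_filter mem_enum Ec eqxx.
  rewrite mem_nbr_nodes ?color_bounds // => cn.
  apply: contra (nb _ (mem i)) => /eqP ->.
  by apply/flattenP; exists (node_roots t (color l j)); rewrite ?map_f.
move=> i; have [_ _ _ /(_ _ (mem i)) E] := H i.
rewrite /= drop.
by rewrite bethe_force ?color_bounds // E subrr.
Qed.

Lemma representing_polyE (t : 'I_(sumn l) -> C) c : (0 < c)%N ->
  representing_poly t c = \prod_(w <- node_roots t c) ('X - w%:P).
Proof.
by case: c => // c _; rewrite /representing_poly big_map big_filter big_enum_cond.
Qed.

Lemma size_node_roots (t : 'I_(sumn l) -> C) c : (1 <= c <= r)%N ->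
  size (node_roots t c) = nth 0%N l c.-1.
Proof.
case: c => // c c_bd; rewrite size_map size_filter -count_colors ?lr //.
rewrite -(count_map (fun j : 'I_(sumn l) => color l j) (pred1 c.+1)).
congr (count _ _); apply: (@eq_from_nth _ 0%N).
  by rewrite size_map size_enum_ord size_colors.
move=> i; rewrite size_map size_enum_ord => i_l.
rewrite (nth_map (Ordinal i_l)) ?size_enum_ord // /color.
by rewrite nth_enum_ord.
Qed.

(** Equal polynomials give equal multisets of pairs (colour, coordinate), and a permutation matching
    these pairs preserves colours. *)
Lemma same_solution_of_polys (t t' : 'I_(sumn l) -> C) :
  (forall c, (1 <= c <= r)%N -> representing_poly t c = representing_poly t' c) ->
  same_solution t t'.
Proof.
move=> H.
pose f (u : 'I_(sumn l) -> C) := [tuple (color l j, u j) | j < sumn l].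
have /tuple_permP[s fs] : perm_eq (f t) (f t').
  apply/allP => -[c w] _ /=; apply/eqP.
  have cnt u : count_mem (c, w) (f u) =
     count_mem w [seq u j | j : 'I_(sumn l) <- enum 'I_(sumn l) & color l j == c].
    have -> : f u = [seq (color l (j : 'I_(sumn l)), u j)
        | j : 'I_(sumn l) <- enum 'I_(sumn l)] :> seq _.
      by rewrite -val_ord_tuple.
    rewrite !count_map count_filter ?enumT; apply: eq_count => j /=.
    by rewrite xpair_eqE andbC.
  rewrite !cnt; case: (boolP (1 <= c <= r)%N) => cb.
    have /seq.permP : perm_eq (node_roots t c) (node_roots t' c).
      apply: prod_XsubC_eq; rewrite -!representing_polyE ?H //; lia.
    by case: c cb {cnt} => // c _; apply.
  have E : [seq j : 'I_(sumn l) <- enum 'I_(sumn l) | color l j == c] = [::].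
    apply/eqP; rewrite -(negbK (_ == _)) -has_filter; apply: contra cb.
    by move=> /hasP[j _ /eqP <-]; apply: color_bounds.
  by rewrite E.
have E (j : 'I_(sumn l)) : (color l j, t j) = (color l (s j), t' (s j)).
  have := congr1 (fun u => nth (0%N, 0) u j) fs.
  by rewrite -!tnth_nth !tnth_mktuple.
by exists s; split=> j; have [] := E j.
Qed.

(** Concatenating the lists in the order of the nodes puts every root at a position of its own
    colour, since [colors] lists the colours in blocks of the same lengths. *)
Lemma node_roots_surj (T : nat -> seq C) :
  T 0%N = [:: 1] ->
  (forall c, (1 <= c <= r)%N -> size (T c) = nth 0%N l c.-1) ->
  exists t : 'I_(sumn l) -> C, forall c, (c <= r)%N -> node_roots t c = T c.
Proof.
move=> T0 szT.
pose ws := flatten [seq T c | c <- iota 1 r].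
exists (fun j => nth 0 ws j) => -[_|c c_r] //=.
have sz : size ws = sumn l.
  rewrite size_flatten; congr sumn; apply: (@eq_from_nth _ 0%N).
    by rewrite !size_map size_iota lr.
  move=> i; rewrite !size_map size_iota => i_r.
  rewrite (nth_map [::]) ?size_map ?size_iota // (nth_map 0%N) ?size_iota //.
  by rewrite nth_iota // szT //; lia.
have zipE : zip (colors l) ws = flatten [seq [seq (d, w) | w <- T d] | d <- iota 1 r].
  rewrite /colors /ws lr.
  have : forall d, d \in iota 1 r -> size (T d) = nth 0%N l d.-1.
    by move=> d; rewrite mem_iota => d_bd; rewrite szT //; lia.
  elim: (iota 1 r) => //= d s IH szs; rewrite zip_cat ?size_nseq ?szs ?mem_head //.
  rewrite IH => [|e es]; last by rewrite szs // inE es orbT.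
  congr (_ ++ _); rewrite -szs ?mem_head //.
  by elim: (T d) => //= w u ->.
transitivity [seq p.2 | p <- zip (colors l) ws & p.1 == c.+1].
  have -> : zip (colors l) ws =
    [seq (color l (j : 'I_(sumn l)), nth 0 ws j) | j : 'I_(sumn l) <- enum 'I_(sumn l)].
    apply: (@eq_from_nth _ (0%N, 0)).
      by rewrite size_zip size_colors sz minnn size_map size_enum_ord.
    move=> i; rewrite size_zip size_colors sz minnn => i_l.
    rewrite (nth_map (Ordinal i_l)) ?size_enum_ord // nth_enum_ord //.
    by rewrite nth_zip ?size_colors.
  by rewrite [in RHS]filter_map -[in RHS]map_comp.
rewrite zipE filter_flatten map_flatten -!map_comp.
rewrite (_ : iota 1 r = iota 1 c ++ c.+1 :: iota c.+2 (r - c.+1)); last first.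
  by rewrite -[c.+1 :: _]/(iota (1 + c) (r - c.+1).+1) -iotaD; congr iota; lia.
have other s : c.+1 \notin s ->
    flatten [seq ([eta map snd] \o ([eta filter (fun p => p.1 == c.+1)] \o
       (fun d => [seq (d, w) | w <- T d]))) i | i <- s] = [::].
  elim: s => //= d s IH; rewrite inE negb_or => /andP[dc /IH ->].
  rewrite cats0 filter_map (@eq_filter _ _ pred0) ?filter_pred0 // => w /=.
  by rewrite eq_sym (negPf dc).
rewrite map_cat flatten_cat /= !other ?cats0 ?mem_iota; try lia.
rewrite filter_map (@eq_filter _ _ predT) => [|w]; last by rewrite /= eqxx.
by rewrite filter_predT -map_comp map_id.
Qed.

End Positions.
End BetheSystem.

(** * Nodes carrying a single variable *)

Section Chains.
Variable C : numFieldType.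
Implicit Types (L t x : nat -> C).

Lemma step_ratio_facts (x e u : C) : 0 < x -> e != 0 -> step_ratio x e u ->
  [/\ u != 0, u != e, 1 / (u - e) = - x / u & 1 / (e - u) = (x + 1) / e].
Proof.
move=> x0 e0 /(step_ratioE (ltW x0)) ->.
have x1 : x + 1 != 0 by rewrite gt_eqF // addr_gt0.
have xn : x != 0 by rewrite gt_eqF.
have ne : x / (x + 1) * e - e != 0.
  have -> : x / (x + 1) * e - e = - (e / (x + 1)) by field.
  by rewrite oppr_eq0 mulf_neq0 ?invr_eq0.
split.
- by rewrite !mulf_neq0 ?invr_eq0.
- by rewrite -subr_eq0.
- have -> : x / (x + 1) * e - e = - (e / (x + 1)) by field.
  by field; rewrite ?x1 ?e0 ?xn.
have -> : e - x / (x + 1) * e = e / (x + 1) by field.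
by field; rewrite ?x1 ?e0 ?xn.
Qed.

(** Induction from the far end towards 0: the ratio at a node together with its nonzero root makes
    the previous root nonzero, which is what [chain_node] needs there. *)
Lemma chain_down m L t x :
  (forall c, (1 <= c <= m)%N -> 0 < x c) ->
  (forall c, (1 <= c < m)%N -> x c = x c.+1 + L c + 1) ->
  (forall c, (1 <= c < m)%N -> t c != t c.-1 /\
     L c / t c + (1 / (t c - t c.-1) + 1 / (t c - t c.+1)) = 0) ->
  ((1 <= m)%N -> step_ratio (x m) (t m.-1) (t m)) -> t m != 0 ->
  forall c, (c <= m)%N -> t c != 0 /\ ((1 <= c)%N -> step_ratio (x c) (t c.-1) (t c)).
Proof.
move=> x0 xE tE rm tm c c_m; have [j jm ->] : exists2 j, (j <= m)%N & c = (m - j)%N.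
  by exists (m - c)%N; nlia.
elim: j jm => [|j IH] jm; first by rewrite subn0.
have [t0 tr] := IH (ltnW jm).
have e : (m - j)%N = (m - j.+1).+1 by nlia.
move: t0 tr; rewrite e => t0 /(_ isT) tr.
have t1 : t (m - j.+1)%N != 0 by apply: step_ratio_neq0 tr t0; apply: x0; nlia.
split=> // c1.
have [|ne E] := tE (m - j.+1)%N; first by nlia.
rewrite xE; last by nlia.
by apply: chain_node ne tr E => //; rewrite ltW // x0; nlia.
Qed.

Lemma chain_prod m t x :
  t 0%N = 1 -> (forall c, (1 <= c <= m)%N -> 0 < x c) ->
  (forall c, (1 <= c <= m)%N -> step_ratio (x c) (t c.-1) (t c)) ->
  forall c, (c <= m)%N -> t c = \prod_(1 <= i < c.+1) (x i / (x i + 1)).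
Proof.
move=> t0 x0 tr; elim=> [|c IH] c_m; first by rewrite big_geq.
rewrite big_nat_recr //= -IH ?(ltnW c_m) // mulrC.
by apply: step_ratioE (tr c.+1 _); rewrite ?ltW ?x0.
Qed.

Lemma sum_from_to_recl L i l : (i <= l)%N ->
  sum_from_to L i l = L i + sum_from_to L i.+1 l.
Proof. by move=> il; rewrite /sum_from_to big_ltn. Qed.

Lemma sum_from_to_recr L i l : (i <= l.+1)%N ->
  sum_from_to L i l.+1 = sum_from_to L i l + L l.+1.
Proof. by move=> il; rewrite /sum_from_to big_nat_recr. Qed.

Lemma sum_from_to_ge0 L i l :
  (forall c, (i <= c <= l)%N -> 0 <= L c) -> 0 <= sum_from_to L i l.
Proof.
by move=> L0; rewrite /sum_from_to big_nat_cond sumr_ge0 // => c; rewrite andbT; apply: L0.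
Qed.

(** The ratio parameter at node i of a path ending at l: each further node contributes its label and
    one unit. *)
Definition path_weight L (l i : nat) : C := sum_from_to L i l + l%:R - i%:R.

Lemma path_weight_rec L l i : (i < l)%N ->
  path_weight L l i = path_weight L l i.+1 + L i + 1.
Proof.
move=> il; rewrite /path_weight sum_from_to_recl; last exact: ltnW.
by rewrite -natr1; ring.
Qed.

Lemma path_weight_gt0 L l i :
  (forall c, (i <= c <= l)%N -> 0 <= L c) -> 0 < L l -> (i <= l)%N ->
  0 < path_weight L l i.
Proof.
move=> L0 Ll il; rewrite /path_weight -addrA -natrB // ltr_wpDr //.
rewrite /sum_from_to big_nat_recr //= ltr_wpDl //.
by rewrite big_nat_cond sumr_ge0 // => c; rewrite andbT => c_bd; apply: L0; nlia.
Qed.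

Lemma path_solution m L t :
  (1 <= m)%N -> t 0%N = 1 -> (forall c, (1 <= c <= m)%N -> 0 <= L c) ->
  (forall c, (1 <= c < m)%N -> t c != t c.-1 /\
     L c / t c + (1 / (t c - t c.-1) + 1 / (t c - t c.+1)) = 0) ->
  (L m != 0 -> t m != 0) -> t m != t m.-1 ->
  L m / t m + 1 / (t m - t m.-1) = 0 ->
  0 < L m /\ forall c, (c <= m)%N ->
    t c = \prod_(1 <= i < c.+1) (path_weight L m i / (path_weight L m i + 1)).
Proof.
move=> m1 t0 L0 tE tm0 tm E; have [Lm tmn tmr] := chain_leaf tm0 tm E.
have Lm0 : 0 < L m by rewrite lt_def Lm L0 // m1 leqnn.
split=> //.
have x0 c : (1 <= c <= m)%N -> 0 < path_weight L m c.
  by move=> c_bd; apply: path_weight_gt0 => //; [move=> ? ?; apply: L0|]; nlia.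
apply: chain_prod => // c c_bd.
have := @chain_down m L t (path_weight L m) x0 _ tE _ tmn c.
case=> //; [by move=> d d_bd; apply: path_weight_rec; nlia| | by nlia | by move=> _; apply; nlia].
move=> _; rewrite /path_weight (_ : sum_from_to L m m = L m) ?addrK //.
by rewrite /sum_from_to big_nat1.
Qed.

End Chains.

Section Solve.
Variables (C : numFieldType) (r : nat).
Hypothesis r4 : (4 <= r)%N.
Implicit Types (L : nat -> C) (T : nat -> seq C) (y : nat -> {poly C}).

Lemma node_eq0 (lam : C) nbr : node_eq lam [::] nbr.
Proof. by split. Qed.

Lemma node_eq1 (lam : C) u nbr :
  node_eq lam [:: u] nbr <-> [/\ u \notin nbr, lam != 0 -> u != 0 &
    lam / u + \sum_(w <- nbr) 1 / (u - w) = 0].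
Proof.
have self : \sum_(w <- [:: u]) 2 / (u - w) = 0.
  by rewrite big_seq1 subrr invr0 mulr0.
split=> [[_ nb l0 E]|[nb l0 E]].
  split; first by apply: nb; rewrite mem_head.
    by move=> /l0; rewrite inE eq_sym.
  by rewrite E ?mem_head.
split=> // [v|l1|v]; rewrite ?inE; first by move=> /eqP ->.
  by rewrite eq_sym l0.
by move=> /eqP ->; rewrite E self.
Qed.

Lemma node_eq2 (lam : C) a b nbr :
  node_eq lam [:: a; b] nbr <->
  [/\ a != b, (a \notin nbr) && (b \notin nbr), lam != 0 -> (a != 0) && (b != 0),
    lam / a + \sum_(w <- nbr) 1 / (a - w) = 2 / (a - b) &
    lam / b + \sum_(w <- nbr) 1 / (b - w) = 2 / (b - a)].
Proof.
have selfa : \sum_(w <- [:: a; b]) 2 / (a - w) = 2 / (a - b).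
  by rewrite !big_cons big_nil subrr invr0 mulr0 add0r addr0.
have selfb : \sum_(w <- [:: a; b]) 2 / (b - w) = 2 / (b - a).
  by rewrite !big_cons big_nil subrr invr0 mulr0 add0r addr0.
split=> [[un nb l0 E]|[ab nb l0 Ea Eb]].
  split; first by move: un; rewrite /= inE andbT.
  - by rewrite !nb // !inE eqxx ?orbT.
  - by move=> /l0; rewrite !inE negb_or ![0 == _]eq_sym.
  - by rewrite E ?selfa // inE eqxx.
  - by rewrite E ?selfb // !inE eqxx orbT.
have [na nb'] := andP nb.
split=> [||l1|v]; first by rewrite /= inE andbT.
- by move=> v; rewrite !inE => /orP[] /eqP ->.
- by have := l0 l1; rewrite !inE negb_or ![0 == _]eq_sym.
by rewrite !inE => /orP[] /eqP ->; rewrite ?selfa ?selfb.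
Qed.

Lemma nbrs_chain T c : (1 <= c <= r - 3)%N -> nbrs r T c = T c.-1 ++ T c.+1.
Proof.
move=> c_bd; rewrite /nbrs /nbr_nodes; do 2?[case: ifP => ?; first by nlia].
by rewrite /= cats0.
Qed.

Lemma nbrs_fork T : nbrs r T (r - 2)%N = T (r - 3)%N ++ T r.-1 ++ T r.
Proof.
rewrite /nbrs /nbr_nodes; case: ifP => ?; first by nlia.
by rewrite eqxx /= cats0.
Qed.

Lemma nbrs_leaf T c : (c == r) || (c == r.-1) -> nbrs r T c = T (r - 2)%N.
Proof. by rewrite /nbrs /nbr_nodes => ->; rewrite /= cats0. Qed.

Lemma size1_head (s : seq C) : size s = 1%N -> s = [:: head 0 s].
Proof. by case: s => [|? []]. Qed.

Lemma size2_nth (s : seq C) : size s = 2%N -> s = [:: nth 0 s 0; nth 0 s 1].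
Proof. by case: s => [|? [|? []]]. Qed.

Definition represents_roots y T :=
  forall c, (1 <= c <= r)%N -> y c = \prod_(w <- T c) ('X - w%:P).

Lemma nbrs_path T (t : nat -> C) l : (l < r)%N ->
  (forall c, (c <= l)%N -> T c = [:: t c]) ->
  (forall c, (l < c <= r)%N -> T c = [::]) ->
  forall c, (1 <= c <= l)%N ->
    nbrs r T c = t c.-1 :: (if (c < l)%N then [:: t c.+1] else [::]).
Proof.
move=> l_r Tt Tn c c_l.
case: (ltnP (r - 3) c) => c3; last first.
  rewrite nbrs_chain ?(Tt c.-1) /=; try nlia; congr (_ :: _).
  by case: ifP => ?; [rewrite Tt|rewrite Tn] => //; nlia.
case: (eqVneq c (r - 2)%N) => [e|ne]; last first.
  rewrite nbrs_leaf ?Tt; try nlia; case: ifP => ?; first by nlia.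
  by congr [:: t _]; nlia.
rewrite e nbrs_fork Tt; last by nlia.
rewrite (Tn r); last by nlia.
rewrite /= cats0; congr (t _ :: _); first by nlia.
case: ifP => ?; [rewrite Tt|rewrite Tn] => //; try nlia.
by congr [:: t _]; nlia.
Qed.

Lemma solve_path L T l : (l < r)%N ->
  (forall c, (1 <= c <= r)%N -> 0 <= L c) -> bethe_system r L T ->
  (forall c, (1 <= c <= r)%N -> size (T c) = (c <= l)%N) ->
  ((0 < l)%N -> 0 < L l) /\
  forall y, represents_roots y T -> represents_i L r l y.
Proof.
move=> l_r L0 [T0 H] sz; pose t c := head 0 (T c).
have Tt c : (c <= l)%N -> T c = [:: t c].
  by case: c => [|c] c_l; rewrite /t ?T0 //; apply: size1_head; rewrite sz; nlia.
have Tn c : (l < c <= r)%N -> T c = [::].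
  by move=> c_l; apply: size0nil; rewrite sz; nlia.
have t0 : t 0%N = 1 by rewrite /t T0.
have nbT := nbrs_path l_r Tt Tn.
case: (posnP l) => [l0|l0].
  split=> // y yT; split=> [j|j j_l]; first by nlia.
  by rewrite yT ?Tn ?big_nil //; nlia.
have [] := @path_solution C l L t l0 t0.
- by move=> c c_bd; apply: L0; nlia.
- move=> c c_bd; have := H c; rewrite nbT ?Tt; try nlia.
  rewrite (proj2 (andP c_bd)) => /(_ ltac:(nlia))/node_eq1[].
  rewrite !inE negb_or => /andP[ne _] _ E; split=> //.
  by rewrite -E !big_cons big_nil addr0.
- by have := H l; rewrite Tt // => /(_ ltac:(nlia))/node_eq1[].
- have := H l; rewrite nbT ?Tt ?ltnn; try nlia.
  by move=> /(_ ltac:(nlia))/node_eq1[]; rewrite inE.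
- have := H l; rewrite nbT ?Tt ?ltnn; try nlia.
  by move=> /(_ ltac:(nlia))/node_eq1[]; rewrite big_seq1.
move=> Ll tE; split=> // y yT; split=> j j_l; last first.
  by rewrite yT ?Tn ?big_nil //; nlia.
by rewrite yT ?Tt ?big_seq1 ?tE //; nlia.
Qed.

Lemma nbrs_bar T (t : nat -> C) :
  (forall c, (c <= r - 2)%N -> T c = [:: t c]) -> T r.-1 = [::] ->
  T r = [:: t r.-1] ->
  forall c, (1 <= c <= r - 2)%N -> nbrs r T c = [:: t c.-1; t c.+1].
Proof.
move=> Tt Tn Tr c c_l; case: (eqVneq c (r - 2)%N) => [e|ne]; last first.
  by rewrite nbrs_chain ?Tt //; nlia.
rewrite e nbrs_fork Tn Tr Tt /=; last by nlia.
by congr [:: t _; t _]; nlia.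
Qed.

Lemma solve_bar L T :
  (forall c, (1 <= c <= r)%N -> 0 <= L c) -> bethe_system r L T ->
  (forall c, (1 <= c <= r)%N -> size (T c) = (c != r.-1)) ->
  0 < L r /\ forall y, represents_roots y T -> represents_ii L r y.
Proof.
(* Node r takes the place of the empty node r-1, so that the occupied nodes form a path of length
   r-1. *)
move=> L0 [T0 H] sz; pose t c := head 0 (T (if c == r.-1 then r else c)).
pose L' c := L (if c == r.-1 then r else c).
have Tt c : (c <= r - 2)%N -> T c = [:: t c].
  move=> c_r; rewrite /t (_ : c == r.-1 = false); last by nlia.
  by case: c c_r => [|c] c_r; rewrite ?T0 //; apply: size1_head; rewrite sz; nlia.
have Tr : T r = [:: t r.-1].
  by rewrite /t eqxx; apply: size1_head; rewrite sz; nlia.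
have Tn : T r.-1 = [::] by apply: size0nil; rewrite sz; nlia.
have t0 : t 0%N = 1 by have := Tt 0%N isT; rewrite T0 => -[].
have nbT := nbrs_bar Tt Tn Tr.
have L'E c : (1 <= c <= r - 2)%N -> L' c = L c.
  by rewrite /L'; case: eqP => // ->; nlia.
have L'r : L' r.-1 = L r by rewrite /L' eqxx.
have Hr := H r ltac:(nlia); rewrite Tr nbrs_leaf ?eqxx // Tt // in Hr.
have [nr Lr Er] := (node_eq1 _ _ _).1 Hr; rewrite big_seq1 in Er.
rewrite inE in nr.
have e2 : r.-1.-1 = (r - 2)%N by nlia.
have [] := @path_solution C r.-1 L' t _ t0; rewrite ?L'r ?e2 //; try nlia.
- by move=> c c_bd; rewrite /L'; case: ifP => ?; apply: L0; nlia.
- move=> c c_bd; have := H c; rewrite nbT ?Tt ?L'E; try nlia.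
  move=> /(_ ltac:(nlia))/node_eq1[].
  rewrite !inE negb_or => /andP[ne _] _ E; split=> //.
  by rewrite -E !big_cons big_nil addr0.
move=> Lr0 tE; split=> // y yT.
have xE i : (1 <= i <= r - 2)%N -> path_weight L' r.-1 i =
    sum_from_to L i (r - 2) + L r + r%:R - 1 - i%:R.
  move=> i_r; rewrite /path_weight.
  have -> : r.-1 = (r - 2).+1 by nlia.
  rewrite sum_from_to_recr; last by nlia.
  rewrite [in L' _.+1](_ : (r - 2).+1 = r.-1) ?L'r; last by nlia.
  rewrite (_ : sum_from_to L' i (r - 2) = sum_from_to L i (r - 2)); last first.
    by apply: eq_big_nat => c c_bd; apply: L'E; nlia.
  by rewrite (_ : (r - 2).+1 = r - 1)%N ?natrB; [ring|nlia|nlia].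
have cE j : (j <= r - 2)%N -> t j = coef_ii L r j.
  move=> j_r; rewrite tE; last by nlia.
  apply: eq_big_nat => i i_bd; rewrite xE; last by nlia.
  by congr (_ / _); ring.
split.
- by move=> j j_r; rewrite yT ?Tt ?big_seq1 ?cE //; nlia.
- by rewrite yT ?Tn ?big_nil //; nlia.
rewrite yT ?Tr ?big_seq1; last by nlia.
rewrite tE // (_ : r.-1.+1 = (r - 2).+2); last by nlia.
rewrite big_nat_recr //= -tE; last by nlia.
rewrite cE // mulrC (_ : path_weight L' r.-1 (r - 2).+1 = L r) //.
rewrite (_ : (r - 2).+1 = r.-1); last by nlia.
by rewrite /path_weight /sum_from_to big_nat1 L'r addrK.
Qed.

(** The same expression as [path_weight] with end r: absorbing the two leaves at once adds both
    labels and two units, as a path through them would. *)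
Definition fork_weight L i : C := sum_from_to L i r + r%:R - i%:R.

Lemma fork_weight_rec L i : (i < r)%N ->
  fork_weight L i = fork_weight L i.+1 + L i + 1.
Proof. exact: path_weight_rec. Qed.

Lemma fork_weight_base L : fork_weight L (r - 2)%N = L r.-1 + L r + L (r - 2)%N + 2.
Proof.
rewrite /fork_weight (_ : r = (r - 2).+2)%N; last by nlia.
rewrite !subSS subn0; set k := (r - 2)%N.
rewrite !sum_from_to_recr; try nlia.
by rewrite /sum_from_to big_nat1 /= -[k.+2]addn2 natrD; ring.
Qed.

Lemma solve_fork L T :
  (forall c, (1 <= c <= r)%N -> 0 <= L c) -> bethe_system r L T ->
  (forall c, (1 <= c <= r)%N -> size (T c) = 1%N) ->
  (0 < L r.-1 /\ 0 < L r) /\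
  forall y, represents_roots y T -> represents_iii L r y.
Proof.
move=> L0 [T0 H] sz; pose t c := head 0 (T c).
have Tt c : (c <= r)%N -> T c = [:: t c].
  by case: c => [|c] c_l; rewrite /t ?T0 //; apply: size1_head; rewrite sz; nlia.
have t0 : t 0%N = 1 by rewrite /t T0.
have leaf c : (c == r) || (c == r.-1) ->
    [/\ 0 < L c, t c != 0 & step_ratio (L c) (t (r - 2)%N) (t c)].
  move=> cr; have := H c; rewrite nbrs_leaf // !Tt; try nlia.
  move=> /(_ ltac:(nlia))/node_eq1[]; rewrite inE big_seq1 => ne Lc E.
  have [l1 t1 rt] := chain_leaf Lc ne E; split=> //.
  by rewrite lt_def l1 L0 //; nlia.
have [La ta ra] := leaf r.-1 ltac:(nlia).
have [Lb tb rb] := leaf r ltac:(nlia).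
have x0 c : (1 <= c <= r - 2)%N -> 0 < fork_weight L c.
  by move=> c_r; apply: path_weight_gt0 => // [d d_r|]; [apply: L0|]; nlia.
have tr2 : t (r - 2)%N != 0 by apply: step_ratio_neq0 La ra ta.
have rr : step_ratio (fork_weight L (r - 2)%N) (t (r - 3)%N) (t (r - 2)%N).
  have := H (r - 2)%N; rewrite nbrs_fork !Tt; try nlia.
  move=> /(_ ltac:(nlia))/node_eq1[]; rewrite !inE !negb_or => /and3P[ne _ _] _ E.
  rewrite fork_weight_base; apply: chain_fork (ltW La) (ltW Lb) tr2 ne ra rb _.
  by rewrite -E !big_cons big_nil /=; ring.
have ratios c : (c <= r - 2)%N -> t c != 0 /\
    ((1 <= c)%N -> step_ratio (fork_weight L c) (t c.-1) (t c)).
  apply: (@chain_down C (r - 2) L t (fork_weight L)) => //.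
  - by move=> d d_r; apply: fork_weight_rec; nlia.
  - move=> d d_r; have := H d; rewrite nbrs_chain ?Tt; try nlia.
    move=> /(_ ltac:(nlia))/node_eq1[]; rewrite !inE negb_or => /andP[ne _] _ E.
    by split=> //; rewrite -E !big_cons big_nil addr0.
  by rewrite (_ : (r - 2).-1 = r - 3)%N //; nlia.
have cE j : (j <= r - 2)%N -> t j = coef_iii L r j.
  move=> j_r; rewrite (@chain_prod C (r - 2) t (fork_weight L)) //; last first.
    by move=> c c_r; apply: (ratios c _).2; nlia.
  by apply: eq_big_nat => i i_bd; rewrite /fork_weight; congr (_ / _); ring.
split=> // y yT; split.
- by move=> j j_r; rewrite yT ?Tt ?big_seq1 ?cE //; nlia.
- rewrite yT ?Tt ?big_seq1; try nlia.
  by rewrite -cE // -(step_ratioE (ltW La) ra).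
rewrite yT ?Tt ?big_seq1; try nlia.
by rewrite -cE // -(step_ratioE (ltW Lb) rb).
Qed.

End Solve.

(** * Nodes carrying two variables *)

Section Doubled.
Variables (C : numFieldType) (r k : nat) (L : nat -> C).
Hypotheses (r4 : (4 <= r)%N) (kr : (k <= r - 3)%N).
Hypothesis L0 : forall c, (1 <= c <= r)%N -> 0 <= L c.

(** The label of node i once the doubled nodes k+1, ..., i-1 have been replaced by their centers;
    [x_weight] and [y_weight] are the resulting labels of the two leaves. *)
Definition rho_weight i : C := sum_from_to L k.+1 i + (i - k.+1)%:R.
Definition x_weight : C := L r.-1 + rho_weight (r - 2) + 1.
Definition y_weight : C := L r + rho_weight (r - 2) + 1.
(** The ratio parameter of the i-th center; at i = r-2 it is the one given by [step_ratio_fork]. The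
    sum [rho_weight i + q_weight i] is the number M of the theorem, for every i. *)
Definition q_weight i : C := x_weight + y_weight - rho_weight i.
Definition p_weight i : C :=
  sum_from_to L i k + (x_weight + y_weight) + 2 + (k - i)%:R.
Definition node_weight i : C := if (i <= k)%N then p_weight i else q_weight i.
(** For c <= k this is the root at node c, for larger c the center of the reproduction at the
    doubled node c. *)
Definition center c : C :=
  \prod_(1 <= i < c.+1) (node_weight i / (node_weight i + 1)).
Definition pair_weight c : C :=
  x_weight / (x_weight + 1) * (y_weight / (y_weight + 1))
  * \prod_(c <= i < r.-1) (q_weight i / (q_weight i + 1)
                           * (rho_weight i / (rho_weight i + 1))).

Lemma rho_weightS i : (k < i)%N -> rho_weight i.+1 = rho_weight i + L i.+1 + 1.
Proof.
move=> ki; rewrite /rho_weight sum_from_to_recr; last by nlia.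
by rewrite subSn // -natr1; ring.
Qed.

Lemma rho_weight_base : rho_weight k.+1 = L k.+1.
Proof. by rewrite /rho_weight /sum_from_to big_nat1 subnn addr0. Qed.

Lemma rho_weight_gt0 i : 0 < L k.+1 -> (k < i <= r - 2)%N -> 0 < rho_weight i.
Proof.
move=> Lk i_bd; rewrite /rho_weight sum_from_to_recl; last by nlia.
rewrite -addrA ltr_wpDr // addr_ge0 // sum_from_to_ge0 // => c c_bd.
by apply: L0; nlia.
Qed.

Lemma rho_weight_le i j : (k < i)%N -> (i <= j <= r - 2)%N ->
  rho_weight i <= rho_weight j.
Proof.
move=> ki /andP[ij jr]; elim: j ij jr => [|j IH]; first by nlia.
rewrite leq_eqVlt => /orP[/eqP <- //|ij] jr.
rewrite rho_weightS; last by nlia.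
apply: le_trans (IH ij (ltnW jr)) _; rewrite -addrA lerDl addr_ge0 // L0 //.
nlia.
Qed.

Lemma x_weight_gt0 : 0 < L k.+1 -> 0 < x_weight.
Proof.
move=> Lk; rewrite /x_weight ltr_wpDr // ltr_wpDl ?L0 //; first by nlia.
by apply: rho_weight_gt0 => //; nlia.
Qed.

Lemma y_weight_gt0 : 0 < L k.+1 -> 0 < y_weight.
Proof.
move=> Lk; rewrite /y_weight ltr_wpDr // ltr_wpDl ?L0 //; first by nlia.
by apply: rho_weight_gt0 => //; nlia.
Qed.

Lemma q_weight_gt0 i : 0 < L k.+1 -> (k < i <= r - 2)%N -> 0 < q_weight i.
Proof.
move=> Lk i_bd.
have -> : q_weight i = (rho_weight (r - 2) - rho_weight i)
     + (rho_weight (r - 2) + (L r.-1 + L r + 2)).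
  by rewrite /q_weight /x_weight /y_weight; ring.
rewrite ltr_wpDl ?subr_ge0 ?rho_weight_le //; try nlia.
rewrite ltr_wpDr ?rho_weight_gt0 //; try nlia.
by rewrite !addr_ge0 ?L0 //; nlia.
Qed.

Lemma q_weightS i : (k < i)%N -> q_weight i = q_weight i.+1 + L i.+1 + 1.
Proof. by move=> ki; rewrite /q_weight rho_weightS //; ring. Qed.

Lemma p_weight_base : p_weight k = q_weight k.+1 + (L k + rho_weight k.+1 + 1) + 1.
Proof.
by rewrite /p_weight /q_weight /sum_from_to big_nat1 subnn; ring.
Qed.

Lemma p_weight_rec i : (i < k)%N -> p_weight i = p_weight i.+1 + L i + 1.
Proof.
move=> ik; rewrite /p_weight sum_from_to_recl; last exact: ltnW.
by rewrite -(subnSK ik) -natr1; ring.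
Qed.

Lemma p_weight_gt0 i : 0 < L k.+1 -> (1 <= i <= k)%N -> 0 < p_weight i.
Proof.
move=> Lk i_bd; rewrite /p_weight ltr_wpDr // ltr_wpDr // ltr_wpDl //.
  by rewrite sum_from_to_ge0 // => c c_bd; apply: L0; nlia.
by rewrite addr_gt0 ?x_weight_gt0 ?y_weight_gt0.
Qed.

Lemma node_weight_gt0 i : 0 < L k.+1 -> (1 <= i <= r - 2)%N -> 0 < node_weight i.
Proof.
move=> Lk i_bd; rewrite /node_weight; case: leqP => ik.
  by apply: p_weight_gt0 => //; nlia.
by apply: q_weight_gt0 => //; nlia.
Qed.

Lemma center_step c : 0 < L k.+1 -> (1 <= c <= r - 2)%N ->
  step_ratio (node_weight c) (center c.-1) (center c).
Proof.
case: c => // c Lk c_bd; have w0 := node_weight_gt0 Lk c_bd.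
rewrite /step_ratio /center big_nat_recr //= -/(center c).
by field; rewrite gt_eqF // addr_gt0.
Qed.

Lemma center_neq0 c : 0 < L k.+1 -> (c <= r - 2)%N -> center c != 0.
Proof.
move=> Lk c_r; rewrite /center prodf_seq_neq0; apply/allP => i.
rewrite mem_index_iota => i_bd /=.
have w0 : 0 < node_weight i by apply: node_weight_gt0 => //; nlia.
by rewrite gt_eqF // divr_gt0 // addr_gt0.
Qed.

Lemma pair_weight_rec c : (c <= r - 2)%N ->
  pair_weight c = q_weight c / (q_weight c + 1)
     * (rho_weight c / (rho_weight c + 1)) * pair_weight c.+1.
Proof. by move=> c_r; rewrite /pair_weight big_ltn; [ring|nlia]. Qed.

Lemma pair_weight_bounds c : 0 < L k.+1 -> (k < c <= r.-1)%N ->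
  0 < pair_weight c < 1.
Proof.
move=> Lk c_bd.
have mul_bounds (u v : C) : 0 < u < 1 -> 0 < v < 1 -> 0 < u * v < 1.
  move=> /andP[u0 u1] /andP[v0 v1]; rewrite mulr_gt0 //=.
  by rewrite mulr_ilt1 // ltW.
have [j jr ->] : exists2 j, (j < r.-1 - k)%N & c = (r.-1 - j)%N.
  by exists (r.-1 - c)%N; nlia.
elim: j jr => [|j IH] jr.
  rewrite subn0 /pair_weight big_geq // mulr1.
  by rewrite mul_bounds ?shift_ratio_bounds ?x_weight_gt0 ?y_weight_gt0.
have e : (r.-1 - j.+1).+1 = (r.-1 - j)%N by nlia.
rewrite pair_weight_rec ?e; last by nlia.
rewrite mul_bounds ?IH //; last exact: ltnW.
rewrite mul_bounds ?shift_ratio_bounds //.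
  by apply: q_weight_gt0 => //; nlia.
by apply: rho_weight_gt0 => //; nlia.
Qed.

Lemma pair_weight_base : 0 < L k.+1 -> forall e : C,
  quad_pair (x_weight + y_weight) (pair_weight r.-1) e
    (x_weight / (x_weight + 1) * e) (y_weight / (y_weight + 1) * e).
Proof.
move=> Lk e; have [x0 y0] := (x_weight_gt0 Lk, y_weight_gt0 Lk).
have x1 : x_weight + 1 != 0 by rewrite gt_eqF // addr_gt0.
have y1 : y_weight + 1 != 0 by rewrite gt_eqF // addr_gt0.
have M1 : x_weight + y_weight + 1 != 0 by rewrite gt_eqF // addr_gt0 // addr_gt0.
rewrite /pair_weight big_geq // mulr1; split; last by field; rewrite x1 y1.
by field; rewrite x1 y1 M1.
Qed.

Section Solution.
Variable T : nat -> seq C.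
Hypothesis sysT : bethe_system r L T.
Variables t A B : nat -> C.
Hypothesis T_single : forall c, (c <= k)%N || (c == r.-1) || (c == r) ->
  T c = [:: t c].
Hypothesis T_double : forall c, (k < c <= r - 2)%N -> T c = [:: A c; B c].
(** The two leaves count as a pair with index r-1, which makes node r-2 look like the other doubled
    nodes. *)
Hypothesis pair_leaves : A r.-1 = t r.-1 /\ B r.-1 = t r.

Lemma nbrs_double c : (k < c <= r - 2)%N ->
  nbrs r T c = T c.-1 ++ [:: A c.+1; B c.+1].
Proof.
move=> c_bd; case: (eqVneq c (r - 2)%N) => [->|ne].
  rewrite nbrs_fork // !(@T_single r.-1, @T_single r) ?eqxx ?orbT //.
  have [<- <-] := pair_leaves; rewrite /= [in RHS](_ : (r - 2).+1 = r.-1); last by nlia.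
  by rewrite (_ : (r - 2).-1 = r - 3)%N //; nlia.
by rewrite nbrs_chain ?(@T_double c.+1) //; nlia.
Qed.

Let node c (c_bd : (1 <= c <= r)%N) : node_eq (L c) (T c) (nbrs r T c).
Proof. exact: proj2 sysT c c_bd. Qed.

Let t0 : t 0 = 1.
Proof. by have := proj1 sysT; rewrite T_single // => -[]. Qed.

Lemma first_double_label : 0 < L k.+1.
Proof.
have c_bd : (1 <= k.+1 <= r)%N by nlia.
have := node c_bd; rewrite nbrs_double ?(T_double (c := k.+1)) /= ?(T_single (c := k)) ?leqnn //; try nlia.
move=> /node_eq2[ab]; rewrite !inE !negb_or.
move=> /andP[/and3P[ae aa ab'] /and3P[be ba bb]] l0 Ea Eb.
rewrite lt_def L0 // andbT; apply/eqP => Lk.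
rewrite Lk mul0r add0r !big_cons big_nil addr0 addrA in Ea.
rewrite Lk mul0r add0r !big_cons big_nil addr0 addrA in Eb.
exact: no_double_node_at_zero ab ae aa ab' be ba bb Ea Eb.
Qed.

Let Lk : 0 < L k.+1. Proof. exact: first_double_label. Qed.

(** The outward pass. Below the doubled part [d] consists of the actual roots, so d k is the
    neighbour e of the first reproduction. *)
Lemma double_reproductions m : (k < m <= r - 2)%N ->
  exists d : nat -> C, (forall c, (c <= k)%N -> d c = t c) /\
  forall i, (k < i <= m)%N ->
    reproduction (rho_weight i) (d i.-1) (A i) (B i) (d i) (A i.+1) (B i.+1) /\
    (d i = 0 -> A i * B i != 0).
Proof.
elim: m => [//|m IH] m_bd.
case: (eqVneq m k) => [->|mk].
  have c_bd : (1 <= k.+1 <= r)%N by nlia.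
  have step (d0 : C) :
      reproduction (rho_weight k.+1) (t k) (A k.+1) (B k.+1) d0 (A k.+2) (B k.+2) ->
      A k.+1 * B k.+1 != 0 ->
    exists d : nat -> C, (forall c, (c <= k)%N -> d c = t c) /\
    forall i, (k < i <= k.+1)%N ->
    reproduction (rho_weight i) (d i.-1) (A i) (B i) (d i) (A i.+1) (B i.+1) /\
    (d i = 0 -> A i * B i != 0).
    move=> Hd AB; exists (fun c => if c == k.+1 then d0 else t c).
    split=> [c ck|i i_bd]; first by case: eqP => // e; move: ck; rewrite e ltnn.
    have -> : i = k.+1 by nlia.
    by rewrite eqxx /= (_ : (k == k.+1) = false) //; nlia.
  have := node c_bd; rewrite nbrs_double ?(T_double (c := k.+1)) /= ?(T_single (c := k)) ?leqnn //; try nlia.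
  move=> /node_eq2[ab]; rewrite !inE !negb_or.
  move=> /andP[/and3P[ae aa ab'] /and3P[be ba bb]] l0.
  have /andP[a0 b0] := l0 (lt0r_neq0 Lk).
  rewrite !big_cons !big_nil !addr0 !addrA => Ea Eb.
  have [d0 Hd] : exists d0, reproduction (rho_weight k.+1) (t k) (A k.+1) (B k.+1)
      d0 (A k.+2) (B k.+2).
    rewrite rho_weight_base.
    by apply: reproduction_exists; rewrite ?(lt0r_neq0 Lk) // ?addrA.
  by apply: step Hd _; rewrite mulf_neq0.
have [|d [dk dW]] := IH; first by nlia.
have c_bd : (1 <= m.+1 <= r)%N by nlia.
have [|W inv] := dW m; first by nlia.
have nm : 0 < rho_weight m by apply: rho_weight_gt0 Lk _; nlia.
have rS : rho_weight m.+1 = rho_weight m + L m.+1 + 1 by apply: rho_weightS; nlia.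
have step (d' : C) :
    reproduction (rho_weight m + L m.+1 + 1) (d m) (A m.+1) (B m.+1) d' (A m.+2) (B m.+2) ->
    (d' = 0 -> A m.+1 * B m.+1 != 0) ->
    exists d : nat -> C, (forall c, (c <= k)%N -> d c = t c) /\
    forall i, (k < i <= m.+1)%N ->
    reproduction (rho_weight i) (d i.-1) (A i) (B i) (d i) (A i.+1) (B i.+1) /\
    (d i = 0 -> A i * B i != 0).
  move=> W' inv'.
  exists (fun c => if c == m.+1 then d' else d c); split=> [c ck|i i_bd].
    by case: eqP => [e|_]; [nlia|exact: dk].
  case: (eqVneq i m.+1) => [->|im].
    by rewrite /= (_ : (m == m.+1) = false) ?rS //; nlia.
  rewrite (_ : (i.-1 == m.+1) = false); last by nlia.
  by apply: dW; nlia.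
have := node c_bd; rewrite nbrs_double ?(T_double (c := m.+1)) ?(T_double (c := m)) /=; try nlia.
move=> /node_eq2[ab]; rewrite !inE !negb_or.
move=> /andP[/and4P[aa ab' aa'' ab''] /and4P[ba bb ba'' bb'']] l0.
rewrite !big_cons !big_nil !addr0 => Ea Eb.
have [||||d' [W' inv']] := reproduction_step nm (L0 c_bd) W inv
   ab aa ab' ba bb aa'' ab'' ba'' bb''.
- by move=> /l0 /andP[].
- by move=> /l0 /andP[].
- by rewrite -Ea; ring.
- by rewrite -Eb; ring.
exact: step W' inv'.
Qed.

(** After the outward pass, the leaves give their ratios to the last center, the ratios of the
    centers follow from r-2 down to 1, and only then are the pairs computed, again from the leaves
    inwards. *)
Lemma double_solution_aux :
  (forall c, (c <= k)%N -> T c = [:: center c]) /\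
  [/\ forall c, (k < c <= r - 2)%N -> exists a b, T c = [:: a; b] /\
        quad_pair (x_weight + y_weight) (pair_weight c) (center c.-1) a b,
      T r.-1 = [:: x_weight / (x_weight + 1) * center (r - 2)] &
      T r = [:: y_weight / (y_weight + 1) * center (r - 2)]].
Proof.
have [|d [dk dW]] := @double_reproductions (r - 2); first by nlia.
have n0 i : (k < i <= r - 2)%N -> 0 < rho_weight i by apply: rho_weight_gt0 Lk.
have [x0 y0] := (x_weight_gt0 Lk, y_weight_gt0 Lk).
have e2 : (r - 2).+1 = r.-1 by nlia.
have [|W inv] := dW (r - 2)%N; first by nlia.
rewrite e2 (proj1 pair_leaves) (proj2 pair_leaves) in W.
have leaf c : (c == r) || (c == r.-1) ->
    [/\ t c != A (r - 2)%N, t c != B (r - 2)%N, L c != 0 -> t c != 0 &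
      L c / t c + (1 / (t c - A (r - 2)%N) + 1 / (t c - B (r - 2)%N)) = 0].
  move=> cr; have c_bd : (1 <= c <= r)%N by nlia.
  have := node c_bd; rewrite nbrs_leaf // (T_double (c := (r - 2)%N)) ?T_single; try nlia.
  move=> /node_eq1[]; rewrite !inE negb_or => /andP[ca cb] l0.
  by rewrite !big_cons big_nil addr0 => E.
have [ta tb tl Et] := leaf r.-1 ltac:(nlia).
have [ua ub ul Eu] := leaf r ltac:(nlia).
have Lr1 : 0 <= L r.-1 by apply: L0; nlia.
have Lr : 0 <= L r by apply: L0; nlia.
have nr : 0 < rho_weight (r - 2) by apply: n0; nlia.
(* The node equation itself excludes the root 0 only when the label is nonzero. *)
have t1 : t r.-1 != 0.
  case: (eqVneq (L r.-1) 0) => [l0|/tl //].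
  rewrite l0 mul0r add0r in Et.
  exact: double_leaf_nonzero nr Lr W inv ta tb ua ub Et Eu.
have u1 : t r != 0.
  case: (eqVneq (L r) 0) => [l0|/ul //].
  rewrite l0 mul0r add0r in Eu.
  exact: double_leaf_nonzero nr Lr1 (reproductionC W) inv ua ub ta tb Eu Et.
have rt : step_ratio x_weight (d (r - 2)%N) (t r.-1) by apply: double_leaf t1 W ta tb Et.
have ru : step_ratio y_weight (d (r - 2)%N) (t r).
  by apply: double_leaf u1 (reproductionC W) ua ub Eu.
have dr : d (r - 2)%N != 0 by apply: step_ratio_neq0 rt t1.
have ABne i : (k < i <= r - 2)%N -> A i != B i.
  move=> i_bd; have c_bd : (1 <= i <= r)%N by nlia.
  by have := node c_bd; rewrite T_double // => /node_eq2[].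
have down i : (k < i <= r - 2)%N -> d i != 0 /\ step_ratio (q_weight i) (d i.-1) (d i).
  move=> i_bd; have [j jr ->] : exists2 j, (j < r - 2 - k)%N & i = (r - 2 - j)%N.
    by exists (r - 2 - i)%N; nlia.
  elim: j jr => [|j IH] jr.
    rewrite subn0; split=> //.
    exact: step_ratio_fork nr (ltW x0) (ltW y0) dr W rt ru.
  have [|d1 r1] := IH; first by nlia.
  have e : (r - 2 - j)%N = (r - 2 - j.+1).+1 by nlia.
  rewrite {}e in d1 r1; set m := (r - 2 - j.+1)%N in d1 r1 *.
  have q0 : 0 < q_weight m.+1 by apply: q_weight_gt0 => //; nlia.
  have dm : d m != 0 by apply: step_ratio_neq0 q0 r1 d1.
  split=> //.
  have [|Wm _] := dW m; first by nlia.
  have [|Wm1 _] := dW m.+1; first by nlia.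
  rewrite q_weightS; last by nlia.
  rewrite rho_weightS in Wm1; last by nlia.
  apply: step_ratio_double (ltW q0) dm _ Wm Wm1 r1; last by apply: ABne; nlia.
  by apply: n0; nlia.
have qk : 0 < q_weight k.+1 by apply: q_weight_gt0 => //; nlia.
have [|dk1 rk] := down k.+1; first by nlia.
have dk0 : d k != 0 by apply: step_ratio_neq0 qk rk dk1.
have ratios c : (1 <= c <= r - 2)%N -> step_ratio (node_weight c) (d c.-1) (d c).
  move=> c_bd; rewrite /node_weight; case: leqP => ck; last first.
    by apply: (down c _).2; nlia.
  have up i : (1 <= i <= k)%N -> nbrs r T i = T i.-1 ++ T i.+1.
    by move=> i_bd; apply: nbrs_chain; nlia.
  apply: (@chain_down C k L d p_weight _ _ _ _ dk0 c ck).2; last by nlia.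
  - by move=> i; apply: p_weight_gt0.
  - by move=> i i_bd; apply: p_weight_rec; nlia.
  - move=> i i_bd; have i_r : (1 <= i <= r)%N by nlia.
    have := node i_r; rewrite up ?T_single -?dk; try nlia.
    move=> /node_eq1[]; rewrite !inE negb_or => /andP[ne _] _ E; split=> //.
    by rewrite -E !big_cons big_nil addr0.
  move=> k1; have k_r : (1 <= k <= r)%N by nlia.
  have := node k_r; rewrite up ?(T_double (c := k.+1)) ?T_single -?dk; try nlia.
  move=> /node_eq1[]; rewrite !inE !negb_or => /and3P[ne ka kb] _ E.
  have [|Wk _] := dW k.+1; first by nlia.
  (* The last single node sees the first pair as the center at k+1 plus [rho_weight k.+1 + 1] units
     of label, and so becomes an ordinary chain node. *)
  have [_ K] := reproduction_at_root Wk (Or31 _ _ erefl) dk0 ka kb.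
  rewrite p_weight_base; apply: chain_node (ltW qk) dk0 ne rk _.
  rewrite -E !big_cons big_nil addr0 K /=; ring.
have dE c : (c <= r - 2)%N -> d c = center c.
  apply: chain_prod => //; first by rewrite dk.
  by move=> i; apply: node_weight_gt0.
split=> [c ck|]; first by rewrite T_single ?ck // -dk // dE //; nlia.
have tE : t r.-1 = x_weight / (x_weight + 1) * center (r - 2).
  by rewrite -dE // -(step_ratioE (ltW x0) rt).
have uE : t r = y_weight / (y_weight + 1) * center (r - 2).
  by rewrite -dE // -(step_ratioE (ltW y0) ru).
have pairs i : (k < i <= r.-1)%N ->
    quad_pair (x_weight + y_weight) (pair_weight i) (d i.-1) (A i) (B i).
  move=> i_bd; have [j jr ->] : exists2 j, (j < r.-1 - k)%N & i = (r.-1 - j)%N.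
    by exists (r.-1 - i)%N; nlia.
  elim: j jr => [|j IH] jr.
    rewrite subn0 (proj1 pair_leaves) (proj2 pair_leaves) tE uE.
    rewrite (_ : r.-1.-1 = r - 2)%N ?dE //; last by nlia.
    exact: pair_weight_base.
  have {}IH := IH (ltnW jr).
  have e : (r.-1 - j)%N = (r.-1 - j.+1).+1 by nlia.
  rewrite {}e in IH; set m := (r.-1 - j.+1)%N in IH *.
  have m_bd : (k < m <= r - 2)%N by nlia.
  have q0 : 0 < q_weight m by apply: q_weight_gt0.
  have [dm rm] := down m m_bd; have dm1 := step_ratio_neq0 q0 rm dm.
  have [Wm _] := dW m m_bd.
  have MnE : x_weight + y_weight = rho_weight m + q_weight m.
    by rewrite /q_weight; ring.
  rewrite /= (step_ratioE (ltW q0) rm) MnE in IH.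
  rewrite (step_ratioE (ltW q0) rm) in Wm.
  rewrite pair_weight_rec ?MnE; last by nlia.
  exact: ((@reproduction_quad_pair _ _ _ _ _ (A m) (B m) _ _ (n0 m m_bd) q0 dm1 IH).2 Wm).
split.
- move=> c c_bd; exists (A c), (B c); rewrite T_double //; split=> //.
  by rewrite -dE; [apply: pairs|]; nlia.
- by rewrite T_single ?tE ?eqxx ?orbT.
by rewrite T_single ?uE ?eqxx ?orbT.
Qed.

End Solution.

Lemma double_solution T : bethe_system r L T ->
  (forall c, (1 <= c <= r)%N -> size (T c) = if (k < c <= r - 2)%N then 2 else 1) ->
  0 < L k.+1 /\
  (forall c, (c <= k)%N -> T c = [:: center c]) /\
  [/\ forall c, (k < c <= r - 2)%N -> exists a b, T c = [:: a; b] /\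
        quad_pair (x_weight + y_weight) (pair_weight c) (center c.-1) a b,
      T r.-1 = [:: x_weight / (x_weight + 1) * center (r - 2)] &
      T r = [:: y_weight / (y_weight + 1) * center (r - 2)]].
Proof.
move=> sysT szT; pose t c := head 0 (T c); pose A c := nth 0 (T c) 0.
pose B c := if c == r.-1 then t r else nth 0 (T c) 1.
have Ts c : (c <= k)%N || (c == r.-1) || (c == r) -> T c = [:: t c].
  case: c => [|c] c_bd; rewrite /t; first by rewrite (proj1 sysT).
  by apply: size1_head; rewrite szT; [case: ifP|]; nlia.
have Td c : (k < c <= r - 2)%N -> T c = [:: A c; B c].
  move=> c_bd; rewrite /A /B (_ : c == r.-1 = false); last by nlia.
  by apply: size2_nth; rewrite szT ?c_bd //; nlia.
have lv : A r.-1 = t r.-1 /\ B r.-1 = t r.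
  by rewrite /A /B eqxx /t; case: (T r.-1); split.
split; first exact: (first_double_label sysT Ts Td lv).
exact: (double_solution_aux sysT Ts Td lv).
Qed.

End Doubled.

(** * Translation of the weights into the P, Q, R, X, Y and M of the statement *)

Section RepresentsDoubled.
Variables (C : numFieldType) (r k : nat) (L : nat -> C).
Hypotheses (r4 : (4 <= r)%N) (kr : (k <= r - 3)%N).
Local Notation l := (2 * r - 2 - k)%N.

Let e1 : (2 * r - 2 - l)%N = k. Proof. nlia. Qed.
Let e2 : (2 * r - l - 1)%N = k.+1. Proof. nlia. Qed.
Let e3 : (2 * r - 1 - l)%N = k.+1. Proof. nlia. Qed.
Let e4 : (2 * r - l - 2)%N = k. Proof. nlia. Qed.
Let lE : l%:R = 2 * r%:R - 2 - k%:R :> C.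
Proof. by rewrite !natrB ?natrM //; nlia. Qed.

Let rho_base : rho_weight k L (r - 2) =
  sum_from_to L k.+1 (r - 2) + r%:R - 3 - k%:R.
Proof.
rewrite /rho_weight (_ : (r - 2 - k.+1 = r - 3 - k)%N); last by nlia.
by rewrite !natrB; try nlia; ring.
Qed.

Let facR_E i : (k < i)%N ->
  facR L r l i = rho_weight k L i / (rho_weight k L i + 1).
Proof.
move=> ki; rewrite /facR e2 /shift_ratio.
suff -> : sum_from_to L k.+1 i + l%:R + i%:R + 1 - 2 * r%:R = rho_weight k L i by [].
by rewrite lE /rho_weight natrB // -natr1; ring.
Qed.

Let facX_E : facX L r l = x_weight r k L / (x_weight r k L + 1).
Proof.
rewrite /facX e3 /shift_ratio.
suff -> : sum_from_to L k.+1 (r - 2) + L r.-1 + l%:R - r%:R = x_weight r k L by [].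
by rewrite lE /x_weight rho_base; ring.
Qed.

Let facY_E : facY L r l = y_weight r k L / (y_weight r k L + 1).
Proof.
rewrite /facY e3 /shift_ratio.
suff -> : sum_from_to L k.+1 (r - 2) + L r + l%:R - r%:R = y_weight r k L by [].
by rewrite lE /y_weight rho_base; ring.
Qed.

Let numM_E : numM L r l = x_weight r k L + y_weight r k L.
Proof. by rewrite /numM e2 lE /x_weight /y_weight rho_base; ring. Qed.

Let facQ_E i : (k < i <= r - 2)%N ->
  facQ L r l i = q_weight r k L i / (q_weight r k L i + 1).
Proof.
move=> ki; rewrite /facQ e3 /shift_ratio.
suff -> : sum_from_to L k.+1 i + 2 * sum_from_to L i.+1 (r - 2) + L r.-1 + L r
    + l%:R - i%:R - 1 = q_weight r k L i by [].
rewrite lE /q_weight /x_weight /y_weight rho_base /rho_weight natrB; last by nlia.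
have -> : sum_from_to L k.+1 (r - 2) =
    sum_from_to L k.+1 i + sum_from_to L i.+1 (r - 2).
  by rewrite /sum_from_to -big_cat_nat //; nlia.
by rewrite -natr1; ring.
Qed.

Let facP_E i : (i <= k)%N ->
  facP L r l i = p_weight r k L i / (p_weight r k L i + 1).
Proof.
move=> ik; rewrite /facP e1 e2 /shift_ratio.
suff -> : sum_from_to L i k + 2 * sum_from_to L k.+1 (r - 2) + L r.-1 + L r
    + l%:R - i%:R = p_weight r k L i by [].
by rewrite lE /p_weight /x_weight /y_weight rho_base natrB //; ring.
Qed.

Let prodP_E c : (c <= k)%N -> \prod_(1 <= i < c.+1) facP L r l i = center r k L c.
Proof.
move=> ck; apply: eq_big_nat => i i_bd; rewrite facP_E; last by nlia.
by rewrite /node_weight (_ : (i <= k)%N) //; nlia.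
Qed.

Let prodPQ_E c : (k <= c <= r - 2)%N ->
  center r k L k * \prod_(k.+1 <= i < c.+1) facQ L r l i = center r k L c.
Proof.
move=> ck; rewrite /center [RHS](big_cat_nat (n := k.+1)) //=; try nlia.
congr (_ * _); apply: eq_big_nat => i i_bd; rewrite facQ_E; last by nlia.
by rewrite /node_weight (_ : (i <= k)%N = false) //; nlia.
Qed.

Let pairs_E c : (k < c <= r.-1)%N -> pair_weight r k L c =
  facX L r l * facY L r l * (\prod_(c <= i < r.-1) facQ L r l i)
    * \prod_(c <= i < r.-1) facR L r l i.
Proof.
move=> ck; rewrite /pair_weight facX_E facY_E -[RHS]mulrA -big_split /=.
by congr (_ * _); apply: eq_big_nat => i i_bd; rewrite facQ_E ?facR_E //; nlia.
Qed.

Lemma solve_double T :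
  (forall c, (1 <= c <= r)%N -> 0 <= L c) -> bethe_system r L T ->
  (forall c, (1 <= c <= r)%N -> size (T c) = if (k < c <= r - 2)%N then 2 else 1) ->
  0 < L k.+1 /\ forall y, represents_roots r y T -> represents_iv L r l y.
Proof.
move=> L0 sysT szT; have [Lk [Tc [Tp Ta Tb]]] := double_solution r4 kr L0 sysT szT.
split=> // y yT.
rewrite /represents_iv e3 e4; split.
- by move=> j j_bd; rewrite yT ?Tc ?big_seq1 ?prodP_E //; nlia.
- move=> c c_bd; have [a [b [TE [s p]]]] := Tp c c_bd.
  have cE : center r k L k * \prod_(k.+1 <= i < c) facQ L r l i = center r k L c.-1.
    by have -> : c = c.-1.+1 by [nlia]; rewrite prodPQ_E //; nlia.
  exists a, b; split.
  + by rewrite yT ?TE ?big_cons ?big_nil ?mulr1 //; nlia.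
  + rewrite p prodP_E // pairs_E -?cE; last by nlia.
    (* Splitting the full product of the Q_i at c exposes the second copy of the initial part, which
       completes the square of the preceding center. *)
    rewrite [\prod_(k.+1 <= i < r.-1) facQ _ _ _ _](big_cat_nat (n := c)) //=; try nlia.
    ring.
  rewrite s prodP_E // cE numM_E pairs_E; last by nlia.
  rewrite -mulrA; congr (_ * _); rewrite mulrDl; congr (_ + _); ring.
- rewrite yT ?Ta ?big_seq1 ?prodP_E; try nlia.
  rewrite facX_E -[in RHS]mulrA (_ : \prod_(k.+1 <= i < r.-1) _ =
    \prod_(k.+1 <= i < (r - 2).+1) facQ L r l i) ?prodPQ_E //; try nlia.
  by congr bigop; congr index_iota; nlia.
rewrite yT ?Tb ?big_seq1 ?prodP_E; try nlia.
rewrite facY_E -[in RHS]mulrA (_ : \prod_(k.+1 <= i < r.-1) _ =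
  \prod_(k.+1 <= i < (r - 2).+1) facQ L r l i) ?prodPQ_E //; try nlia.
by congr bigop; congr index_iota; nlia.
Qed.

End RepresentsDoubled.

(** * Existence of solutions *)

Section Existence.
Variable C : numFieldType.
Implicit Types (L t x : nat -> C).

Lemma chain_leaf_node (lam e u : C) :
  0 < lam -> e != 0 -> step_ratio lam e u -> node_eq lam [:: u] [:: e].
Proof.
move=> l0 e0 H; have [u0 ue E _] := step_ratio_facts l0 e0 H.
by apply/node_eq1; rewrite inE big_seq1 E; split=> //; rewrite mulNr subrr.
Qed.

Lemma chain_interior_node (lam x e u w : C) :
  0 < x -> 0 < x + lam + 1 -> e != 0 ->
  step_ratio (x + lam + 1) e u -> step_ratio x u w -> node_eq lam [:: u] [:: e; w].
Proof.
move=> x0 y0 e0 H H'; have [u0 ue E _] := step_ratio_facts y0 e0 H.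
have [w0 wu _ E'] := step_ratio_facts x0 u0 H'.
apply/node_eq1; rewrite !inE negb_or ue eq_sym wu; split=> //.
by rewrite !big_cons big_nil E E'; field.
Qed.

Lemma chain_fork_node (lam x y e u w w' : C) :
  0 < x -> 0 < y -> 0 < x + y + lam + 2 -> e != 0 ->
  step_ratio (x + y + lam + 2) e u -> step_ratio x u w -> step_ratio y u w' ->
  node_eq lam [:: u] [:: e; w; w'].
Proof.
move=> x0 y0 z0 e0 H Hx Hy; have [u0 ue E _] := step_ratio_facts z0 e0 H.
have [w0 wu _ Ex] := step_ratio_facts x0 u0 Hx.
have [w'0 w'u _ Ey] := step_ratio_facts y0 u0 Hy.
apply/node_eq1; rewrite !inE !negb_or ue [u == w]eq_sym wu [u == w']eq_sym w'u.
by split=> //; rewrite !big_cons big_nil E Ex Ey; field.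
Qed.

Lemma prod_step_ratio m x : (forall c, (1 <= c <= m)%N -> 0 < x c) ->
  exists t, [/\ t 0%N = 1, forall c, (c <= m)%N -> t c != 0 &
    forall c, (1 <= c <= m)%N -> step_ratio (x c) (t c.-1) (t c)].
Proof.
move=> x0; pose t c := \prod_(1 <= i < c.+1) (x i / (x i + 1)).
exists t; split=> [|c c_m|c c_m]; first by rewrite /t big_geq.
  rewrite prodf_seq_neq0; apply/allP => i; rewrite mem_index_iota => i_bd /=.
  have w0 : 0 < x i by apply: x0; nlia.
  by rewrite gt_eqF // divr_gt0 // addr_gt0.
case: c c_m => // c c_m; rewrite /step_ratio /t big_nat_recr //=.
have w0 : 0 < x c.+1 by apply: x0.
by field; rewrite gt_eqF // addr_gt0.
Qed.

Variable r : nat.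
Hypothesis r4 : (4 <= r)%N.

Lemma exists_path L l : (l < r)%N ->
  (forall c, (1 <= c <= r)%N -> 0 <= L c) -> ((0 < l)%N -> 0 < L l) ->
  exists2 T, bethe_system r L T &
    forall c, (1 <= c <= r)%N -> size (T c) = (c <= l)%N.
Proof.
move=> l_r L0 Ll.
have x0 c : (1 <= c <= l)%N -> 0 < path_weight L l c.
  by move=> c_l; apply: path_weight_gt0; [move=> d d_l; apply: L0|apply: Ll|]; nlia.
have [t [t00 t0 tr]] := prod_step_ratio x0.
exists (fun c => if (c <= l)%N then [:: t c] else [::]); last first.
  by move=> c _; case: ifP.
split=> [|c c_r]; first by rewrite t00.
case: leqP => cl; last exact: node_eq0.
have c_l : (1 <= c <= l)%N by nlia.
rewrite (nbrs_path r4 (t := t) (l := l)) //; first last.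
- by move=> d d_l; case: leqP => //; nlia.
- by move=> d ->.
have tc0 : t c.-1 != 0 by apply: t0; nlia.
case: ltnP => lt_cl.
  have xE : path_weight L l c = path_weight L l c.+1 + L c + 1.
    exact: path_weight_rec.
  apply: (chain_interior_node (x := path_weight L l c.+1)) => //.
  - by apply: x0; nlia.
  - by rewrite -xE; apply: x0; nlia.
  - by rewrite -xE; apply: tr.
  by apply: (tr c.+1); nlia.
have e : c = l by nlia.
subst c; apply: chain_leaf_node => //; first by apply: Ll; nlia.
have := tr l c_l; rewrite {1}/path_weight (_ : sum_from_to L l l = L l) ?addrK //.
by rewrite /sum_from_to big_nat1.
Qed.

Lemma exists_bar L :
  (forall c, (1 <= c <= r)%N -> 0 <= L c) -> 0 < L r ->
  exists2 T, bethe_system r L T &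
    forall c, (1 <= c <= r)%N -> size (T c) = (c != r.-1).
Proof.
move=> L0 Lr; pose L' c := L (if c == r.-1 then r else c).
have L'r : L' r.-1 = L r by rewrite /L' eqxx.
have x0 c : (1 <= c <= r.-1)%N -> 0 < path_weight L' r.-1 c.
  move=> c_l; apply: path_weight_gt0; rewrite ?L'r //; last by nlia.
  by move=> d d_l; rewrite /L'; case: ifP => ?; apply: L0; nlia.
have [t [t00 t0 tr]] := prod_step_ratio x0.
pose T c := if c == r then [:: t r.-1] else if c == r.-1 then [::] else [:: t c].
have Tr : T r = [:: t r.-1] by rewrite /T eqxx.
have Tn : T r.-1 = [::] by rewrite /T eqxx (_ : r.-1 == r = false) //; nlia.
have Tt c : (c <= r - 2)%N -> T c = [:: t c].
  by move=> c_r; rewrite /T; do 2?[case: eqP => ?; first by nlia].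
exists T; last by move=> c c_r; rewrite /T; do 2![case: eqP => ?] => //; nlia.
split=> [|c c_r]; first by rewrite Tt // t00.
case: (eqVneq c r.-1) => [->|ne]; first by rewrite Tn; apply: node_eq0.
have e2 : r.-1.-1 = (r - 2)%N by nlia.
case: (eqVneq c r) => [->|ne'].
  rewrite Tr nbrs_leaf ?eqxx // Tt //; apply: chain_leaf_node => //.
    by apply: t0; nlia.
  have := tr r.-1 ltac:(nlia); rewrite e2 {1}/path_weight.
  by rewrite (_ : sum_from_to _ _ _ = L r) ?addrK // /sum_from_to big_nat1.
have c_l : (1 <= c <= r - 2)%N by nlia.
rewrite (nbrs_bar r4 Tt Tn Tr) // Tt; last by nlia.
have xE : path_weight L' r.-1 c = path_weight L' r.-1 c.+1 + L c + 1.
  by rewrite path_weight_rec ?{2}/L' ?(negPf ne) //; nlia.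
apply: (chain_interior_node (x := path_weight L' r.-1 c.+1)) => //.
- by apply: x0; nlia.
- by rewrite -xE; apply: x0; nlia.
- by apply: t0; nlia.
- by rewrite -xE; apply: tr; nlia.
by apply: (tr c.+1); nlia.
Qed.

Lemma exists_fork L :
  (forall c, (1 <= c <= r)%N -> 0 <= L c) -> 0 < L r.-1 -> 0 < L r ->
  exists2 T, bethe_system r L T &
    forall c, (1 <= c <= r)%N -> size (T c) = 1%N.
Proof.
move=> L0 La Lb.
have x0 c : (1 <= c <= r - 2)%N -> 0 < fork_weight r L c.
  by move=> c_r; apply: path_weight_gt0 => // [d d_r|]; [apply: L0|]; nlia.
have [t [t00 t0 tr]] := prod_step_ratio x0.
have tr2 : t (r - 2)%N != 0 by apply: t0; nlia.
pose T c := if c == r.-1 then [:: L r.-1 / (L r.-1 + 1) * t (r - 2)%N] else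
  if c == r then [:: L r / (L r + 1) * t (r - 2)%N] else [:: t c].
have leaf (lam : C) : 0 < lam ->
    step_ratio lam (t (r - 2)%N) (lam / (lam + 1) * t (r - 2)%N).
  by move=> lam0; rewrite /step_ratio; field; rewrite gt_eqF // addr_gt0.
have Tt c : (c <= r - 2)%N -> T c = [:: t c].
  by move=> c_r; rewrite /T; do 2?[case: eqP => ?; first by nlia].
have Ta : T r.-1 = [:: L r.-1 / (L r.-1 + 1) * t (r - 2)%N] by rewrite /T eqxx.
have Tb : T r = [:: L r / (L r + 1) * t (r - 2)%N].
  by rewrite /T eqxx (_ : r == r.-1 = false) //; nlia.
exists T; last by move=> c c_r; rewrite /T; case: eqP => // _; case: eqP.
split=> [|c c_r]; first by rewrite Tt // t00.
case: (eqVneq c r.-1) => [->|ne1].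
  by rewrite Ta nbrs_leaf ?eqxx ?orbT // Tt //; apply: chain_leaf_node (leaf _ La).
case: (eqVneq c r) => [->|ne2].
  by rewrite Tb nbrs_leaf ?eqxx ?orbT // Tt //; apply: chain_leaf_node (leaf _ Lb).
have tc0 : t c.-1 != 0 by apply: t0; nlia.
case: (eqVneq c (r - 2)%N) => [e|ne3].
  rewrite e nbrs_fork // Ta Tb (Tt (r - 2)%N) ?(Tt (r - 3)%N) /=; try nlia.
  have f : fork_weight r L (r - 2)%N = L r.-1 + L r + L (r - 2)%N + 2.
    exact: fork_weight_base.
  apply: (chain_fork_node (x := L r.-1) (y := L r)) => //.
  - by rewrite -f; apply: x0; nlia.
  - by apply: t0; nlia.
  - rewrite -f (_ : r - 3 = (r - 2).-1)%N; last by nlia.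
    by apply: tr; nlia.
  - exact: leaf _ La.
  exact: leaf _ Lb.
rewrite nbrs_chain ?Tt /=; try nlia.
have xE : fork_weight r L c = fork_weight r L c.+1 + L c + 1.
  by apply: fork_weight_rec; nlia.
apply: (chain_interior_node (x := fork_weight r L c.+1)) => //.
- by apply: x0; nlia.
- by rewrite -xE; apply: x0; nlia.
- by rewrite -xE; apply: tr; nlia.
by apply: (tr c.+1); nlia.
Qed.

End Existence.

Lemma reproduction_swap (C : numFieldType) (n e a b d a' b' : C) :
  reproduction n e a b d a' b' -> reproduction n e b a d a' b'.
Proof. by move=> H x; rewrite -H; ring. Qed.

Section ExistsDouble.
Variables (C : numFieldType) (r k : nat) (L : nat -> C).
Hypotheses (r4 : (4 <= r)%N) (kr : (k <= r - 3)%N).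
Hypothesis L0 : forall c, (1 <= c <= r)%N -> 0 <= L c.
Hypothesis Lk : 0 < L k.+1.

Local Notation M := (x_weight r k L + y_weight r k L).
Local Notation Z := (pair_weight r k L).
Local Notation D := (center r k L).
Local Notation n := (rho_weight k L).
Local Notation q := (q_weight r k L).

Variables (t a b : nat -> C).
Hypothesis tE : forall c, (c <= k)%N -> t c = D c.
Hypothesis tx : t r.-1 = x_weight r k L / (x_weight r k L + 1) * D (r - 2).
Hypothesis ty : t r = y_weight r k L / (y_weight r k L + 1) * D (r - 2).
Hypothesis ab : forall c, (k < c <= r - 2)%N -> quad_pair M (Z c) (D c.-1) (a c) (b c).
Hypothesis ar : a r.-1 = t r.-1.
Hypothesis br : b r.-1 = t r.

Definition double_roots c : seq C :=
  if (c <= k)%N || (c == r.-1) || (c == r) then [:: t c] else [:: a c; b c].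

Let D0 c : (c <= r - 2)%N -> D c != 0.
Proof. exact: center_neq0. Qed.

Let Z01 c : (k < c <= r.-1)%N -> 0 < Z c < 1.
Proof. exact: pair_weight_bounds. Qed.

Let M0 : 0 < M.
Proof. by rewrite addr_gt0 ?x_weight_gt0 ?y_weight_gt0. Qed.

Let abr c : (k < c <= r.-1)%N -> quad_pair M (Z c) (D c.-1) (a c) (b c).
Proof.
move=> c_bd; case: (eqVneq c r.-1) => [->|ne]; last by apply: ab; nlia.
rewrite ar br tx ty (_ : r.-1.-1 = r - 2)%N; last by nlia.
exact: pair_weight_base.
Qed.

Let n0 c : (k < c <= r - 2)%N -> 0 < n c.
Proof. exact: rho_weight_gt0. Qed.

Let q0 c : (k < c <= r - 2)%N -> 0 < q c.
Proof. exact: q_weight_gt0. Qed.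

Let MnE c : M = n c + q c.
Proof. by rewrite /q_weight; ring. Qed.

Let D_step c : (k < c <= r - 2)%N -> D c = q c / (q c + 1) * D c.-1.
Proof.
move=> c_bd; have h : (1 <= c <= r - 2)%N by nlia.
have := center_step r4 kr L0 Lk h.
rewrite /node_weight (_ : (c <= k)%N = false); last by nlia.
by apply: step_ratioE; rewrite ltW // q0.
Qed.

Let nonzero c : (k < c <= r.-1)%N -> (a c != 0) && (b c != 0).
Proof.
move=> c_bd; have /andP[z0 _] := Z01 c_bd.
by apply: quad_pair_nonzero z0 _ (abr c_bd); apply: D0; nlia.
Qed.

Let off_center c : (k < c <= r.-1)%N -> (D c.-1 != a c) && (D c.-1 != b c).
Proof.
move=> c_bd; have /andP[_ z1] := Z01 c_bd.
by apply: (quad_pair_center (ltW M0) _ _ (abr c_bd)); rewrite ?(lt_eqF z1) ?D0 //; nlia.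
Qed.

Let distinct c : (k < c <= r - 2)%N -> a c != b c.
Proof.
move=> c_bd; have h : (k < c.+1 <= r.-1)%N by nlia.
have cr : (c <= r - 2)%N by nlia.
have H := ab c_bd; rewrite (pair_weight_rec _ r4 kr cr) (MnE c) in H.
by apply: (quad_pair_distinct (n0 c_bd) (q0 c_bd) (Z01 h) _ H); apply: D0; nlia.
Qed.

(** Here the prescribed sums and products become reproduction identities, from which the equations
    of the doubled nodes, of the leaves and of node k are read off. *)
Let W c : (k < c <= r - 2)%N ->
  reproduction (n c) (D c.-1) (a c) (b c) (D c) (a c.+1) (b c.+1).
Proof.
move=> c_bd; have h : (k < c.+1 <= r.-1)%N by nlia.
have e0 : D c.-1 != 0 by apply: D0; nlia.
have h' := abr h; rewrite /= (D_step c_bd) (MnE c) in h'.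
rewrite (D_step c_bd).
have cr : (c <= r - 2)%N by nlia.
have H := ab c_bd; rewrite (pair_weight_rec _ r4 kr cr) (MnE c) in H.
exact: ((@reproduction_quad_pair _ _ _ _ _ (a c) (b c) _ _ (n0 c_bd) (q0 c_bd) e0 h').1 H).
Qed.

Let D_neq c : (k < c <= r - 2)%N -> D c != D c.-1.
Proof.
move=> c_bd; have e0 : D c.-1 != 0 by apply: D0; nlia.
have st : step_ratio (q c) (D c.-1) (D c).
  rewrite (D_step c_bd) /step_ratio; field.
  by rewrite gt_eqF // addr_gt0 // q0.
by have [] := step_ratio_facts (q0 c_bd) e0 st.
Qed.

Let a_neq_D c : (k < c <= r - 2)%N -> (a c != D c) && (b c != D c).
Proof.
move=> c_bd; have h : (k < c.+1 <= r.-1)%N by nlia.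
have /andP[da db] := off_center h.
exact: reproduction_center (lt0r_neq0 (n0 c_bd)) (D_neq c_bd) da db (W c_bd).
Qed.

Let Wnode c (c_bd : (k < c <= r - 2)%N) :
  ([/\ n c != 0, a c != D c.-1, a c != a c.+1 & a c != b c.+1] /\
   n c / a c + (1 / (a c - D c.-1) + 1 / (a c - a c.+1) + 1 / (a c - b c.+1))
     = 2 / (a c - b c)) /\
  ([/\ n c != 0, b c != D c.-1, b c != a c.+1 & b c != b c.+1] /\
   n c / b c + (1 / (b c - D c.-1) + 1 / (b c - a c.+1) + 1 / (b c - b c.+1))
     = 2 / (b c - a c)).
Proof.
have h : (k < c <= r.-1)%N by nlia.
have [/andP[a0 b0] /andP[ad bd]] := (nonzero h, a_neq_D c_bd).
split; first exact: reproduction_node (W c_bd) (distinct c_bd) a0 ad.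
apply: reproduction_node (reproduction_swap (W c_bd)) _ b0 bd.
by rewrite eq_sym distinct.
Qed.

Let T := double_roots.

Let T_single c : (c <= k)%N || (c == r.-1) || (c == r) -> T c = [:: t c].
Proof. by rewrite /T /double_roots => ->. Qed.

Let T_double c : (k < c <= r - 2)%N -> T c = [:: a c; b c].
Proof. by move=> c_bd; rewrite /T /double_roots; case: ifP => //; nlia. Qed.

Let nbrs_dbl c : (k < c <= r - 2)%N -> nbrs r T c = T c.-1 ++ [:: a c.+1; b c.+1].
Proof. by apply: (nbrs_double r4 kr T_single T_double); split. Qed.

Let double_node_first : node_eq (L k.+1) [:: a k.+1; b k.+1]
  [:: t k; a k.+2; b k.+2].
Proof.
have c_bd : (k < k.+1 <= r - 2)%N by nlia.
have h : (k < k.+1 <= r.-1)%N by nlia.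
have := Wnode c_bd; rewrite rho_weight_base /= -(tE (leqnn k)).
case=> -[[_ h1 h2 h3] Ea] [[_ h4 h5 h6] Eb].
apply/node_eq2; rewrite !inE !negb_or h1 h2 h3 h4 h5 h6; split=> //.
- exact: distinct.
- by rewrite nonzero.
- by rewrite -Ea !big_cons big_nil; ring.
by rewrite -Eb !big_cons big_nil; ring.
Qed.

(** The reproduction at c+1 gives the equation with label [n c.+1] and neighbour [D c]; the one at c
    trades that center and the excess label n_c + 1 back for the pair at c. *)
Let double_node_next c : (k < c)%N -> (c.+1 <= r - 2)%N ->
  node_eq (L c.+1) [:: a c.+1; b c.+1] [:: a c; b c; a c.+2; b c.+2].
Proof.
move=> kc cr; have c_bd : (k < c <= r - 2)%N by nlia.
have c1_bd : (k < c.+1 <= r - 2)%N by nlia.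
have h : (k < c.+1 <= r.-1)%N by nlia.
have [/andP[a0 b0] rS] := (nonzero h, rho_weightS L r4 kr kc).
have [[[_ _ h1 h2] _] [[_ _ h3 h4] _]] := Wnode c_bd.
have [[[_ _ g1 g2] Ea] [[_ _ g3 g4] Eb]] := Wnode c1_bd.
rewrite eq_sym in h1; rewrite eq_sym in h2; rewrite eq_sym in h3; rewrite eq_sym in h4.
have [_ Ka] := reproduction_at_root (W c_bd) (Or32 _ _ erefl) a0 h1 h3.
have [_ Kb] := reproduction_at_root (W c_bd) (Or33 _ _ erefl) b0 h2 h4.
rewrite /= rS in Ea Eb.
apply/node_eq2; rewrite !inE !negb_or h1 h2 h3 h4 g1 g2 g3 g4; split=> //.
- exact: distinct.
- by rewrite a0.
- rewrite -Ea !big_cons big_nil addr0 (addrA (1 / _)) Ka; ring.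
rewrite -Eb !big_cons big_nil addr0 (addrA (1 / _)) Kb; ring.
Qed.

Let leaf_node (lam x u : C) : 0 < x -> x = lam + n (r - 2) + 1 ->
  u = x / (x + 1) * D (r - 2) -> u = a r.-1 \/ u = b r.-1 ->
  node_eq lam [:: u] [:: a (r - 2)%N; b (r - 2)%N].
Proof.
move=> x0 xE uE uab.
have c_bd : (k < r - 2 <= r - 2)%N by nlia.
have e2 : (r - 2).+1 = r.-1 by nlia.
have [[[_ _ h1 h2] _] [[_ _ h3 h4] _]] := Wnode c_bd.
rewrite e2 in h1 h2 h3 h4.
have Wr := W c_bd; rewrite e2 in Wr.
have ua : u != a (r - 2)%N by case: uab => ->; rewrite eq_sym.
have ub : u != b (r - 2)%N by case: uab => ->; rewrite eq_sym.
have d0 : D (r - 2) != 0 by apply: D0.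
have st : step_ratio x (D (r - 2)) u.
  by rewrite uE /step_ratio; field; rewrite gt_eqF // addr_gt0.
have [u0 ud E _] := step_ratio_facts x0 d0 st.
have uu : [\/ u = D (r - 2).-1, u = a r.-1 | u = b r.-1].
  by case: uab => ->; [constructor 2|constructor 3].
have [_ K] := reproduction_at_root Wr uu u0 ua ub.
apply/node_eq1; rewrite !inE negb_or ua ub; split=> //.
by rewrite !big_cons big_nil addr0 K E xE; field.
Qed.

Let chain_last : (0 < k)%N ->
  node_eq (L k) [:: t k] [:: t k.-1; a k.+1; b k.+1].
Proof.
move=> k0; have c_bd : (k < k.+1 <= r - 2)%N by nlia.
have h : (k < k.+1 <= r.-1)%N by nlia.
have kb : (1 <= k <= k)%N by nlia.
have k2 : (1 <= k <= r - 2)%N by nlia.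
have k3 : (k <= r - 2)%N by nlia.
have k4 : (k.-1 <= r - 2)%N by nlia.
have /andP[h1 h2] := off_center h; rewrite /= in h1 h2.
have [_ K] := reproduction_at_root (W c_bd) (Or31 _ _ erefl) (D0 k3) h1 h2.
have p0 := p_weight_gt0 r4 kr L0 Lk kb.
have st := center_step r4 kr L0 Lk k2; rewrite /node_weight leqnn in st.
have [u0 ue E _] := step_ratio_facts p0 (D0 k4) st.
have stq : step_ratio (q k.+1) (D k) (D k.+1).
  rewrite (D_step c_bd) /step_ratio /=; field.
  by rewrite gt_eqF // addr_gt0 // q0.
have [_ _ _ E'] := step_ratio_facts (q0 c_bd) (D0 k3) stq.
rewrite !tE //; last by nlia.
apply/node_eq1; rewrite !inE !negb_or ue h1 h2; split=> //.
by rewrite !big_cons big_nil addr0 K E E' p_weight_base /=; field.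
Qed.

Let chain_node c : (1 <= c < k)%N -> node_eq (L c) [:: t c] [:: t c.-1; t c.+1].
Proof.
move=> c_bd; have h1 : (c.-1 <= r - 2)%N by nlia.
have h2 : (1 <= c <= r - 2)%N by nlia.
have h3 : (1 <= c.+1 <= r - 2)%N by nlia.
have h5 : (1 <= c <= k)%N by nlia.
have h6 : (c <= k)%N by nlia.
have h7 : (c < k)%N by nlia.
have pE := p_weight_rec r L h7.
have s1 := center_step r4 kr L0 Lk h2; rewrite /node_weight h6 pE in s1.
have s2 := center_step r4 kr L0 Lk h3; rewrite /node_weight h7 in s2.
rewrite !tE //; last by nlia.
apply: (chain_interior_node (x := p_weight r k L c.+1)) (D0 h1) s1 s2.
  exact: p_weight_gt0.
by rewrite -pE p_weight_gt0.
Qed.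

Lemma double_roots_system : bethe_system r L double_roots.
Proof.
split=> [|c c_r]; first by rewrite /double_roots /= tE // /center big_geq.
rewrite -/T; have xx := x_weight_gt0 r4 kr L0 Lk; have yy := y_weight_gt0 r4 kr L0 Lk.
have e2 : (k < r - 2 <= r - 2)%N by nlia.
case: (eqVneq c r) => [->|cr].
  rewrite nbrs_leaf ?eqxx // (T_double e2) T_single ?eqxx ?orbT // ty.
  by apply: leaf_node yy _ _ _ => //; right; rewrite br ty.
case: (eqVneq c r.-1) => [->|cr1].
  rewrite nbrs_leaf ?eqxx ?orbT // (T_double e2) T_single ?eqxx ?orbT // tx.
  by apply: leaf_node xx _ _ _ => //; left; rewrite ar tx.
case: (leqP c k) => ck; last first.
  have c_bd : (k < c <= r - 2)%N by nlia.
  rewrite nbrs_dbl // (T_double c_bd).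
  case: (eqVneq c k.+1) => [->|ne].
    by rewrite /= T_single ?leqnn //; apply: double_node_first.
  case: c {c_r cr cr1} ck c_bd ne => // c ck c_bd ne.
  have h : (k < c <= r - 2)%N by nlia.
  by rewrite /= (T_double h); apply: double_node_next; nlia.
have h1 : (c.-1 <= k)%N by nlia.
have h2 : (1 <= c <= r - 3)%N by nlia.
rewrite nbrs_chain // (T_single (c := c)) ?ck // (T_single (c := c.-1)) ?h1 //.
case: (ltnP c k) => ck'.
  by rewrite (T_single (c := c.+1)) ?ck' //; apply: chain_node; nlia.
have -> : c = k by nlia.
by rewrite (T_double (c := k.+1)) ?ltnSn /=; [apply: chain_last|]; nlia.
Qed.

End ExistsDouble.

(** * Classification of the solutions by tuple *)

Lemma tuple_entries (r : nat) (lab : label) (l : seq nat) :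
  (4 <= r)%N -> labelled_tuple r lab l ->
  [\/ exists m, [/\ (m < r)%N, lab = Lab m &
        forall c, (1 <= c <= r)%N -> nth 0%N l c.-1 = (c <= m)%N],
      lab = LabBar /\ forall c, (1 <= c <= r)%N -> nth 0%N l c.-1 = (c != r.-1) |
      exists m, [/\ (m <= r - 2)%N, lab = Lab (2 * r - 2 - m) &
        forall c, (1 <= c <= r)%N ->
          nth 0%N l c.-1 = if (m < c <= r - 2)%N then 2 else 1]].
Proof.
move=> r4 hl.
have nthc (u v : seq nat) i : nth 0%N (u ++ v) i =
    if (i < size u)%N then nth 0%N u i else nth 0%N v (i - size u) by rewrite nth_cat.
case: hl => [m m_r|||m m_r].
- have [e|ne] := eqVneq m r.
    (* The tuple with k_1 = r coincides with that for k_2 = r-2, and both have label r. *)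
    constructor 3; exists (r - 2)%N; split=> [//||c c_r].
      by rewrite e; congr Lab; lia.
    by rewrite e nthc !nth_nseq size_nseq; do ?case: ifP; lia.
  constructor 1; exists m; split=> [|//|c c_r]; first by lia.
  by rewrite nthc !nth_nseq size_nseq; do ?case: ifP; lia.
- constructor 1; exists (r - 1)%N; split=> [|//|c c_r]; first by lia.
  rewrite nthc !nth_nseq size_nseq; case: ifP => h; first by case: leqP; lia.
  have [->|->] : c = r.-1 \/ c = r by lia.
    by rewrite (_ : r.-2 - (r - 2) = 0)%N /=; [case: leqP|]; lia.
  by rewrite (_ : r.-1 - (r - 2) = 1)%N /=; [case: leqP|]; lia.
- constructor 2; split=> // c c_r.
  rewrite nthc !nth_nseq size_nseq; case: ifP => h; first by rewrite ?h; case: eqP => /=; lia.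
  have [->|->] : c = r.-1 \/ c = r by lia.
    by rewrite (_ : r.-2 - (r - 2) = 0)%N /=; [case: eqP => /=|]; lia.
  by rewrite (_ : r.-1 - (r - 2) = 1)%N /=; [case: eqP => /=|]; lia.
constructor 3; exists m; split=> // c c_r; rewrite !nthc !nth_nseq !size_nseq.
case: ifP => h1; first by rewrite ?h1; case: ifP; lia.
case: ifP => h2; first by rewrite ?h2; case: ifP; lia.
have [->|->] : c = r.-1 \/ c = r by lia.
  rewrite (_ : r.-2 - m - (r - 2 - m) = 0)%N /=; last by lia.
  by case: ifP; lia.
rewrite (_ : r.-1 - m - (r - 2 - m) = 1)%N /=; last by lia.
by case: ifP; lia.
Qed.

Section Classification.
Variables (C : numFieldType) (rt : C -> C).
Hypothesis rtE : forall x, rt x ^+ 2 = x.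
Variable r : nat.
Hypothesis r4 : (4 <= r)%N.
Implicit Types (L : nat -> C).

Lemma exists_double L k : (k <= r - 3)%N ->
  (forall c, (1 <= c <= r)%N -> 0 <= L c) -> 0 < L k.+1 ->
  exists2 T, bethe_system r L T & forall c, (1 <= c <= r)%N ->
    size (T c) = if (k < c <= r - 2)%N then 2 else 1.
Proof.
move=> kr L0 Lk; pose M := x_weight r k L + y_weight r k L.
pose D := center r k L; pose Z := pair_weight r k L.
pose s c := D c.-1 * (M + (M + 2) * Z c) / (M + 1); pose p c := D c.-1 ^+ 2 * Z c.
pose t c := if c == r.-1 then x_weight r k L / (x_weight r k L + 1) * D (r - 2)%N
  else if c == r then y_weight r k L / (y_weight r k L + 1) * D (r - 2)%N else D c.
(* The pair is recovered as the roots of x^2 - s x + p; this is the use of square roots. *)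
pose a c := if c == r.-1 then t c else (s c + rt (s c ^+ 2 - 4 * p c)) / 2.
pose b c := if c == r.-1 then t r else (s c - rt (s c ^+ 2 - 4 * p c)) / 2.
exists (double_roots r k t a b); last first.
  move=> c c_r; rewrite /double_roots; case: ifP; case: ifP => //; nlia.
apply: double_roots_system => //.
- by move=> c ck; rewrite /t; do 2?[case: eqP => ?; first by nlia].
- by rewrite /t eqxx.
- by rewrite /t eqxx (_ : r == r.-1 = false) //; nlia.
- move=> c c_bd; rewrite /a /b (_ : c == r.-1 = false); last by nlia.
  split; first by transitivity (s c) => //; field.
  transitivity (p c) => //.
  transitivity ((s c ^+ 2 - rt (s c ^+ 2 - 4 * p c) ^+ 2) / 4); first by field.
  by rewrite rtE; field.
- by rewrite /a eqxx.
by rewrite /b eqxx.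
Qed.

Definition label_condition L lab : Prop :=
  match lab with
  | Lab l => if l == 0%N then True else if (l < r)%N then is_true (0 < L l)
             else if l == r then 0 < L r.-1 /\ 0 < L r
             else 0 < L (2 * r - l - 1)%N
  | LabBar => 0 < L r
  end.

Definition tuple_sizes (T : nat -> seq C) (l : seq nat) : Prop :=
  forall c, (1 <= c <= r)%N -> size (T c) = nth 0%N l c.-1.

Lemma classify L lab l : labelled_tuple r lab l ->
  (forall c, (1 <= c <= r)%N -> 0 <= L c) ->
  (forall T, bethe_system r L T -> tuple_sizes T l ->
     label_condition L lab /\
     forall y, represents_roots r y T -> represents L r lab y) /\
  (label_condition L lab -> exists2 T, bethe_system r L T & tuple_sizes T l).
Proof.
move=> hl L0.
have sz_eq (f : nat -> nat) T : (forall c, (1 <= c <= r)%N -> nth 0%N l c.-1 = f c) ->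
    tuple_sizes T l <-> (forall c, (1 <= c <= r)%N -> size (T c) = f c).
  by move=> E; split=> H c c_r; rewrite H // E.
have [[m [m_r -> E]]|[-> E]|[m [m_r -> E]]] := tuple_entries r4 hl.
- rewrite /= m_r; split=> [T sT /(sz_eq _ _ E) szT|cond].
    have [Lm rep] := solve_path r4 m_r L0 sT szT; split=> //.
    by case: (posnP m) Lm => // m0; apply.
  have [|T sT szT] := exists_path r4 m_r L0; first by move: cond; case: (posnP m).
  by exists T => //; apply/(sz_eq _ _ E).
- split=> [T sT /(sz_eq _ _ E) szT|Lr]; first exact: (solve_bar r4 L0 sT szT).
  have [T sT szT] := exists_bar r4 L0 Lr.
  by exists T => //; apply/(sz_eq _ _ E).
have [e|ne] := eqVneq m (r - 2)%N.
  have E1 c : (1 <= c <= r)%N -> nth 0%N l c.-1 = 1%N.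
    by move=> c_r; rewrite E //; case: ifP; nlia.
  rewrite [(2 * r - 2 - m)%N](_ : _ = r) /=; last by nlia.
  rewrite ltnn eqxx (_ : r == 0%N = false); last by nlia.
  split=> [T sT /(sz_eq _ _ E1) szT|[La Lb]]; first exact: (solve_fork r4 L0 sT szT).
  have [T sT szT] := exists_fork r4 L0 La Lb.
  by exists T => //; apply/(sz_eq _ _ E1).
have m3 : (m <= r - 3)%N by nlia.
rewrite /= (_ : (2 * r - 2 - m == 0)%N = false); last by nlia.
rewrite (_ : (2 * r - 2 - m < r)%N = false); last by nlia.
rewrite (_ : (2 * r - 2 - m == r)%N = false); last by nlia.
rewrite (_ : (2 * r - (2 * r - 2 - m) - 1 = m.+1)%N); last by nlia.
split=> [T sT /(sz_eq _ _ E) szT|Lm]; first exact: (solve_double r4 m3 L0 sT szT).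
have [T sT szT] := exists_double m3 L0 Lm.
by exists T => //; apply/(sz_eq _ _ E).
Qed.

(** In the doubled case the roots a, b are given only through their sum and product, which are
    exactly the coefficients of the quadratic factor. *)
Lemma represents_inj L lab l (y y' : nat -> {poly C}) : labelled_tuple r lab l ->
  represents L r lab y -> represents L r lab y' ->
  forall c, (1 <= c <= r)%N -> y c = y' c.
Proof.
move=> hl; have path m : represents_i L r m y -> represents_i L r m y' ->
    forall c, (1 <= c <= r)%N -> y c = y' c.
  move=> [h1 h2] [h1' h2'] c c_r; case: (leqP c m) => cm.
    by rewrite h1 ?h1' //; nlia.
  by rewrite h2 ?h2' //; nlia.
have ends c : (1 <= c <= r)%N -> [\/ (1 <= c <= r - 2)%N, c = r.-1 | c = r].
  move=> c_r; case: (leqP c (r - 2)) => cr; first by constructor 1; nlia.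
  by case: (eqVneq c r) => ?; [constructor 3|constructor 2]; nlia.
rewrite /represents; case: hl => [m m_r|||m m_r].
- case: ifP => mr; first exact: path.
  rewrite (_ : m == r); last by nlia.
  move=> [h1 h2 h3] [h1' h2' h3'] c /ends[c_r|->|->]; last by rewrite h3 h3'.
    by rewrite h1 ?h1'.
  by rewrite h2 h2'.
- by rewrite (_ : (r - 1 < r)%N); [exact: path|nlia].
- move=> [h1 h2 h3] [h1' h2' h3'] c /ends[c_r|->|->]; last by rewrite h3 h3'.
    by rewrite h1 ?h1'.
  by rewrite h2 h2'.
rewrite (_ : (2 * r - 2 - m < r)%N = false); last by nlia.
case: eqP => mr.
  move=> [h1 h2 h3] [h1' h2' h3'] c /ends[c_r|->|->]; last by rewrite h3 h3'.
    by rewrite h1 ?h1'.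
  by rewrite h2 h2'.
move=> [h1 h2 h3 h4] [h1' h2' h3' h4'] c /ends[c_r|->|->]; last by rewrite h4 h4'.
  case: (leqP c m) => cm; first by rewrite h1 ?h1' //; nlia.
  have c_bd : (2 * r - 1 - (2 * r - 2 - m) <= c <= r - 2)%N by nlia.
  have [a [b [-> pE sE]]] := h2 c c_bd; have [a' [b' [-> pE' sE']]] := h2' c c_bd.
  rewrite -pE' in pE; rewrite -sE' in sE.
  have expand (u v : C) : ('X - u%:P) * ('X - v%:P) =
      'X ^+ 2 - (u + v)%:P * 'X + (u * v)%:P.
    by rewrite rmorphD rmorphM /=; ring.
  by rewrite !expand pE sE.
by rewrite h3 h3'.
Qed.

End Classification.

(** * Unitary modules of so(2r) *)

Local Open Scope sesquilinear_scope.

Section Adjoint.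
Variable C : numClosedFieldType.

Lemma ctrM m n p (A : 'M[C]_(m, n)) (B : 'M[C]_(n, p)) :
  (A *m B)^t* = B^t* *m A^t*.
Proof. by rewrite trmx_mul map_mxM. Qed.

Lemma ctrD m n (A B : 'M[C]_(m, n)) : (A + B)^t* = A^t* + B^t*.
Proof. by rewrite linearD /= map_mxD. Qed.

Lemma ctrB m n (A B : 'M[C]_(m, n)) : (A - B)^t* = A^t* - B^t*.
Proof. by rewrite linearB /= map_mxB. Qed.

Lemma ctrN m n (A : 'M[C]_(m, n)) : (- A)^t* = - A^t*.
Proof. by rewrite linearN /= map_mxN. Qed.

Lemma ctrZ m n a (A : 'M[C]_(m, n)) : (a *: A)^t* = a^* *: A^t*.
Proof. by rewrite linearZ /= map_mxZ. Qed.

Lemma ctr0 m n : (0 : 'M[C]_(m, n))^t* = 0.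
Proof. by rewrite trmx0 map_mx0. Qed.

Lemma ctr1 n : (1%:M : 'M[C]_n)^t* = 1%:M.
Proof. by rewrite trmx1 map_mx1. Qed.

Lemma ctr_sum m n I (s : seq I) (P : pred I) (F : I -> 'M[C]_(m, n)) :
  (\sum_(i <- s | P i) F i)^t* = \sum_(i <- s | P i) (F i)^t*.
Proof. by rewrite linear_sum /= raddf_sum. Qed.

Lemma ctr_tens m n p q (A : 'M[C]_(m, n)) (B : 'M[C]_(p, q)) :
  (A *t B)^t* = A^t* *t B^t*.
Proof. by rewrite trmx_tens map_mxT. Qed.

Lemma ctr_mul_eq0 m n (A : 'M[C]_(m, n)) : A^t* *m A = 0 -> A = 0.
Proof.
move=> /matrixP E; apply/matrixP => i j; have := E j j; rewrite !mxE.
move=> /eqP; rewrite psumr_eq0 => [/allP/(_ i)|k _].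
  by rewrite mem_index_enum !mxE mulrC -normCK sqrf_eq0 normr_eq0 => /(_ isT)/eqP.
by rewrite !mxE mulrC -normCK exprn_ge0.
Qed.

Lemma mulmx_eq_cols m n (A B : 'M[C]_(m, n)) :
  (forall v : 'cV_n, A *m v = B *m v) -> A = B.
Proof.
move=> E; apply/matrixP => i j.
by have /matrixP/(_ i 0) := E (delta_mx j 0); rewrite -!colE !mxE.
Qed.

Lemma unitmx_of_kernel n (A : 'M[C]_n) :
  (forall v : 'cV_n, A *m v = 0 -> v = 0) -> A \in unitmx.
Proof.
move=> inj; rewrite -unitmx_tr -row_free_unit -kermx_eq0.
apply/eqP/row_matrixP => i; rewrite row0.
have /(congr1 trmx) : row i (kermx A^T) *m A^T = 0 by rewrite -row_mul mulmx_ker row0.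
rewrite trmx_mul trmxK trmx0 => /inj /(congr1 trmx).
by rewrite trmxK trmx0.
Qed.

Lemma orthonormal_rows m n (A : 'M[C]_(m, n)) :
  exists S : 'M[C]_(\rank A, n), S *m S^t* = 1%:M /\ (S :=: A)%MS.
Proof.
exists (schmidt (row_base A)); split.
  by apply/unitarymxP/schmidt_unitarymx/rank_leq_col.
apply: eqmx_trans (eq_row_base A).
by apply: eqmx_schmidt_free; apply: row_base_free.
Qed.

Lemma projection_factor n (P : 'M[C]_n) : P^t* = P -> P *m P = P ->
  exists S : 'M[C]_(\rank P, n), S *m S^t* = 1%:M /\ S^t* *m S = P.
Proof.
move=> Pa PP; have [S [SS SP]] := orthonormal_rows P; exists S; split=> //.
have /submxP[E SE] : (S <= P)%MS by rewrite SP.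
have /submxP[F PE] : (P <= S)%MS by rewrite SP.
have SP1 : S *m P = S by rewrite SE -mulmxA PP.
have H : P *m (S^t* *m S) = P.
  by rewrite {1}PE -mulmxA (mulmxA S) SS mul1mx -PE.
have := congr1 (fun M : 'M_n => M^t*) H; rewrite !ctrM trmxCK Pa -mulmxA SP1.
by [].
Qed.

Lemma subspace_projection k (U : {vspace 'cV[C]_k}) :
  exists j (S : 'M[C]_(j, k)), [/\ S *m S^t* = 1%:M,
    forall u, u \in U -> S^t* *m S *m u = u &
    forall w : 'cV_j, S^t* *m w \in U].
Proof.
(* The basis vectors are conjugated so that the adjoint of [S] maps back into U. *)
pose R := \matrix_(i < \dim U) ((tnth (vbasis U) i)^t* : 'rV[C]_k).
have [S [SS SR]] := orthonormal_rows R; exists (\rank R), S; split=> //.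
- move=> u /coord_vbasis ->; set w := \sum_i _.
  have /submxP[E wE] : (w^t* <= S)%MS.
    rewrite SR /w ctr_sum summx_sub // => i _; rewrite ctrZ scalemx_sub //.
    rewrite -(tnth_nth 0) (_ : _^t* = row i R) ?row_sub //.
    by rewrite rowK.
  have -> : w = S^t* *m E^t* by rewrite -ctrM -wE trmxCK.
  by rewrite -mulmxA (mulmxA S) SS mul1mx.
move=> w; have /submxP[E ->] : (S <= R)%MS by rewrite SR.
rewrite ctrM -mulmxA; set x := E^t* *m w.
have -> : R^t* *m x = \sum_i x i 0 *: tnth (vbasis U) i.
  apply/matrixP => a b; rewrite [b]ord1 !mxE summxE; apply: eq_bigr => i _.
  by rewrite !mxE conjCK mulrC.
by apply: memv_suml => i _; apply: memvZ; apply: vbasis_mem; apply: mem_tnth.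
Qed.

Lemma tensmxDl m n p q (A B : 'M[C]_(m, n)) (D : 'M[C]_(p, q)) :
  (A + B) *t D = A *t D + B *t D.
Proof. by apply/matrixP => i j; rewrite !mxE mulrDl. Qed.

Lemma tensmxDr m n p q (A : 'M[C]_(m, n)) (B D : 'M[C]_(p, q)) :
  A *t (B + D) = A *t B + A *t D.
Proof. by apply/matrixP => i j; rewrite !mxE mulrDr. Qed.

Lemma tensmxZl m n p q a (A : 'M[C]_(m, n)) (D : 'M[C]_(p, q)) :
  (a *: A) *t D = a *: (A *t D).
Proof. by apply/matrixP => i j; rewrite !mxE mulrA. Qed.

Lemma tensmxZr m n p q a (A : 'M[C]_(m, n)) (D : 'M[C]_(p, q)) :
  A *t (a *: D) = a *: (A *t D).
Proof. by apply/matrixP => i j; rewrite !mxE mulrCA. Qed.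

Lemma tensmx1 m n : (1%:M : 'M[C]_m) *t (1%:M : 'M[C]_n) = 1%:M.
Proof.
apply/matrixP => i j; case: (mxtens_indexP i) => i1 i2.
case: (mxtens_indexP j) => j1 j2; rewrite tensmxE !mxE.
by rewrite (can_eq (@mxtens_indexK m n)) xpair_eqE -natrM mulnb.
Qed.

Lemma tensmx_col_neq0 m n (v : 'cV[C]_m) (w : 'cV[C]_n) :
  v != 0 -> w != 0 -> (v *t w : 'cV_(m * n)) != 0.
Proof.
move=> /cV0Pn[i vi] /cV0Pn[j wj]; apply/eqP => /matrixP.
move=> /(_ (mxtens_index (i, j)) (@mxtens_index 1 1 (0, 0))).
rewrite (tensmxE v w i j 0 0) mxE => /eqP.
by rewrite mulf_eq0 (negPf vi) (negPf wj).
Qed.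

Lemma tensmx_mul_col m n p q (A : 'M[C]_(m, n)) (B : 'M[C]_(p, q))
  (v : 'cV[C]_n) (w : 'cV[C]_q) :
  (A *t B) *m (v *t w : 'cV_(n * q)) = (A *m v) *t (B *m w) :> 'cV_(m * p).
Proof. exact (tensmx_mul A B v w). Qed.

End Adjoint.

Section Modules.
Variables (C : numClosedFieldType) (r : nat).
Local Notation G := (so_gram C r).
Local Notation gl := 'M[C]_(r + r).

Lemma so_gramK : G *m G = 1%:M.
Proof.
rewrite /so_gram mulmx_block !(mulmx0, mul0mx, mulmx1, addr0, add0r).
by rewrite -scalar_mx_block.
Qed.

Lemma so_gram_conj : map_mx Num.conj G = G.
Proof. by rewrite /so_gram map_block_mx !map_mx0 !map_mx1. Qed.

Lemma so_adj (X : gl) : so X -> so (X^t*).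
Proof.
rewrite /so => H; have := congr1 (fun M => map_mx Num.conj (G *m M *m G)) H.
rewrite mulmxDr mulmxDl !mulmxA so_gramK mul1mx mulmx0 mul0mx map_mx0.
rewrite -!mulmxA so_gramK mulmx1 map_mxD !map_mxM so_gram_conj => <-.
by rewrite addrC -map_trmx trmxK.
Qed.

(** Compatibility with adjoints makes orthogonal complements of submodules into submodules and
    adjoints of equivariant maps equivariant. *)
Definition unitary_module d (rho : gl -> 'M[C]_d) : Prop :=
  so_module rho /\ forall X, so X -> rho (X^t*) = (rho X)^t*.

Lemma tensor_unitary d1 d2 (rho1 : gl -> 'M[C]_d1) (rho2 : gl -> 'M[C]_d2) :
  unitary_module rho1 -> unitary_module rho2 ->
  unitary_module (tensor_module rho1 rho2).
Proof.
move=> [[lin1 lie1] ctr1'] [[lin2 lie2] adj2']; split; first split.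
- move=> a X Y sX sY; rewrite /tensor_module lin1 // lin2 //.
  by rewrite tensmxDl tensmxDr tensmxZl tensmxZr scalerDr addrACA.
- move=> X Y sX sY; rewrite /tensor_module lie1 // lie2 // /lie.
  rewrite !mulmxDl !mulmxDr !tensmx_mul !mulmx1 !mul1mx.
  have tensB (A B : 'M[C]_d1) (D : 'M[C]_d2) : (A - B) *t D = A *t D - B *t D.
    by rewrite -scaleN1r tensmxDl tensmxZl scaleN1r.
  have tensB' (A : 'M[C]_d1) (B D : 'M[C]_d2) : A *t (B - D) = A *t B - A *t D.
    by rewrite -scaleN1r tensmxDr tensmxZr scaleN1r.
  rewrite tensB tensB'.
  apply/matrixP => i j; rewrite !mxE; ring.
move=> X sX; rewrite /tensor_module ctr1' // adj2' //.
by rewrite ctrD !ctr_tens !ctr1.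
Qed.

Lemma tensor_hwv d1 d2 (rho1 : gl -> 'M[C]_d1) (rho2 : gl -> 'M[C]_d2) mu1 mu2 v1 v2 :
  highest_weight_vector rho1 mu1 v1 -> highest_weight_vector rho2 mu2 v2 ->
  highest_weight_vector (tensor_module rho1 rho2) (mu1 + mu2) (v1 *t v2).
Proof.
move=> [n1 e1 w1] [n2 e2 w2]; split; first exact: tensmx_col_neq0.
  move=> i i_r; rewrite /tensor_module mulmxDl !tensmx_mul_col e1 // e2 //.
  by rewrite tens0mx tensmx0 addr0.
move=> x; rewrite /tensor_module mulmxDl !tensmx_mul_col w1 w2 !mul1mx.
by rewrite tensmxZl tensmxZr -scalerDl inv_formDl.
Qed.

Definition subrep d k (rho : gl -> 'M[C]_d) (S : 'M[C]_(k, d)) (X : gl) : 'M[C]_k :=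
  S *m rho X *m S^t*.

(** S gives orthonormal coordinates on a submodule: its adjoint is the inclusion, and the adjoint
    times S is the orthogonal projection. *)
Definition invariant_isometry d k (rho : gl -> 'M[C]_d) (S : 'M[C]_(k, d)) : Prop :=
  S *m S^t* = 1%:M /\
  forall X, so X -> S^t* *m S *m rho X = rho X *m (S^t* *m S).

Section Subrep.
Variables (d : nat) (rho : gl -> 'M[C]_d).
Hypothesis rhoU : unitary_module rho.

Lemma subrep_mul k (S : 'M[C]_(k, d)) X : invariant_isometry rho S -> so X ->
  subrep rho S X *m S = S *m rho X.
Proof.
move=> [SS inv] sX; rewrite /subrep -!mulmxA -inv // !mulmxA SS mul1mx //.
Qed.

Lemma subrep_unitary k (S : 'M[C]_(k, d)) : invariant_isometry rho S ->
  unitary_module (subrep rho S).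
Proof.
move=> invS; have [[lin_rho lie_rho] adj_rho] := rhoU; split; first split.
- move=> a X Y sX sY; rewrite /subrep lin_rho // mulmxDr mulmxDl.
  by rewrite -scalemxAr -scalemxAl.
- move=> X Y sX sY; rewrite {1}/subrep lie_rho // /lie.
  have mulE Z T : so Z -> so T ->
      subrep rho S Z *m subrep rho S T = S *m (rho Z *m rho T) *m S^t*.
    by move=> sZ sT; rewrite {2}/subrep !mulmxA subrep_mul.
  by rewrite !mulE // mulmxBr mulmxBl.
by move=> X sX; rewrite /subrep adj_rho // !ctrM trmxCK mulmxA.
Qed.

Lemma subrep_hwv k (S : 'M[C]_(k, d)) mu v : invariant_isometry rho S ->
  highest_weight_vector rho mu v -> S *m v != 0 ->
  highest_weight_vector (subrep rho S) mu (S *m v).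
Proof.
move=> invS [_ ev wv] Sv; split=> //.
  by move=> i i_r; rewrite mulmxA (subrep_mul invS (so_root_vector _ _ _)) -mulmxA ev // mulmx0.
by move=> x; rewrite mulmxA (subrep_mul invS (so_cartan _)) -mulmxA wv -scalemxAr.
Qed.

(* An orthogonal projection onto an invariant subspace is equivariant because *)
(* rho is stable under adjoints; if the module is reducible, one of the two   *)
(* orthogonal pieces still sees [L v], so induction on the dimension applies. *)
Lemma irreducible_piece_of k (S : 'M[C]_(k, d)) m (L : 'M[C]_(m, d)) (v : 'cV[C]_d) :
  invariant_isometry rho S -> L *m (S^t* *m S) *m v != 0 ->
  exists k' (S' : 'M[C]_(k', d)), [/\ invariant_isometry rho S',
    irreducible_module (subrep rho S') & L *m (S'^t* *m S') *m v != 0].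
Proof.
have [n] := ubnP k; elim: n => // n IH in k S *; rewrite ltnS => kn invS Lv.
have [irr|] := EM (irreducible_module (subrep rho S)); first by exists k, S.
have k0 : (0 < k)%N.
  case: k S Lv {kn invS} => // S Lv; case/eqP: Lv.
  by rewrite (_ : S = 0) ?(mulmx0, mul0mx) //; apply/matrixP => [] [].
move=> nirr.
have [U [stU U0 U1]] : exists U : {vspace 'cV[C]_k},
   [/\ forall X, so X -> forall u, u \in U -> subrep rho S X *m u \in U,
     U <> 0%VS & U <> fullv].
  apply: contrapT => nU; apply: nirr; split=> // U stU.
  have [->|U0] := EM (U = 0%VS); first by left.
  have [->|U1] := EM (U = fullv); first by right.
  by case: nU; exists U.
have [j [T [TT fixU inU]]] := subspace_projection U.
have [Q QE] : exists Q, Q = T^t* *m T by exists (T^t* *m T).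
have Qadj : Q^t* = Q by rewrite QE ctrM trmxCK.
have QQ : Q *m Q = Q by rewrite QE -mulmxA (mulmxA T) TT mul1mx.
rewrite -QE in fixU.
have QU w : Q *m w \in U by rewrite QE -mulmxA inU.
have [_ adjS] := subrep_unitary invS.
have Qcomm X : so X -> Q *m subrep rho S X = subrep rho S X *m Q.
  have half Y : so Y -> Q *m subrep rho S Y *m Q = subrep rho S Y *m Q.
    move=> sY; apply: mulmx_eq_cols => w.
    rewrite -(mulmxA (Q *m _) Q w) -(mulmxA (subrep _ _ _) Q w) -(mulmxA Q).
    by apply: fixU; apply: stU => //; apply: QU.
  move=> sX; have h1 := half X sX; have h2 := half _ (so_adj sX).
  rewrite adjS // in h2; move: (subrep rho S X) h1 h2 => M h1 h2; rewrite -h1.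
  have := congr1 (fun N : 'M_k => N^t*) h2.
  by rewrite !ctrM Qadj trmxCK mulmxA => ->.
have key (P : 'M[C]_k) : P^t* = P -> P *m P = P -> P <> 1%:M ->
    (forall X, so X -> P *m subrep rho S X = subrep rho S X *m P) ->
    L *m (S^t* *m P *m S) *m v != 0 ->
    exists k' (S' : 'M[C]_(k', d)), [/\ invariant_isometry rho S',
    irreducible_module (subrep rho S') & L *m (S'^t* *m S') *m v != 0].
  move=> Pa PP P1 Pc LP; have [S1 [S1S1 S1P]] := projection_factor Pa PP.
  have S1S : (S1 *m S)^t* *m (S1 *m S) = S^t* *m P *m S.
    by rewrite ctrM !mulmxA -(mulmxA _ (S1^t*)) S1P.
  apply: (IH (\rank P) (S1 *m S)); last by rewrite S1S.
    apply: leq_trans kn; rewrite ltn_neqAle rank_leq_row andbT.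
    apply/negP => /eqP rk; apply: P1.
    have Pu : P \in unitmx by rewrite -row_free_unit /row_free rk.
    by rewrite -[P]mulmx1 -(mulmxV Pu) mulmxA PP.
  have [SS inv] := invS; split.
    by rewrite ctrM mulmxA -(mulmxA S1) SS mulmx1.
  move=> X sX; rewrite S1S.
  have e1 := subrep_mul invS sX; have e3 := Pc X sX.
  have e2 := subrep_mul invS (so_adj sX).
  have [_ ar] := rhoU; rewrite adjS // ar // in e2.
  move: (subrep rho S X) e1 e2 e3 => M e1 e2 e3.
  have {}e2 : S^t* *m M = rho X *m S^t*.
    by have := congr1 (fun N : 'M_(k, d) => N^t*) e2; rewrite !ctrM !trmxCK.
  rewrite -(mulmxA _ S (rho X)) -e1 mulmxA -(mulmxA _ P M) e3 (mulmxA (S^t*)) e2.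
  by rewrite -!mulmxA.
have Qn1 : Q <> 1%:M.
  move=> Q1; apply: U1; apply/vspaceP => w; rewrite memvf.
  by rewrite -[w]mul1mx -Q1 QU.
have Pn1 : 1%:M - Q <> 1%:M.
  move=> Q1; apply: U0; apply/vspaceP => w; rewrite memv0.
  have Q0 : Q = 0 by apply: oppr_inj; apply: (addrI 1%:M); rewrite Q1 oppr0 addr0.
  apply/idP/eqP => [wU|->]; last exact: mem0v.
  by rewrite -(fixU _ wU) Q0 mul0mx.
have [LQ|LQ] := EM (L *m (S^t* *m Q *m S) *m v = 0); last first.
  by apply: (key Q) => //; apply/eqP.
apply: (key (1%:M - Q)) => //.
- by rewrite ctrB ctr1 Qadj.
- by rewrite mulmxBl mul1mx mulmxBr mulmx1 QQ subrr subr0.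
- by move=> X sX; rewrite mulmxBl mulmxBr mul1mx mulmx1 Qcomm.
by rewrite mulmxBr mulmxBl mulmx1 mulmxBr mulmxBl LQ subr0.
Qed.

(** The projection of a highest weight vector to a piece is zero or again a highest weight vector.
    The map L selects a piece in which the component of v is nonzero and is still seen by L. *)
Lemma irreducible_piece m (L : 'M[C]_(m, d)) mu (v : 'cV[C]_d) :
  highest_weight_vector rho mu v -> L *m v != 0 ->
  exists k (S : 'M[C]_(k, d)), [/\ invariant_isometry rho S,
    irreducible_of_highest_weight mu (subrep rho S) &
    L *m S^t* *m (S *m v) != 0].
Proof.
move=> hv Lv; have [||k [S [invS irr LS]]] := @irreducible_piece_of d 1%:M m L v.
- by split; [rewrite ctr1 mulmx1|move=> X _; rewrite ctr1 !mulmx1 mul1mx].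
- by rewrite ctr1 !mulmx1.
rewrite -!mulmxA !mulmxA in LS; exists k, S; split=> //; last by rewrite mulmxA.
split=> //; first exact: (subrep_unitary invS).1.
exists (S *m v); apply: subrep_hwv => //.
by apply: contraNneq LS => Sv; rewrite -mulmxA Sv mulmx0.
Qed.

End Subrep.
End Modules.

(** * Equivariant maps into tensor products with the vector module *)

Section VectorOps.
Variables (C : numClosedFieldType) (r : nat).
Local Notation G := (so_gram C r).
Local Notation gl := 'M[C]_(r + r).

(* The family g encodes the map v |-> \sum_b (g b *m v) (x) e_b from A to the *)
(* tensor product of B with the vector module; the condition says that it is  *)
(* so(2r)-equivariant.                                                        *)
Definition vector_ops dA dB (rhoA : gl -> 'M[C]_dA) (rhoB : gl -> 'M[C]_dB)
    (g : 'I_(r + r) -> 'M[C]_(dB, dA)) : Prop :=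
  forall X, so X -> forall b,
    rhoB X *m g b - g b *m rhoA X = - \sum_c X b c *: g c.

Definition dual_index (b : 'I_(r + r)) : 'I_(r + r) :=
  match split b with inl i => rshift r i | inr i => lshift r i end.

Lemma dual_indexK : involutive dual_index.
Proof.
move=> b; rewrite /dual_index -{2}[b]splitK; case: (split b) => i /=.
  by rewrite (unsplitK (inr i)).
by rewrite (unsplitK (inl i)).
Qed.

Lemma dual_index_eq b c : (dual_index b == dual_index c) = (b == c).
Proof. exact: inj_eq (inv_inj dual_indexK) b c. Qed.

Lemma dual_lshift i : dual_index (lshift r i) = rshift r i.
Proof. by rewrite /dual_index (unsplitK (inl i)). Qed.

Lemma dual_rshift i : dual_index (rshift r i) = lshift r i.
Proof. by rewrite /dual_index (unsplitK (inr i)). Qed.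

Lemma so_gramE b c : G b c = (c == dual_index b)%:R.
Proof.
rewrite /so_gram -[b]splitK -[c]splitK; case: (split b) => i; case: (split c) => j /=;
  rewrite ?dual_lshift ?dual_rshift.
- by rewrite block_mxEul mxE eq_lrshift.
- by rewrite block_mxEur mxE (inj_eq (@rshift_inj _ _)) eq_sym.
- by rewrite block_mxEdl mxE (inj_eq (@lshift_inj _ _)) eq_sym.
by rewrite block_mxEdr mxE eq_rlshift.
Qed.

Lemma so_dual (X : gl) b c : so X -> X (dual_index b) c = - X (dual_index c) b.
Proof.
move=> /matrixP/(_ b c); rewrite !mxE => /eqP; rewrite addrC addr_eq0 => /eqP E.
have -> : X (dual_index b) c = \sum_j G b j * X j c.
  rewrite (bigD1 (dual_index b)) //= so_gramE eqxx mul1r big1 ?addr0 // => j nj.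
  by rewrite so_gramE (negPf nj) mul0r.
rewrite E; congr (- _); rewrite (bigD1 (dual_index c)) //= so_gramE.
rewrite dual_indexK eqxx mulr1 mxE big1 ?addr0 // => j nj.
rewrite so_gramE (_ : (c == _) = false) ?mulr0 //.
by apply/negP => /eqP e; case/eqP: nj; rewrite e dual_indexK.
Qed.

(** The vector module is self-dual through the invariant form, which pairs e_b with its dual basis
    vector; a map from A to B (x) V therefore yields one from B to A (x) V. *)
Lemma vector_ops_adjoint dA dB (rhoA : gl -> 'M[C]_dA) (rhoB : gl -> 'M[C]_dB) g :
  unitary_module rhoA -> unitary_module rhoB -> vector_ops rhoA rhoB g ->
  vector_ops rhoB rhoA (fun b => (g (dual_index b))^t*).
Proof.
move=> [_ uA] [_ uB] gP X sX b.
have := congr1 (fun M : 'M_(dB, dA) => M^t*) (gP _ (so_adj sX) (dual_index b)).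
rewrite ctrB !ctrM uA // uB // !trmxCK ctrN ctr_sum => E.
rewrite -[LHS]opprB E opprK (reindex_inj (inv_inj dual_indexK)) /=.
rewrite -sumrN; apply: eq_bigr => c _.
by rewrite ctrZ !mxE conjCK so_dual // dual_indexK scaleNr.
Qed.

Definition ops_map dA dB (g : 'I_(r + r) -> 'M[C]_(dB, dA)) :
    'M[C]_(dB * (r + r), dA) :=
  \matrix_(i, j) g (mxtens_unindex i).2 (mxtens_unindex i).1 j.

Lemma ops_mapE dA dB (g : 'I_(r + r) -> 'M[C]_(dB, dA)) p b j :
  ops_map g (mxtens_index (p, b)) j = g b p j.
Proof. by rewrite mxE mxtens_indexK. Qed.

Lemma ops_map_equivariant dA dB (rhoA : gl -> 'M[C]_dA) (rhoB : gl -> 'M[C]_dB) g X :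
  vector_ops rhoA rhoB g -> so X ->
  tensor_module rhoB id X *m ops_map g = ops_map g *m rhoA X.
Proof.
move=> gP sX; apply/matrixP => i j; case: (mxtens_indexP i) => p b.
have sum_tens m n (F : 'I_(m * n) -> C) :
    \sum_k F k = \sum_p \sum_b F (mxtens_index (p, b)).
  rewrite pair_bigA /= (reindex (@mxtens_index m n)) /=; last first.
    by exists (@mxtens_unindex m n) => x _; rewrite ?mxtens_indexK ?mxtens_unindexK.
  by apply: eq_bigr => -[].
rewrite [RHS]mxE; under [RHS]eq_bigr => k _ do rewrite ops_mapE.
have -> : \sum_k g b p k * rhoA X k j = (g b *m rhoA X) p j by rewrite mxE.
have -> : g b *m rhoA X = rhoB X *m g b + \sum_c X b c *: g c.
  by rewrite -[X in _ + X]opprK -gP // opprB addrC subrK.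
rewrite [LHS]mxE sum_tens mxE [X in _ = X + _]mxE summxE.
under eq_bigr => p' _ do under eq_bigr => b' _ do
  rewrite /tensor_module mxE !tensmxE ops_mapE mulrDl !mxE.
under eq_bigr => p' _ do rewrite big_split /=.
rewrite big_split /=; congr (_ + _).
  apply: eq_bigr => p' _; rewrite (bigD1 b) //= eqxx mulr1 big1 ?addr0 // => b' nb.
  by rewrite eq_sym (negPf nb) mulr0 mul0r.
rewrite (bigD1 p) //= eqxx [X in _ + X]big1 ?addr0; last first.
  move=> p' np; rewrite big1 // => b' _.
  by rewrite eq_sym (negPf np) !mul0r.
by apply: eq_bigr => b' _; rewrite mul1r mxE.
Qed.

Lemma id_unitary : unitary_module (id : gl -> gl).
Proof. by []. Qed.

(** The equivariant map phi is injective by irreducibility, so its adjoint times phi is invertible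
    and commutes with the action; composing the inverse with the adjoint of phi gives an equivariant
    retraction. *)
Lemma summand_of_ops dA dB (rhoA : gl -> 'M[C]_dA) (rhoB : gl -> 'M[C]_dB) g b :
  unitary_module rhoA -> irreducible_module rhoA -> unitary_module rhoB ->
  vector_ops rhoA rhoB g -> g b != 0 ->
  summand rhoA (tensor_module rhoB id).
Proof.
move=> uA [_ irrA] uB gP gb0; set phi := ops_map g.
have [_ uM] := tensor_unitary uB id_unitary.
have eq1 X : so X -> tensor_module rhoB id X *m phi = phi *m rhoA X.
  exact: ops_map_equivariant.
have phi0 : phi != 0.
  apply: contraNneq gb0 => z; apply/eqP/matrixP => p j.
  by rewrite -ops_mapE -/phi z !mxE.
have eq2 X : so X -> phi^t* *m tensor_module rhoB id X = rhoA X *m phi^t*.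
  move=> sX; have := congr1 (fun M : 'M_(_, dA) => M^t*) (eq1 _ (so_adj sX)).
  by rewrite !ctrM uM // (proj2 uA) // !trmxCK.
have ker (v : 'cV_dA) : phi *m v = 0 -> v = 0.
  pose U := lker (linfun (mulmx phi : 'cV_dA -> 'cV__)).
  have mU w : (w \in U) = (phi *m w == 0) by rewrite memv_ker lfunE.
  case: (irrA U) => [X sX w|U0|U1].
  - by rewrite !mU mulmxA -eq1 // -mulmxA => /eqP ->; rewrite mulmx0.
  - by move=> pv; apply/eqP; rewrite -memv0 -U0 mU pv.
  case/eqP: phi0; apply: mulmx_eq_cols => w; rewrite mul0mx; apply/eqP.
  by rewrite -mU U1 memvf.
have Su : phi^t* *m phi \in unitmx.
  apply: unitmx_of_kernel => v Sv; apply: ker; apply: ctr_mul_eq0.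
  by rewrite ctrM -mulmxA (mulmxA _ phi) Sv mulmx0.
exists phi, (invmx (phi^t* *m phi) *m phi^t*); split.
- by rewrite -mulmxA mulVmx.
- by move=> X sX; rewrite eq1.
move=> X sX; rewrite -mulmxA eq2 // mulmxA [RHS]mulmxA; congr (_ *m _).
have c : phi^t* *m phi *m rhoA X = rhoA X *m (phi^t* *m phi).
  by rewrite -mulmxA -eq1 // (mulmxA (phi^t*)) eq2 // mulmxA.
by apply: (canRL (mulmxK Su)); rewrite -mulmxA -c mulKmx.
Qed.

End VectorOps.

(** * The vector module *)

Section Natural.
Variables (C : numClosedFieldType) (r : nat).
Hypothesis r4 : (4 <= r)%N.
Local Notation gl := 'M[C]_(r + r).
Local Notation dual := (@dual_index r).

Lemma dual_index_neq (b : 'I_(r + r)) : dual b != b.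
Proof.
rewrite -[b]splitK; case: (split b) => i /=.
  by rewrite dual_lshift eq_rlshift.
by rewrite dual_rshift eq_lrshift.
Qed.

Definition so_unit (a b : 'I_(r + r)) : gl :=
  delta_mx a b - delta_mx (dual b) (dual a).

Lemma so_of_dual (X : gl) :
  (forall b c, X (dual b) c = - X (dual c) b) -> so X.
Proof.
move=> E; apply/matrixP => b c; rewrite !mxE.
rewrite (bigD1 (dual c)) //= so_gramE dual_indexK eqxx mulr1 mxE.
rewrite [X in _ + X + _]big1 ?addr0; last first.
  move=> j nj; rewrite so_gramE (_ : (c == _) = false) ?mulr0 //.
  by apply/negP => /eqP e; case/eqP: nj; rewrite e dual_indexK.
rewrite (bigD1 (dual b)) //= so_gramE eqxx mul1r big1 ?addr0 => [|j nj].
  by rewrite (E b c) subrr.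
by rewrite so_gramE (negPf nj) mul0r.
Qed.

Lemma so_so_unit a b : so (so_unit a b).
Proof.
apply: so_of_dual => c d; rewrite !mxE.
have dE x y : (dual x == y) = (x == dual y).
  by apply/eqP/eqP => [<-|->]; rewrite dual_indexK.
by rewrite !dE !dual_indexK opprB [(d == b) && _]andbC [(c == b) && _]andbC.
Qed.

Lemma so_unit_mul a b (u : 'cV[C]_(r + r)) :
  so_unit a b *m u = u b 0 *: delta_mx a 0 - u (dual a) 0 *: delta_mx (dual b) 0.
Proof.
have dm i j : delta_mx i j *m u = u j 0 *: delta_mx i 0.
  apply/matrixP => k z; rewrite [z]ord1 !mxE (bigD1 j) //= !mxE eqxx andbT.
  rewrite big1 => [|m nm]; first by rewrite addr0 mulrC; case: (k == i).
  by rewrite !mxE (negPf nm) andbF mul0r.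
by rewrite /so_unit mulmxBl !dm.
Qed.

(** A vector with nonzero coordinate b yields e_a for every a other than b and its dual. Each e_a
    yields every e_c except the one dual to it, so two different choices of a give the whole
    basis. *)
Lemma natural_irreducible : irreducible_module (id : gl -> gl).
Proof.
split=> [|U stU]; first by lia.
have st a b u : u \in U -> so_unit a b *m u \in U by apply/stU/so_so_unit.
have [/eqP U0|U0] := boolP (U == 0%VS); [by left|right].
have e_off b u a : u \in U -> u b 0 != 0 -> a != b -> a != dual b ->
    (delta_mx a 0 : 'cV_(r + r)) \in U.
  move=> uU ub ab ab'; have := st a a _ (st a b u uU).
  rewrite [X in X \in U]so_unit_mul so_unit_mul !mxE.
  rewrite !eqxx (negPf ab') dual_index_eq (negPf ab).
  rewrite (negPf (dual_index_neq a)) !(mulr0, mulr1, subr0, scale0r) => H.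
  by have := memvZ (u b 0)^-1 H; rewrite scalerA mulVf // scale1r.
have e_all a c : (delta_mx a 0 : 'cV_(r + r)) \in U -> c != dual a ->
    (delta_mx c 0 : 'cV_(r + r)) \in U.
  move=> aU ca; have := st c a _ aU; rewrite so_unit_mul !mxE !eqxx.
  rewrite (_ : (dual c == a) = false) ?(scale0r, scale1r, subr0) //.
  by apply: contraNF ca => /eqP <-; rewrite dual_indexK.
have /cV0Pn[b ub] : vpick U != 0 by rewrite vpick0.
have [a [a2 [ab a2b aa2]]] : exists a a2, [/\ a \in ~: [set b; dual b],
    a2 \in ~: [set b; dual b] & a != a2].
  apply/card_gt1P; rewrite cardsCs setCK card_ord cards2.
  by case: (_ != _) => /=; lia.
rewrite !inE !negb_or in ab a2b; have [[ab1 ab2] [ab3 ab4]] := (andP ab, andP a2b).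
have aU := e_off _ _ _ (memv_pick U) ub ab1 ab2.
have a2U := e_off _ _ _ (memv_pick U) ub ab3 ab4.
have eU c : (delta_mx c 0 : 'cV_(r + r)) \in U.
  have [e|] := eqVneq c (dual a); last exact: e_all.
  by apply: e_all a2U _; rewrite e dual_index_eq.
apply/vspaceP => w; rewrite memvf; rewrite [w]matrix_sum_delta.
by apply: memv_suml => c _; rewrite big_ord1; apply/memvZ/eU.
Qed.

Lemma root_vector_col i j (b : 'I_(r + r)) : (1 <= i < r)%N ->
  root_vector C r i b (lshift r j) = ((b.+1 == i) && (j == i :> nat))%:R.
Proof.
move=> i_r; rewrite /root_vector (_ : i == r = false); last by lia.
rewrite -[b]splitK; case: (split b) => a /=.
  by rewrite block_mxEul mxE eqSS.
by rewrite block_mxEdl mxE (_ : _ == i = false) //; lia.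
Qed.

Lemma root_vector_last_col j (b : 'I_(r + r)) : root_vector C r r b (lshift r j) = 0.
Proof.
rewrite /root_vector eqxx -[b]splitK; case: (split b) => a /=.
  by rewrite block_mxEul mxE.
by rewrite block_mxEdl mxE.
Qed.

Lemma cartan_col (x : 'rV[C]_r) j (b : 'I_(r + r)) :
  cartan x b (lshift r j) = x 0 j *+ (b == lshift r j).
Proof.
rewrite /cartan -[b]splitK; case: (split b) => a /=.
  rewrite block_mxEul mxE (inj_eq (@lshift_inj _ _)).
  by case: eqP => [->|]; rewrite ?mulr1n ?mulr0n.
by rewrite block_mxEdl mxE eq_rlshift.
Qed.

Lemma inv_form_epsE (x : 'rV[C]_r) (j : 'I_r) : inv_form (eps C r j.+1) x = x 0 j.
Proof.
rewrite /inv_form (bigD1 j) //= mxE eqxx mul1r big1 ?addr0 // => i ni.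
by rewrite mxE eqSS (_ : (i == j :> nat) = false) ?mul0r //; apply/negbTE.
Qed.

Lemma natural_hwv : exists v, highest_weight_vector (id : gl -> gl) (omega1 C r) v.
Proof.
have r0 : (0 < r)%N by lia.
pose j0 := Ordinal r0; exists (delta_mx (lshift r j0) 0); split.
- apply/cV0Pn; exists (lshift r j0); by rewrite mxE !eqxx oner_eq0.
- move=> i i_r; rewrite -colE; apply/matrixP => b z; rewrite [LHS]mxE [RHS]mxE.
  have [->|ne] := eqVneq i r; first by rewrite root_vector_last_col.
  rewrite root_vector_col; last by lia.
  by rewrite [(j0 == i :> nat)](_ : _ = false) ?andbF //=; lia.
move=> x; rewrite -colE (inv_form_epsE x j0); apply/matrixP => b z.
by rewrite [LHS]mxE cartan_col !mxE [z]ord1 eqxx andbT mulr_natr.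
Qed.

End Natural.

(** The Jordan-Wigner construction: on the product of C^2 with the space for n modes, the new
    annihilator acts on C^2, and the old ones are twisted by the sign Z, which anticommutes with
    it. *)
Lemma car_exists (C : numClosedFieldType) n :
  exists d (c : nat -> 'M[C]_d) (Om : 'cV[C]_d), [/\
    forall i j, (i < n)%N -> (j < n)%N -> c i *m c j + c j *m c i = 0,
    forall i j, (i < n)%N -> (j < n)%N ->
      c i *m (c j)^t* + (c j)^t* *m c i = (i == j)%:R%:M,
    Om != 0 & forall i, (i < n)%N -> c i *m Om = 0].
Proof.
elim: n => [|n [d [c [Om [cc cd On Oc]]]]].
  exists 1%N, (fun _ => 0), 1%:M; split=> //; exact: oner_neq0.
pose a : 'M[C]_2 := delta_mx 0 1; pose a' : 'M[C]_2 := delta_mx 1 0.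
pose Z : 'M[C]_2 := delta_mx 0 0 - delta_mx 1 1.
have aa' : a^t* = a' by rewrite /a trmx_delta map_delta_mx.
have ZH : Z^t* = Z by rewrite /Z ctrB !trmx_delta !map_delta_mx.
have ZZ : Z *m Z = 1%:M.
  apply/matrixP => i j; rewrite !mxE !big_ord_recl big_ord0 !mxE.
  by case: i => [[|[|[]]] ?] //; case: j => [[|[|[]]] ?] //=; ring.
have Za : Z *m a + a *m Z = 0.
  apply/matrixP => i j; rewrite !mxE !big_ord_recl !big_ord0 !mxE.
  by case: i => [[|[|[]]] ?] //; case: j => [[|[|[]]] ?] //=; ring.
have Za' : Z *m a' + a' *m Z = 0.
  apply/matrixP => i j; rewrite !mxE !big_ord_recl !big_ord0 !mxE.
  by case: i => [[|[|[]]] ?] //; case: j => [[|[|[]]] ?] //=; ring.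
have a2 : a *m a = 0 by rewrite /a mul_delta_mx_0.
have aa1 : a *m a' + a' *m a = 1%:M.
  apply/matrixP => i j; rewrite !mxE !big_ord_recl !big_ord0 !mxE.
  by case: i => [[|[|[]]] ?] //; case: j => [[|[|[]]] ?] //=; ring.
pose e0 : 'cV[C]_2 := delta_mx 0 0.
have ae0 : a *m e0 = 0 by rewrite /a /e0 mul_delta_mx_0.
pose c' i : 'M[C]_(2 * d) := if i == n then a *t 1%:M else Z *t c i.
have cE i : (i < n)%N -> c' i = Z *t c i by rewrite /c' => /ltn_eqF ->.
have cn : c' n = a *t 1%:M by rewrite /c' eqxx.
have z m : (false%:R : C)%:M = 0 :> 'M_m by rewrite -scalemx1 scale0r.
have ends i : (i < n.+1)%N -> (i < n)%N \/ i = n by lia.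
exists (2 * d)%N, c', (e0 *t Om); split.
- move=> i j /ends[i_n|->] /ends[j_n|->]; rewrite ?cn ?cE // !tensmx_mul.
  + by rewrite ZZ -tensmxDr cc // tensmx0.
  + by rewrite mulmx1 mul1mx -tensmxDl Za tens0mx.
  + by rewrite mulmx1 mul1mx -tensmxDl addrC Za tens0mx.
  by rewrite a2 tens0mx addr0.
- move=> i j /ends[i_n|->] /ends[j_n|->]; rewrite ?cn ?cE // ctr_tens ?ctr1 ?ZH ?aa' !tensmx_mul.
  + rewrite ZZ -tensmxDr cd //; case: (i == j); first by rewrite tensmx1.
    by rewrite !z tensmx0.
  + rewrite mulmx1 mul1mx -tensmxDl Za' tens0mx (ltn_eqF i_n).
    by rewrite z.
  + by rewrite mulmx1 mul1mx -tensmxDl addrC Za tens0mx (gtn_eqF j_n) z.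
  by rewrite !mulmx1 -tensmxDl aa1 tensmx1 eqxx.
- apply: tensmx_col_neq0 => //; apply/cV0Pn; exists 0; by rewrite mxE !eqxx oner_eq0.
move=> i /ends[i_n|->]; rewrite ?cn ?cE // tensmx_mul_col.
  by rewrite Oc // tensmx0.
by rewrite ae0 tens0mx.
Qed.

(** * Exterior and spin modules *)

Section Quadratic.
Variables (C : numClosedFieldType) (r : nat).
Local Notation gl := 'M[C]_(r + r).
Variables (d : nat) (s : C) (p : 'I_(r + r) -> 'M[C]_d).
Hypothesis s_real : s^* = s.

(** With s = 1 and creation operators p this is the action on the exterior algebra of the vector
    module; with s = 1/2 and Clifford generators p it is the spin representation. *)
Definition quadratic_rep (X : gl) : 'M[C]_d :=
  s *: \sum_a \sum_b X a b *: (p a *m (p b)^t*).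
Local Notation rho := quadratic_rep.

Hypothesis p_vec : forall X, so X -> forall b,
  rho X *m p b - p b *m rho X = \sum_a X a b *: p a.

Lemma quadratic_adj X : rho (X^t*) = (rho X)^t*.
Proof.
rewrite /quadratic_rep ctrZ s_real ctr_sum exchange_big /=; congr (_ *: _).
apply: eq_bigr => a _; rewrite ctr_sum; apply: eq_bigr => b _.
by rewrite ctrZ ctrM trmxCK !mxE.
Qed.

Lemma quadratic_vector_ops : vector_ops rho rho (fun b => (p b)^t*).
Proof.
move=> X sX b; have := congr1 (fun M : 'M_d => M^t*) (p_vec (so_adj sX) b).
rewrite ctrB !ctrM -quadratic_adj trmxCK ctr_sum => E.
rewrite -[LHS]opprB E; congr (- _); apply: eq_bigr => a _.
by rewrite ctrZ !mxE conjCK.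
Qed.

(** By [p_vec] and its adjoint, the commutator with rho X acts as a derivation on the products p_a
    p_b^*, so bracketing with rho Y replaces the matrix Y by XY - YX. *)
Lemma quadratic_unitary : unitary_module rho.
Proof.
split; last by move=> X _; apply: quadratic_adj.
split=> [a X Y _ _|X Y sX sY].
  rewrite /quadratic_rep scalerA mulrC -scalerA -scalerDr; congr (_ *: _).
  rewrite scaler_sumr -big_split; apply: eq_bigr => b _.
  rewrite scaler_sumr -big_split; apply: eq_bigr => c _.
  by rewrite !mxE scalerDl scalerA.
have comm a b : lie (rho X) (p a *m (p b)^t*) =
    \sum_c X c a *: (p c *m (p b)^t*) - \sum_c X b c *: (p a *m (p c)^t*).
  have -> : lie (rho X) (p a *m (p b)^t*) =
      (rho X *m p a - p a *m rho X) *m (p b)^t*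
      + p a *m (rho X *m (p b)^t* - (p b)^t* *m rho X).
    by rewrite mulmxBl mulmxBr /lie !mulmxA addrA subrK.
  rewrite p_vec // quadratic_vector_ops // mulmxN mulmx_suml mulmx_sumr.
  by congr (_ - _); apply: eq_bigr => c _; rewrite -?scalemxAl -?scalemxAr.
have lieE : lie (rho X) (rho Y) =
    s *: \sum_a \sum_b Y a b *: lie (rho X) (p a *m (p b)^t*).
  rewrite /lie; move: (rho X) => RX; rewrite /quadratic_rep -scalemxAr -scalemxAl -scalerBr; congr (_ *: _).
  rewrite mulmx_sumr mulmx_suml -sumrB; apply: eq_bigr => a _.
  rewrite mulmx_sumr mulmx_suml -sumrB; apply: eq_bigr => b _.
  by rewrite -scalemxAr -scalemxAl scalerBr.
rewrite lieE {1}/quadratic_rep; congr (_ *: _).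
under [RHS]eq_bigr => a _ do under eq_bigr => b _ do rewrite comm scalerBr.
under [RHS]eq_bigr => a _ do rewrite sumrB.
rewrite sumrB.
under eq_bigr => a _ do under eq_bigr => b _ do rewrite !mxE scalerBl.
under eq_bigr => a _ do rewrite sumrB.
rewrite sumrB; congr (_ - _).
  under [RHS]eq_bigr => a _ do under eq_bigr => b _ do rewrite scaler_sumr.
  under [LHS]eq_bigr => a _ do under eq_bigr => b _ do rewrite scaler_suml.
  under [RHS]eq_bigr => a _ do rewrite exchange_big /=.
  rewrite [RHS]exchange_big /=; apply: eq_bigr => a _.
  rewrite exchange_big /=; apply: eq_bigr => c _; apply: eq_bigr => b _.
  by rewrite scalerA mulrC.
under [RHS]eq_bigr => a _ do under eq_bigr => b _ do rewrite scaler_sumr.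
under [LHS]eq_bigr => a _ do under eq_bigr => b _ do rewrite scaler_suml.
apply: eq_bigr => a _; rewrite [RHS]exchange_big /=; apply: eq_bigr => b _.
by apply: eq_bigr => c _; rewrite scalerA.
Qed.

End Quadratic.

Section Fock.
Variables (C : numClosedFieldType) (r : nat).
Hypothesis r4 : (4 <= r)%N.
Local Notation gl := 'M[C]_(r + r).
Variables (d : nat) (rho : gl -> 'M[C]_d) (p : 'I_(r + r) -> 'M[C]_d).
Variables (Om : 'cV[C]_d) (w0 : 'rV[C]_r).
Let P k : 'M[C]_d := if insub k is Some i then p (lshift r i) else 0.

Hypothesis p_vec : forall X, so X -> forall b,
  rho X *m p b - p b *m rho X = \sum_a X a b *: p a.
Hypothesis pp : forall i j,
  p (lshift r i) *m p (lshift r j) + p (lshift r j) *m p (lshift r i) = 0.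
Hypothesis gp : forall i j,
  (p (lshift r i))^t* *m p (lshift r j) + p (lshift r j) *m (p (lshift r i))^t*
  = (i == j)%:R%:M.
Hypothesis gO : forall i, (p (lshift r i))^t* *m Om = 0.
Hypothesis O0 : Om != 0.
Hypothesis rootO : forall i, (1 <= i < r)%N -> rho (root_vector C r i) *m Om = 0.
Hypothesis cartanO : forall x, rho (cartan x) *m Om = inv_form w0 x *: Om.

(** The vector e_1 wedge ... wedge e_k, up to sign, built on the vacuum [Om]; [P] extends p to all
    natural numbers so that the recursion needs no bounds. *)
Fixpoint fock_vector k : 'cV[C]_d :=
  if k is k'.+1 then P k' *m fock_vector k' else Om.

Definition fock_weight k : 'rV[C]_r := w0 + \row_j (j < k)%:R.

Let P_ord (i : 'I_r) : P i = p (lshift r i).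
Proof. by rewrite /P valK. Qed.

Let PP (i j : 'I_r) : P i *m P j = - (P j *m P i).
Proof. by apply/eqP; rewrite !P_ord -addr_eq0 pp. Qed.

Lemma fock_kill i k : (i < k <= r)%N -> P i *m fock_vector k = 0.
Proof.
elim: k => [|k IH]; first by lia.
move=> i_k /=; rewrite mulmxA; have [kr ir] : (k < r /\ i < r)%N by lia.
pose I := Ordinal ir; pose K := Ordinal kr.
have [e|ne] := eqVneq i k.
  have : P K *m P K = 0.
    apply/eqP; have := PP K K => /eqP; rewrite -addr_eq0 -mulr2n -scaler_nat.
    by rewrite scaler_eq0 pnatr_eq0.
  by rewrite e /= => ->; rewrite mul0mx.
by rewrite (PP I K) mulNmx -mulmxA IH ?mulmx0 ?oppr0 //; lia.
Qed.

Lemma fock_kill_ord (i : 'I_r) k : (i < k <= r)%N ->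
  p (lshift r i) *m fock_vector k = 0.
Proof. by rewrite -P_ord; apply: fock_kill. Qed.

Lemma fock_annihilate_out (i : 'I_r) k : (k <= i)%N ->
  (p (lshift r i))^t* *m fock_vector k = 0.
Proof.
elim: k => [|k IH] ki; first exact: gO.
have kr : (k < r)%N by apply: ltn_trans ki _.
pose K := Ordinal kr; have iK : (i == K) = false.
  by apply/negbTE; rewrite -val_eqE /= gtn_eqF.
have := gp i K; rewrite iK -scalemx1 scale0r => /eqP.
rewrite addr_eq0 => /eqP E; rewrite /= (P_ord K) mulmxA E mulNmx -mulmxA.
by rewrite IH ?mulmx0 ?oppr0 // ltnW.
Qed.

Lemma fock_annihilate (k : 'I_r) :
  (p (lshift r k))^t* *m fock_vector k.+1 = fock_vector k.
Proof.
have := gp k k; rewrite eqxx => /(congr1 (fun M => M *m fock_vector k)).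
rewrite mulmxDl mul1mx -!mulmxA fock_annihilate_out // mulmx0 addr0.
by rewrite /= P_ord.
Qed.

Lemma fock_vector_neq0 k : (k <= r)%N -> fock_vector k != 0.
Proof.
elim: k => // k IH kr; apply: contraNneq (IH (ltnW kr)) => z.
by rewrite -(fock_annihilate (Ordinal kr)) z mulmx0.
Qed.

Lemma fock_commute X (k : 'I_r) (v : 'cV[C]_d) : so X ->
  rho X *m (P k *m v) = P k *m (rho X *m v) + \sum_a X a (lshift r k) *: (p a *m v).
Proof.
move=> sX; rewrite P_ord !mulmxA -[X in X *m v](subrK (p (lshift r k) *m rho X)).
rewrite p_vec // mulmxDl addrC mulmx_suml; congr (_ + _).
by apply: eq_bigr => a _; rewrite scalemxAl.
Qed.

(** The root vector sends e_(i+1) to e_i, which is already a factor of the product when e_(i+1) is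
    added. *)
Lemma fock_root i k : (1 <= i < r)%N -> (k <= r)%N ->
  rho (root_vector C r i) *m fock_vector k = 0.
Proof.
move=> i_r; elim: k => [|k IH] kr; first exact: rootO.
rewrite /= (fock_commute (Ordinal kr)); last exact: so_root_vector.
rewrite IH ?(ltnW kr) // mulmx0 add0r.
under eq_bigr => a _ do rewrite root_vector_col //=.
have [ki|ki] := eqVneq k i; last first.
  by rewrite big1 // => a _; rewrite andbF scale0r.
have i1r : (i.-1 < r)%N by lia.
rewrite (bigD1 (lshift r (Ordinal i1r))) //= big1 ?addr0 => [|a na].
  rewrite -P_ord /= -ki fock_kill ?scaler0 //; lia.
rewrite andbT (_ : a.+1 == i = false) ?scale0r //.
by apply: contraNF na => /eqP e; apply/eqP/val_inj => /=; lia.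
Qed.

Lemma fock_weightS (k : 'I_r) : fock_weight k.+1 = fock_weight k + eps C r k.+1.
Proof.
rewrite /fock_weight -addrA; congr (_ + _); apply/rowP => j; rewrite !mxE eqSS ltnS.
by case: ltngtP; rewrite ?addr0 ?add0r.
Qed.

Lemma fock_cartan x k : (k <= r)%N ->
  rho (cartan x) *m fock_vector k = inv_form (fock_weight k) x *: fock_vector k.
Proof.
elim: k => [|k IH] kr.
  rewrite /= cartanO; congr (inv_form _ _ *: _).
  by apply/rowP => j; rewrite !mxE addr0.
rewrite (fock_weightS (Ordinal kr)) inv_formDl (inv_form_epsE x (Ordinal kr)) scalerDl.
rewrite [LHS]/= (fock_commute (Ordinal kr)); last exact: so_cartan.
rewrite (IH (ltnW kr)) -scalemxAr; congr (_ + _).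
rewrite (bigD1 (lshift r (Ordinal kr))) //= big1 ?addr0 => [|a na].
  by rewrite cartan_col eqxx mulr1n -(P_ord (Ordinal kr)).
by rewrite cartan_col (negPf na) mulr0n scale0r.
Qed.

Lemma fock_hwv k : (k <= r)%N -> rho (root_vector C r r) *m fock_vector k = 0 ->
  highest_weight_vector rho (fock_weight k) (fock_vector k).
Proof.
move=> kr last_root; split; first exact: fock_vector_neq0.
  by move=> i i_r; case: (eqVneq i r) => [->//|ne]; apply: fock_root => //; lia.
by move=> x; apply: fock_cartan.
Qed.

End Fock.

Section FundamentalModules.
Variables (C : numClosedFieldType) (r : nat).
Hypothesis r4 : (4 <= r)%N.
Local Notation gl := 'M[C]_(r + r).

(* A unitary module F with highest weight vectors v of weight kappa and w of  *)
(* weight kappa + eps k such that v is a component of the image of w in the   *)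
(* tensor product of F with the vector module.                                *)
Definition step_module (kappa : 'rV[C]_r) (k : nat) : Prop :=
  exists d (rho : gl -> 'M[C]_d) g b v w, [/\ unitary_module rho,
    vector_ops rho rho g, highest_weight_vector rho kappa v,
    highest_weight_vector rho (kappa + eps C r k) w & g b *m w = v].

(** In the exterior algebra of the vector module, contraction takes e_1 wedge ... wedge e_(k+1) to
    e_1 wedge ... wedge e_k up to sign. *)
Lemma exterior_step k : (k < r)%N -> step_module (\row_j (j < k)%:R) k.+1.
Proof.
move=> kr; have [d [c [Om [cc cd O0 cO]]]] := car_exists C (r + r).
pose p (a : 'I_(r + r)) := (c a)^t*.
have pt a : (p a)^t* = c a by rewrite /p trmxCK.
have ppE a b : p a *m p b + p b *m p a = 0.
  by rewrite /p -!ctrM -ctrD addrC cc ?ctr0.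
have rhoE X : quadratic_rep 1 p X = \sum_a \sum_b X a b *: (p a *m c b).
  rewrite /quadratic_rep scale1r.
  by apply: eq_bigr => a _; apply: eq_bigr => b _; rewrite pt.
have p_vec X : so X -> forall b,
    quadratic_rep 1 p X *m p b - p b *m quadratic_rep 1 p X = \sum_a X a b *: p a.
  move=> _ b; rewrite rhoE mulmx_suml mulmx_sumr -sumrB; apply: eq_bigr => a _.
  rewrite mulmx_suml mulmx_sumr -sumrB (bigD1 b) //= big1 ?addr0 => [|e ne].
    rewrite -scalemxAl -scalemxAr -scalerBr; congr (_ *: _).
    rewrite mulmxA -(mulmxA (p a)) (_ : c b *m p b = 1%:M - p b *m c b); last first.
      by apply/eqP; rewrite eq_sym subr_eq eq_sym addrC addrC /p cd ?eqxx.
    rewrite mulmxBr mulmx1 !mulmxA -addrA -opprD -mulmxDl ppE mul0mx oppr0 addr0 //.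
  rewrite -scalemxAl -scalemxAr -scalerBr.
  rewrite mulmxA -(mulmxA (p a)) (_ : c e *m p b = - (p b *m c e)); last first.
    apply/eqP; rewrite -addr_eq0 /p cd // (_ : (e == b :> nat) = false) //.
      by rewrite -scalemx1 scale0r.
    exact/negbTE.
  rewrite mulmxN !mulmxA -opprD -mulmxDl ppE mul0mx oppr0 scaler0 //.
have one_real : (1 : C)^* = 1 by rewrite conjC1.
have rhoO X : quadratic_rep 1 p X *m Om = 0.
  rewrite rhoE mulmx_suml big1 // => a _; rewrite mulmx_suml big1 // => b _.
  by rewrite -scalemxAl -mulmxA cO // mulmx0 scaler0.
have hw m : (m <= r)%N ->
    highest_weight_vector (quadratic_rep 1 p) (fock_weight 0 m) (fock_vector p Om m).
  move=> mr; apply: fock_hwv => //.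
  - by move=> i j; rewrite pt cd // -val_eqE.
  - by move=> i; rewrite pt cO.
  - by move=> x; rewrite rhoO inv_formC /inv_form big1 ?scale0r // => j _; rewrite mxE mulr0.
  elim: m mr => [|m IH] mr; first exact: rhoO.
  rewrite [fock_vector _ _ _]/= (@fock_commute _ _ _ _ _ p_vec _ (Ordinal mr)); last exact: so_root_vector.
  rewrite IH ?(ltnW mr) // mulmx0 add0r big1 // => a _.
  by rewrite root_vector_last_col // scale0r.
exists d, (quadratic_rep 1 p), (fun b => (p b)^t*), (lshift r (Ordinal kr)).
exists (fock_vector p Om k), (fock_vector p Om k.+1).
have wE m : fock_weight (0 : 'rV[C]_r) m = \row_j (j < m)%:R.
  by rewrite /fock_weight add0r.
split.
- exact: quadratic_unitary.
- exact: quadratic_vector_ops.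
- by rewrite -wE; apply: hw; apply: ltnW.
- by rewrite -wE -(fock_weightS 0 (Ordinal kr)); apply: hw.
apply: (@fock_annihilate _ _ _ _ _ _ _ (Ordinal kr)) => //.
- by move=> i j; rewrite pt cd // -val_eqE.
by move=> i; rewrite pt cO.
Qed.

Definition spin_weight k : 'rV[C]_r := \row_j ((j < k)%:R - 2^-1).

(** With only r modes, the generators of one isotropic half create and those of the other
    annihilate. The vectors with r-1 and r occupied modes are highest weight vectors of the two
    half-spin modules, and the last annihilator links them. *)
Lemma spin_module : exists d (rho : gl -> 'M[C]_d) g b v w, [/\ unitary_module rho,
    vector_ops rho rho g, highest_weight_vector rho (spin_weight r.-1) v,
    highest_weight_vector rho (spin_weight r) w & g b *m w = v].
Proof.
have [d [c [Om [cc cd O0 cO]]]] := car_exists C r.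
pose p (a : 'I_(r + r)) : 'M[C]_d :=
  match split a with inl i => (c i)^t* | inr i => c i end.
have pl i : p (lshift r i) = (c i)^t* by rewrite /p (unsplitK (inl i)).
have pr i : p (rshift r i) = c i by rewrite /p (unsplitK (inr i)).
have pt a : (p a)^t* = p (dual_index a).
  rewrite -[a]splitK; case: (split a) => i /=.
    by rewrite dual_lshift pl pr trmxCK.
  by rewrite dual_rshift pl pr.
have z m : (false%:R : C)%:M = 0 :> 'M_m by rewrite -scalemx1 scale0r.
have ppE a b : p a *m p b + p b *m p a = (b == dual_index a)%:R%:M.
  rewrite -[a]splitK -[b]splitK; case: (split a) => i; case: (split b) => j /=;
    rewrite ?dual_lshift ?dual_rshift ?pl ?pr.
  - by rewrite eq_lrshift z -!ctrM -ctrD addrC cc // ctr0.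
  - by rewrite (inj_eq (@rshift_inj _ _)) addrC cd // -val_eqE.
  - by rewrite (inj_eq (@lshift_inj _ _)) cd // -val_eqE eq_sym.
  by rewrite eq_rlshift z cc.
have half_real : (2^-1 : C)^* = 2^-1 by rewrite fmorphV rmorph_nat.
pose rho := quadratic_rep 2^-1 p.
have rhoE X : rho X = 2^-1 *: \sum_a \sum_b X a b *: (p a *m p (dual_index b)).
  rewrite /rho /quadratic_rep; congr (_ *: _).
  by apply: eq_bigr => a _; apply: eq_bigr => b _; rewrite pt.
have p_vec X : so X -> forall b,
    rho X *m p b - p b *m rho X = \sum_a X a b *: p a.
  move=> sX e; rewrite rhoE -scalemxAl -scalemxAr -scalerBr.
  have -> : (\sum_a \sum_b X a b *: (p a *m p (dual_index b))) *m p e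
      - p e *m (\sum_a \sum_b X a b *: (p a *m p (dual_index b))) =
    \sum_a \sum_b X a b *: ((e == b)%:R *: p a)
    - \sum_a \sum_b X a b *: ((a == dual_index e)%:R *: p (dual_index b)).
    rewrite mulmx_suml mulmx_sumr -!sumrB; apply: eq_bigr => a _.
    rewrite mulmx_suml mulmx_sumr -!sumrB; apply: eq_bigr => b _.
    rewrite -scalemxAl -scalemxAr -!scalerBr; congr (_ *: _).
    have -> : p a *m p (dual_index b) *m p e - p e *m (p a *m p (dual_index b)) =
        p a *m (p (dual_index b) *m p e + p e *m p (dual_index b))
        - (p e *m p a + p a *m p e) *m p (dual_index b).
      by rewrite mulmxDr mulmxDl !mulmxA opprD addrACA subrr addr0.
    by rewrite !ppE dual_indexK mul_mx_scalar mul_scalar_mx.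
  have -> : \sum_a \sum_b X a b *: ((e == b)%:R *: p a) = \sum_a X a e *: p a.
    apply: eq_bigr => a _; rewrite (bigD1 e) //= eqxx scale1r big1 ?addr0 // => b nb.
    by rewrite eq_sym (negPf nb) scale0r scaler0.
  have -> : \sum_a \sum_b X a b *: ((a == dual_index e)%:R *: p (dual_index b)) =
      - \sum_a X a e *: p a.
    rewrite (bigD1 (dual_index e)) //= eqxx [X in _ + X]big1 ?addr0; last first.
      by move=> a na; rewrite big1 // => b _; rewrite (negPf na) scale0r scaler0.
    rewrite (reindex_inj (inv_inj (@dual_indexK r))) /= -sumrN; apply: eq_bigr => a _.
    by rewrite scale1r dual_indexK so_dual // dual_indexK scaleNr.
  (* The antisymmetry of X makes the two halves of the commutator equal, which the factor 1/2
     compensates. *)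
  rewrite opprK -mulr2n -scaler_nat scalerA mulVf ?scale1r // pnatr_eq0 //.
pose w0 : 'rV[C]_r := \row_j (- 2^-1).
have kill_l a j : p a *m p (dual_index (lshift r j)) *m Om = 0.
  by rewrite dual_lshift pr -mulmxA cO // mulmx0.
have rhoO (X : gl) : (forall i j, X (lshift r i) (rshift r j) = 0) ->
    rho X *m Om = (2^-1 * \sum_i X (rshift r i) (rshift r i)) *: Om.
  move=> X0; rewrite rhoE -scalemxAl -[RHS]scalerA; congr (_ *: _).
  rewrite mulmx_suml big_split_ord /= [X in X + _]big1 ?add0r => [|i _]; last first.
    rewrite mulmx_suml big_split_ord /= !big1 ?addr0 // => j _.
      by rewrite X0 scale0r mul0mx.
    by rewrite -scalemxAl kill_l scaler0.
  rewrite scaler_suml; apply: eq_bigr => i _.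
  rewrite mulmx_suml big_split_ord /= [X in X + _]big1 ?add0r => [|j _]; last first.
    by rewrite -scalemxAl kill_l scaler0.
  have cjO (j : 'I_r) : c i *m ((c j)^t* *m Om) = (i == j)%:R *: Om.
    have := cd i j (ltn_ord i) (ltn_ord j) => /(congr1 (fun M => M *m Om)).
    by rewrite mulmxDl -!mulmxA cO // mulmx0 addr0 mul_scalar_mx.
  rewrite (bigD1 i) //= big1 ?addr0 => [|j nj]; rewrite -scalemxAl dual_rshift pl pr -mulmxA cjO.
    by rewrite eqxx scale1r.
  by rewrite eq_sym (negPf nj) scale0r scaler0.
have fw k : fock_weight w0 k = spin_weight k.
  by apply/rowP => j; rewrite !mxE addrC.
(* The last root vector creates in modes r-1 and r together, and mode r-1 (index r-2) is already
   occupied. *)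
have lastE m : (r.-1 <= m <= r)%N ->
    rho (root_vector C r r) *m fock_vector p Om m = 0.
  move=> m_r; have pkill (i : 'I_r) : (i : nat) = (r - 2)%N ->
      p (lshift r i) *m fock_vector p Om m = 0.
    move=> ir; apply: fock_kill_ord => //; last by lia.
    by move=> i' j'; rewrite ppE dual_lshift eq_lrshift z.
  rewrite rhoE -scalemxAl mulmx_suml big1 ?scaler0 // => a _.
  rewrite mulmx_suml big1 // => b _; rewrite -scalemxAl.
  rewrite /root_vector eqxx -[a]splitK -[b]splitK.
  case: (split a) => i; case: (split b) => j /=.
  - by rewrite block_mxEul mxE scale0r.
  - rewrite block_mxEur dual_rshift !mxE.
    have [jr|jr] := eqVneq (j : nat) (r - 2)%N.
      by rewrite -mulmxA pkill // mulmx0 scaler0.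
    have [ir|ir] := eqVneq (i : nat) (r - 2)%N.
      have /eqP := ppE (lshift r i) (lshift r j).
      rewrite dual_lshift eq_lrshift z addr_eq0 => /eqP ->.
      by rewrite mulNmx -mulmxA pkill // mulmx0 oppr0 scaler0.
    rewrite [(i.+1 == _)](_ : _ = false); last by lia.
    by rewrite [(j.+1 == r.-1)](_ : _ = false) ?andbF ?subrr ?scale0r //; lia.
  - by rewrite block_mxEdl mxE scale0r.
  by rewrite block_mxEdr mxE scale0r.
have hw m : (r.-1 <= m <= r)%N ->
    highest_weight_vector rho (fock_weight w0 m) (fock_vector p Om m).
  move=> rm; have /andP[_ mr] := rm; apply: fock_hwv => //.
  - by move=> i j; rewrite ppE dual_lshift eq_lrshift z.
  - by move=> i j; rewrite pt dual_lshift ppE dual_rshift (inj_eq (@lshift_inj _ _)) eq_sym.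
  - by move=> i; rewrite pl trmxCK cO.
  - move=> i i_r; rewrite rhoO => [|a b]; rewrite /root_vector (_ : i == r = false); try lia.
      rewrite big1 ?mulr0 ?scale0r // => a _; rewrite block_mxEdr !mxE.
      rewrite (_ : (a.+1 == i.+1) && (a.+1 == i) = false) ?oppr0 //; lia.
    by rewrite block_mxEur mxE.
  - move=> x; rewrite rhoO => [|a b]; last by rewrite /cartan block_mxEur mxE.
    congr (_ *: _); rewrite /inv_form mulr_sumr; apply: eq_bigr => i _.
    by rewrite /cartan block_mxEdr !mxE eqxx mulr1n mulrN mulNr.
  exact: lastE.
have r1 : (r.-1 < r)%N by lia.
exists d, rho, (fun b => (p b)^t*), (lshift r (Ordinal r1)).
exists (fock_vector p Om r.-1), (fock_vector p Om r).
have e : r.-1.+1 = r by lia.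
split.
- exact: quadratic_unitary.
- exact: quadratic_vector_ops.
- by rewrite -fw; apply: hw; lia.
- by rewrite -fw; apply: hw; lia.
have -> : fock_vector p Om r = fock_vector p Om r.-1.+1 by rewrite e.
apply: (@fock_annihilate _ _ _ _ _ _ _ (Ordinal r1)).
- by move=> i j; rewrite pt dual_lshift ppE dual_rshift (inj_eq (@lshift_inj _ _)) eq_sym.
by move=> i; rewrite pl trmxCK cO.
Qed.

End FundamentalModules.

(** * Modules with prescribed dominant highest weights *)

Section Weights.
Variables (C : numClosedFieldType) (r : nat).
Hypothesis r4 : (4 <= r)%N.
Local Notation gl := 'M[C]_(r + r).
Implicit Types lam mu nu kappa : 'rV[C]_r.

Definition coord mu k : C := inv_form mu (eps C r k).

Lemma coord_row (f : nat -> C) k : (1 <= k <= r)%N -> coord (\row_j f j) k = f k.-1.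
Proof.
case: k => // k k_r; rewrite /coord inv_formC (inv_form_epsE _ (Ordinal k_r)).
by rewrite mxE.
Qed.

Lemma dynkin_coord mu i : (1 <= i <= r)%N ->
  dynkin mu i = if i == r then coord mu r.-1 + coord mu r
                else coord mu i - coord mu i.+1.
Proof.
move=> i_r; rewrite dynkinE // /alpha; case: eqP => _.
  by rewrite inv_formDr.
by rewrite inv_formDr inv_formNr.
Qed.

Lemma coord_eps k i : (1 <= k <= r)%N -> coord (eps C r k) i = (k == i)%:R.
Proof. exact: inv_form_eps. Qed.

Lemma dynkinD mu nu i : (1 <= i <= r)%N ->
  dynkin (mu + nu) i = dynkin mu i + dynkin nu i.
Proof. by move=> i_r; rewrite !dynkinE // inv_formDl. Qed.

Lemma dynkinB mu nu i : (1 <= i <= r)%N ->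
  dynkin (mu - nu) i = dynkin mu i - dynkin nu i.
Proof. by move=> i_r; rewrite !dynkinE // inv_formDl inv_formNl. Qed.

Lemma dynkin_eps k i : (1 <= k <= r)%N -> (1 <= i <= r)%N ->
  dynkin (eps C r k) i =
  if i == r then (k == r.-1)%:R + (k == r)%:R else (k == i)%:R - (k == i.+1)%:R.
Proof. by move=> k_r i_r; rewrite dynkin_coord // !coord_eps. Qed.

Lemma dynkin_row_ones k i : (1 <= k <= r - 2)%N -> (1 <= i <= r)%N ->
  dynkin (\row_(j < r) (j < k)%:R : 'rV[C]_r) i = (i == k)%:R.
Proof.
move=> k_r i_r; have cE := @coord_row (fun j => (j < k)%:R).
rewrite dynkin_coord //; case: eqP => [->|ne].
  rewrite !cE; try lia.
  have a1 : (r.-2 < k)%N = false by lia.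
  have a2 : (r.-1 < k)%N = false by lia.
  have a3 : (r == k) = false by lia.
  by rewrite a1 a2 a3 addr0.
rewrite !cE; try lia.
have a1 : (i.-1 < k)%N = (i <= k)%N by lia.
by rewrite a1; case: (ltngtP i k); rewrite ?subrr ?subr0.
Qed.

Lemma dynkin_spin_weight k i : (r.-1 <= k <= r)%N -> (1 <= i <= r)%N ->
  dynkin (spin_weight C r k) i = (i == k)%:R.
Proof.
move=> k_r i_r; have cE := @coord_row (fun j => (j < k)%:R - 2^-1).
rewrite dynkin_coord //; case: eqP => [->|ne].
  rewrite !cE; try lia.
  have a1 : (r.-2 < k)%N by lia.
  have a2 : (r.-1 < k)%N = (r == k) by lia.
  by rewrite a1 a2; case: (r == k) => /=; field.
rewrite !cE; try lia.
have a1 : (i.-1 < k)%N by lia.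
have a2 : (i <= k)%N by lia.
rewrite a1 opprB addrA subrK; case: (ltngtP i k) a2 => //= _ _; rewrite ?subrr ?subr0 //.
Qed.

Lemma dynkin_eq0 mu : (forall i, (1 <= i <= r)%N -> dynkin mu i = 0) -> mu = 0.
Proof.
move=> H; have cr : coord mu r = 0.
  have h1 := H r ltac:(lia); have h2 := H r.-1 ltac:(lia).
  rewrite dynkin_coord ?eqxx in h1; last by lia.
  have e1 : (r.-1 == r) = false by lia.
  have e2 : r.-1.+1 = r by lia.
  rewrite dynkin_coord ?e1 ?e2 in h2; last by lia.
  have : coord mu r + coord mu r = 0.
    by rewrite -h1 -[X in X + _]add0r -h2; ring.
  by move/eqP; rewrite -mulr2n mulrn_eq0 => /eqP.
have c0 j : (j < r)%N -> coord mu (r - j) = 0.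
  elim: j => [|j IH] jr; first by rewrite subn0.
  have := H (r - j.+1)%N ltac:(lia); rewrite dynkin_coord; last by lia.
  rewrite (_ : _ == r = false); last by lia.
  rewrite (_ : (r - j.+1).+1 = r - j)%N; last by lia.
  by rewrite IH ?subr0 //; lia.
apply/rowP => j; rewrite mxE -inv_form_epsE inv_formC -/(coord mu j.+1).
have := c0 (r - j.+1)%N; rewrite (_ : r - (r - j.+1) = j.+1)%N; last by have := ltn_ord j; lia.
by apply; have := ltn_ord j; lia.
Qed.

Definition has_module mu : Prop :=
  exists d (rho : gl -> 'M[C]_d) v, unitary_module rho /\ highest_weight_vector rho mu v.

Lemma has_moduleD mu nu : has_module mu -> has_module nu -> has_module (mu + nu).
Proof.
move=> [d1 [rho1 [v1 [u1 h1]]]] [d2 [rho2 [v2 [u2 h2]]]].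
exists (d1 * d2)%N, (tensor_module rho1 rho2), (v1 *t v2); split.
  exact: tensor_unitary.
exact: tensor_hwv.
Qed.

Lemma has_module0 : has_module 0.
Proof.
exists 1%N, (fun _ => 0), 1%:M; split.
  split; first by split=> *; rewrite ?scaler0 ?addr0 // /lie mulmx0 subrr.
  by move=> *; rewrite ctr0.
split; [exact: oner_neq0|by move=> *; rewrite mul0mx|move=> x].
rewrite mul0mx (_ : inv_form 0 x = 0) ?scale0r //.
by rewrite /inv_form big1 // => j _; rewrite mxE mul0r.
Qed.

Lemma has_fundamental_module i : (1 <= i <= r)%N ->
  exists omega, has_module omega /\
    forall j, (1 <= j <= r)%N -> dynkin omega j = (j == i)%:R.
Proof.
move=> i_r; have [ir|ir] := leqP i (r - 2).
  exists (\row_(j < r) (j < i)%:R); split; last first.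
    by move=> j j_r; apply: dynkin_row_ones => //; lia.
  have [|d [rho [g [b [v [w [u _ h _ _]]]]]]] := @exterior_step C r r4 i; first by lia.
  by exists d, rho, v.
have [d [rho [g [b [v [w [u _ h1 h2 _]]]]]]] := spin_module C r4.
exists (spin_weight C r i); split; last first.
  by move=> j j_r; apply: dynkin_spin_weight => //; lia.
have [->|->] : i = r.-1 \/ i = r by lia.
  by exists d, rho, v.
by exists d, rho, w.
Qed.

(** Induction on the sum of the labels, splitting off one fundamental weight at a time: tensor
    products add highest weights, and no irreducibility is asked for at this stage. *)
Lemma dominant_has_module mu : dominant_integral mu -> has_module mu.
Proof.
move=> dom; have [m mE] : exists m : nat -> nat,
    forall i, (1 <= i <= r)%N -> dynkin mu i = (m i)%:R.
  have /choice[m mE] : forall i, exists k : nat, (1 <= i <= r)%N -> dynkin mu i = k%:R.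
    move=> i; have [i_r|ni] := boolP (1 <= i <= r)%N; last by exists 0%N.
    by have [k kE] := dom i i_r; exists k.
  by exists m.
have [N] := ubnP (\sum_(1 <= i < r.+1) m i); elim: N => // N IH in mu m mE {dom} *.
move=> mN; have [/hasP hm|] := boolP (has (fun i => 0 < m i)%N (index_iota 1 r.+1)).
  case: hm => i; rewrite mem_index_iota => i_r mi.
  have [om [hom omE]] := has_fundamental_module i_r.
  rewrite -[mu](subrK om) addrC; apply: has_moduleD => //.
  apply: (IH _ (fun j => (m j - (j == i))%N)) => [j j_r|].
    rewrite dynkinB // mE // omE // natrB //.
    by case: eqP => // ->.
  have iin : i \in index_iota 1 r.+1 by rewrite mem_index_iota.
  rewrite ltnS in mN; apply: leq_trans mN; rewrite (bigD1_seq i) ?iota_uniq //=.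
  rewrite [X in (_ <= X)%N](bigD1_seq i) ?iota_uniq //= eqxx.
  rewrite (eq_bigr m) => [|j /negPf ->]; last by rewrite subn0.
  by rewrite -addSn leq_add2r; lia.
rewrite -all_predC => /allP m0; rewrite (_ : mu = 0); first exact: has_module0.
apply: dynkin_eq0 => i i_r; rewrite mE //.
by have := m0 i; rewrite mem_index_iota i_r => /(_ isT) /=; rewrite -eqn0Ngt => /eqP ->.
Qed.

Lemma subrep_mulr d k (rho : gl -> 'M[C]_d) (S : 'M[C]_(k, d)) X :
  invariant_isometry rho S -> so X -> S^t* *m subrep rho S X = rho X *m S^t*.
Proof.
move=> [SS inv] sX; rewrite /subrep !mulmxA inv // -!mulmxA SS mulmx1 //.
Qed.

(** Tensoring a module of highest weight mu - kappa with the step module gives highest weight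
    vectors z (x) v and z (x) w, the second mapped to the first by 1 (x) g_b. A piece [SB] seeing z
    (x) v is chosen first, then a piece [SA] detected by the map into [SB], so the compressed map is
    nonzero. *)
Lemma linked_modules_of kappa mu k : step_module kappa k -> has_module (mu - kappa) ->
  exists dA (rhoA : gl -> 'M[C]_dA) dB (rhoB : gl -> 'M[C]_dB) g b,
  [/\ unitary_module rhoA /\ irreducible_of_highest_weight (mu + eps C r k) rhoA,
      unitary_module rhoB /\ irreducible_of_highest_weight mu rhoB,
      vector_ops rhoA rhoB g & g b != 0].
Proof.
move=> [d [rho [g [b [v [w [u gP hv hw gw]]]]]]] [d' [rho' [z [u' hz]]]].
pose M := tensor_module rho' rho; have uM := tensor_unitary u' u.
pose H c : 'M[C]_(d' * d) := 1%:M *t g c.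
have HP : vector_ops M M H.
  move=> X sX c; rewrite /M /tensor_module /H mulmxDl mulmxDr !tensmx_mul !mul1mx !mulmx1.
  rewrite opprD addrACA subrr add0r.
  have tB (A B : 'M[C]_d) : (1%:M : 'M[C]_d') *t A - 1%:M *t B = 1%:M *t (A - B).
    by apply/matrixP => i j; rewrite !mxE mulrBr.
  rewrite tB gP // -scaleN1r tensmxZr scaleN1r; congr (- _).
  elim/big_ind2: _ => [|A A' B B' <- <-|e _]; rewrite ?tensmx0 ?tensmxDr ?tensmxZr //.
have hvM := tensor_hwv hz hv; rewrite subrK in hvM.
have hwM := tensor_hwv hz hw; rewrite addrA subrK in hwM.
have HE : H b *m (z *t w : 'cV_(d' * d)) = (z *t v : 'cV_(d' * d)).
  by rewrite /H tensmx_mul_col mul1mx gw.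
have [vM0 _ _] := hvM.
have [|kB [SB [invB irrB SBv]]] := @irreducible_piece _ _ _ _ uM _ 1%:M _ _ hvM.
  by rewrite mul1mx.
rewrite mul1mx in SBv.
have SBv0 : SB *m (z *t v : 'cV_(d' * d)) != 0.
  by apply: contraNneq SBv => ->; rewrite mulmx0.
have [|kA [SA [invA irrA SAw]]] := @irreducible_piece _ _ _ _ uM _ (SB *m H b) _ _ hwM.
  by rewrite -mulmxA HE.
exists kA, (subrep M SA), kB, (subrep M SB), (fun c => SB *m H c *m SA^t*), b.
split.
- by split=> //; apply: subrep_unitary.
- by split=> //; apply: subrep_unitary.
- move=> X sX c.
  have -> : subrep M SB X *m (SB *m H c *m SA^t*) = SB *m (M X *m H c) *m SA^t*.
    by rewrite (mulmxA _ (SB *m _)) (mulmxA _ SB) subrep_mul // -(mulmxA SB).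
  have -> : SB *m H c *m SA^t* *m subrep M SA X = SB *m (H c *m M X) *m SA^t*.
    by rewrite -(mulmxA (SB *m H c)) subrep_mulr // mulmxA -(mulmxA SB).
  rewrite -mulmxBl -mulmxBr HP // mulmxN mulNmx.
  rewrite mulmx_sumr mulmx_suml; congr (- _); apply: eq_bigr => e _.
  by rewrite -scalemxAr -scalemxAl.
by apply: contraNneq SAw => ->; rewrite mul0mx.
Qed.

(** Here kappa is the fundamental weight omega_(k-1), or 0 for k = 1, realized in the exterior
    algebra for k < r and in the spin module for k = r. A positive label k-1 of mu is what makes mu
    - kappa dominant. *)
Lemma linked_modules mu k : dominant_integral mu -> (1 <= k <= r)%N ->
  ((2 <= k)%N -> dynkin mu k.-1 != 0) ->
  exists dA (rhoA : gl -> 'M[C]_dA) dB (rhoB : gl -> 'M[C]_dB) g b,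
  [/\ unitary_module rhoA /\ irreducible_of_highest_weight (mu + eps C r k) rhoA,
      unitary_module rhoB /\ irreducible_of_highest_weight mu rhoB,
      vector_ops rhoA rhoB g & g b != 0].
Proof.
move=> dom k_r mk.
have [kappa [kap kapE]] : exists kappa, step_module kappa k /\
   forall i, (1 <= i <= r)%N -> dynkin kappa i = ((i == k.-1) && (1 < k)%N)%:R.
  have [kr|kr] := ltnP k r; last first.
    have -> : k = r by lia.
    exists (spin_weight C r r.-1); split; last first.
      move=> i i_r; rewrite dynkin_spin_weight ?leqnn ?leq_pred //.
      by rewrite (_ : (1 < r)%N) ?andbT //; lia.
    have [d [rho [g [b [v [w [u gP hv hw gw]]]]]]] := spin_module C r4.
    exists d, rho, g, b, v, w; split=> //.
    suff -> : spin_weight C r r.-1 + eps C r r = spin_weight C r r by [].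
    apply/rowP => j; rewrite !mxE addrAC -natrD; congr (_%:R - _).
    by have := ltn_ord j; case: eqP; case: ltnP; case: ltnP => /=; lia.
  have kS : k = k.-1.+1 by lia.
  exists (\row_(j < r) (j < k.-1)%:R); split.
    by rewrite {2}kS; apply: exterior_step => //; lia.
  move=> i i_r; have [k1|k1] := ltnP 1 k.
    by rewrite andbT dynkin_row_ones //; lia.
  rewrite andbF (_ : k.-1 = 0)%N; last by lia.
  rewrite (_ : \row_j _ = 0) ?dynkinE //; last by apply/rowP => j; rewrite !mxE.
  by rewrite /inv_form big1 // => j _; rewrite mxE mul0r.
apply: linked_modules_of kap _; apply: dominant_has_module => i i_r.
have [m mE] := dom i i_r; rewrite dynkinB // kapE // mE.
have [/andP[/eqP ik k1]|_] := boolP ((i == k.-1) && (1 < k)%N); last first.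
  by exists m; rewrite subr0.
have := mk k1; rewrite -ik mE pnatr_eq0 -lt0n => m0.
by exists m.-1; rewrite -natrB // subn1.
Qed.

End Weights.

(** * Admissibility *)

Section Sl2.
Variables (C : numClosedFieldType) (r : nat).
Hypothesis r4 : (4 <= r)%N.
Local Notation G := (so_gram C r).
Local Notation gl := 'M[C]_(r + r).

Lemma so_tr (X : gl) : so X -> so X^T.
Proof.
rewrite /so => H; have := congr1 (fun M => G *m M *m G) H.
rewrite mulmxDr mulmxDl !mulmxA so_gramK mul1mx mulmx0 mul0mx.
by rewrite -!mulmxA so_gramK mulmx1 trmxK addrC.
Qed.

Lemma cartan_tr (x : 'rV[C]_r) : (cartan x)^T = cartan x.
Proof. by rewrite /cartan tr_block_mx !trmx0 linearN /= tr_diag_mx. Qed.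

Lemma lie_tr (X Y : gl) : (lie X Y)^T = - lie X^T Y^T.
Proof. by rewrite /lie linearB /= !trmx_mul opprB. Qed.

Lemma elem_mxM i j k l : (1 <= j <= r)%N ->
  elem_mx C r i j *m elem_mx C r k l = (j == k)%:R *: elem_mx C r i l.
Proof.
case: j => // j j_r; apply/matrixP => a b; rewrite !mxE (bigD1 (Ordinal j_r)) //=.
rewrite big1 ?addr0 => [|c nc].
  by rewrite !mxE /= eqxx andbT -!natrM mulnb; congr _%:R; do ![case: (_ == _)].
by rewrite !mxE [c.+1 == _]eqSS (_ : (c == j :> nat) = false) ?andbF ?mul0r //; apply/negbTE.
Qed.

Lemma elem_mx_diag i : diag_mx (eps C r i) = elem_mx C r i i.
Proof.
apply/matrixP => a b; rewrite !mxE.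
have [->|ne] := eqVneq a b; first by rewrite mulr1n andbb.
rewrite mulr0n; case: eqP => //= e; case: eqP => //= e'.
by case/eqP: ne; apply: ord_inj; lia.
Qed.

Lemma diag_eps i j c : diag_mx (eps C r i + c *: eps C r j) =
  elem_mx C r i i + c *: elem_mx C r j j.
Proof.
rewrite -!elem_mx_diag; apply/matrixP => a b; rewrite !mxE.
by case: (a == b); rewrite ?mulr1n ?mulr0n ?mulr0 ?addr0.
Qed.

Lemma lie_root_vectors i : (1 <= i <= r)%N ->
  lie (root_vector C r i) (root_vector C r i)^T = cartan (alpha C r i).
Proof.
move=> i_r; rewrite /lie /cartan /root_vector /alpha; case: eqP => [ei|ni].
  rewrite tr_block_mx !trmx0 !mulmx_block !(mulmx0, mul0mx, addr0, add0r).
  rewrite opp_block_mx add_block_mx !oppr0 !addr0 add0r.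
  rewrite linearB /= !trmx_elem_mx -[eps C r r]scale1r diag_eps !scale1r.
  rewrite !(mulmxBl, mulmxBr) !elem_mxM; try lia.
  have e1 : (r == r.-1) = false by lia.
  have e2 : (r.-1 == r) = false by lia.
  by rewrite !eqxx e1 e2 !scale1r !scale0r !subr0 !sub0r !opprK [X in - X]addrC.
rewrite tr_block_mx !trmx0 !mulmx_block !(mulmx0, mul0mx, addr0, add0r).
rewrite opp_block_mx add_block_mx !oppr0 !addr0.
rewrite linearN /= !trmx_elem_mx !(mulmxN, mulNmx) !opprK.
rewrite !elem_mxM ?eqxx ?scale1r; try lia.
by rewrite -[- eps C r i.+1]scaleN1r diag_eps scaleN1r opprB.
Qed.

(* A highest weight vector v with pairing -1 would generate under the         *)
(* lowering operator infinitely many eigenvectors with distinct eigenvalues.  *)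
Lemma highest_weight_pairing d (rho : gl -> 'M[C]_d) mu v i :
  so_module rho -> highest_weight_vector rho mu v -> (1 <= i <= r)%N ->
  dynkin mu i <> -1.
Proof.
move=> [lin_rho lie_rho] [v0 ev hv] i_r; rewrite dynkinE // => mE.
pose E := root_vector C r i; pose F := E^T; pose H := cartan (alpha C r i).
have sE : so E := so_root_vector C r i.
have sF : so F := so_tr sE.
have sH : so H := so_cartan _.
have EF : rho E *m rho F = rho F *m rho E + rho H.
  by rewrite /H -lie_root_vectors // lie_rho // /lie addrC subrK.
have HF : rho H *m rho F = rho F *m rho H - 2 *: rho F.
  have rhoZ a X : so X -> rho (a *: X) = a *: rho X.
    move=> sX; have s0 : so (0 : gl) by rewrite /so trmx0 mul0mx mulmx0 addr0.
    have r0 : rho 0 = 0.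
      have := lin_rho 1 0 0 s0 s0; rewrite !scale1r addr0 => e.
      by apply: (addrI (rho 0)); rewrite addr0 -e.
    by have := lin_rho a X 0 sX s0; rewrite r0 !addr0.
  have := lie_rho H F sH sF; rewrite /F -[H]cartan_tr.
  have -> : lie H^T E^T = - (2 *: E^T).
    rewrite -[LHS]opprK -lie_tr /H lie_cartan_root_vector inv_form_alpha_self //.
    by rewrite linearZ.
  rewrite cartan_tr -scaleNr rhoZ // scaleNr /lie => e.
  by rewrite /F e addrC subrK.
pose w k := iter k (fun u : 'cV_d => rho F *m u) v.
have wS k : w k.+1 = rho F *m w k by [].
have Hw k : rho H *m w k = (-1 - 2 * k%:R) *: w k.
  elim: k => [|k IH]; first by rewrite mulr0 subr0 hv mE.
  rewrite /= mulmxA HF mulmxBl -mulmxA IH -scalemxAl -scalemxAr -scalerBl.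
  by congr (_ *: _); rewrite -natr1; ring.
(* The usual coefficient (k+1)(m-k) for highest weight m = -1; it never vanishes, so the chain of
   the w k does not stop. *)
have Ew k : rho E *m w k.+1 = - (k.+1%:R ^+ 2) *: w k.
  elim: k => [|k IH].
    by rewrite /= mulmxA EF mulmxDl -mulmxA ev // mulmx0 add0r hv mE expr1n.
  rewrite (wS k.+1) mulmxA EF mulmxDl -mulmxA IH Hw -scalemxAr -wS -scalerDl.
  by congr (_ *: _); rewrite -!natr1; ring.
have w0 k : w k != 0.
  elim: k => // k IH; apply: contraNneq IH => z.
  have := Ew k; rewrite z mulmx0 => /esym/eqP; rewrite scaler_eq0 oppr_eq0.
  by rewrite expf_eq0 /= pnatr_eq0.
(* The first d+1 eigenvalues already outnumber the possible roots of a polynomial of degree d. *)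
pose p := char_poly (rho H)^T; pose rs := [seq -1 - 2 * k%:R : C | k <- iota 0 d.+1].
have : (size rs < size p)%N.
  apply: max_poly_roots.
  - by rewrite -size_poly_eq0 size_char_poly.
  - apply/allP => _ /mapP[k _ ->]; rewrite -eigenvalue_root_char.
    apply/eigenvalueP; exists (w k)^T; first by rewrite -trmx_mul Hw linearZ.
    by rewrite trmx_eq0.
  rewrite map_inj_uniq ?iota_uniq // => a b /(addrI _)/oppr_inj/mulfI.
  by rewrite pnatr_eq0 => /(_ isT)/eqP; rewrite eqr_nat => /eqP.
by rewrite size_char_poly size_map size_iota ltnn.
Qed.

End Sl2.

Section Admissibility.
Variables (C : numClosedFieldType) (r : nat).
Hypothesis r4 : (4 <= r)%N.
Local Notation gl := 'M[C]_(r + r).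

Lemma sum_alpha a b : (1 <= a <= b)%N -> (b <= r)%N ->
  \sum_(a <= i < b) alpha C r i = eps C r a - eps C r b.
Proof.
move=> ab br; rewrite -[RHS]opprB -telescope_sumr; last by lia.
rewrite -sumrN; apply: eq_big_nat => i i_bd; rewrite opprB /alpha.
by rewrite (_ : i == r = false) //; lia.
Qed.

(** Each label picks one of the 2r weights of the vector module, +eps_k or -eps_k. *)
Definition shifted_weight (lam : 'rV[C]_r) lab : 'rV[C]_r :=
  match lab with
  | Lab l => if (l < r)%N then lam + eps C r l.+1
             else lam - eps C r (2 * r - 1 - l)
  | LabBar => lam - eps C r r
  end.

Lemma target_weightE lam lab l : labelled_tuple r lab l ->
  target_weight lam l = shifted_weight lam lab.
Proof.
move=> hl; rewrite /target_weight /omega1.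
have split3 (F : nat -> 'rV[C]_r) : \sum_(1 <= i < r.+1) F i =
    \sum_(1 <= i < r.-1) F i + F r.-1 + F r.
  have last_term n : (2 <= n)%N ->
      \sum_(1 <= i < n) F i = \sum_(1 <= i < n.-1) F i + F n.-1.
    by case: n => [|[|n]] // _; rewrite big_nat_recr.
  by rewrite (last_term r.+1) /= ?(last_term r) //; lia.
have S3 : \sum_(1 <= i < r.+1) alpha C r i *+ nth 0%N l i.-1 =
    \sum_(1 <= i < r.-1) alpha C r i *+ nth 0%N l i.-1
    + alpha C r r.-1 *+ nth 0%N l r.-2 + alpha C r r *+ nth 0%N l r.-1.
  exact: (split3 (fun i => alpha C r i *+ nth 0%N l i.-1)).
have alr : alpha C r r = eps C r r.-1 + eps C r r by rewrite /alpha eqxx.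
have alr1 : alpha C r r.-1 = eps C r r.-1 - eps C r r.
  by rewrite /alpha (_ : r.-1 == r = false) ?prednK //; lia.
have [[m [m_r -> E]]|[-> E]|[m [m_r -> E]]] := tuple_entries r4 hl.
- rewrite /= m_r (big_cat_nat (n := m.+1)) //=; last by lia.
  rewrite [\sum_(m.+1 <= i < _) _]big_nat_cond [X in _ - (_ + X)]big1 ?addr0; last first.
    move=> i /andP[i_bd _]; rewrite E; last by lia.
    by rewrite (_ : (i <= m)%N = false) ?mulr0n //; lia.
  rewrite (eq_big_nat _ _ (F2 := fun i => alpha C r i)) => [|i i_bd].
    by rewrite sum_alpha // opprB addrACA subrr addr0.
  rewrite E; last by lia.
  by rewrite (_ : (i <= m)%N) ?mulr1n //; lia.
- rewrite S3 (eq_big_nat _ _ (F2 := fun i => alpha C r i)) => [|i i_bd].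
    rewrite !E ?eqxx ?mulr0n ?addr0; try lia.
    rewrite (_ : r != r.-1) ?mulr1n; last by lia.
    rewrite sum_alpha ?alr; try lia.
    by apply/rowP => j; rewrite !mxE; ring.
  rewrite E; last by lia.
  by rewrite (_ : i != r.-1) ?mulr1n //; lia.
rewrite S3 !E; try lia.
have e1 : (m < r.-1 <= r - 2)%N = false by lia.
have e2 : (m < r <= r - 2)%N = false by lia.
rewrite e1 e2 !mulr1n alr alr1 (big_cat_nat (n := m.+1)) //=; last by lia.
rewrite (eq_big_nat _ _ (F2 := fun i => alpha C r i)) => [|i i_bd]; last first.
  rewrite E; last by lia.
  by rewrite (_ : (m < i <= r - 2)%N = false) ?mulr1n //; lia.
rewrite [\sum_(m.+1 <= i < _) _](eq_big_nat _ _ (F2 := fun i => alpha C r i *+ 2)) => [|i i_bd];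
  last first.
  rewrite E; last by lia.
  by rewrite (_ : (m < i <= r - 2)%N) //; lia.
rewrite sumrMnl !sum_alpha; try lia.
rewrite (_ : (2 * r - 2 - m < r)%N = false); last by lia.
rewrite (_ : (2 * r - 1 - (2 * r - 2 - m) = m.+1)%N); last by lia.
by apply/rowP => j; rewrite !mxE; ring.
Qed.

Lemma dominant_ge0 (lam : 'rV[C]_r) c : dominant_integral lam -> (1 <= c <= r)%N ->
  0 <= dynkin lam c.
Proof. by move=> dom c_r; have [k ->] := dom c c_r. Qed.

Lemma summand_tensor_natural (lam mu : 'rV[C]_r) l dA (rhoA : gl -> 'M[C]_dA)
    dB (rhoB : gl -> 'M[C]_dB) g b :
  irreducible_of_highest_weight mu rhoA -> unitary_module rhoA ->
  irreducible_of_highest_weight lam rhoB -> unitary_module rhoB ->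
  vector_ops rhoA rhoB g -> g b != 0 -> mu = target_weight lam l ->
  admissible lam l.
Proof.
move=> irrA uA irrB uB gP gb muE; rewrite muE in irrA.
exists dB, (r + r)%N, dA, rhoB, id, rhoA; split=> //.
  by split; [case: (id_unitary C r)|exact: natural_irreducible|exact: natural_hwv].
by case: irrA => _ irr _; apply: summand_of_ops uA irr uB gP gb.
Qed.

(** For a target lambda + eps_k the linked modules are used with mu = lambda. For lambda - eps_k
    they are used with mu the target, and the resulting map is turned around by its adjoint. *)
Lemma label_condition_admissible (lam : 'rV[C]_r) lab l :
  dominant_integral lam -> labelled_tuple r lab l ->
  label_condition r (dynkin lam) lab -> admissible lam l.
Proof.
move=> dom hl cond; have tE := target_weightE lam hl.
have up m : (m < r)%N -> ((0 < m)%N -> dynkin lam m != 0) ->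
    target_weight lam l = lam + eps C r m.+1 -> admissible lam l.
  move=> m_r Lm tm.
  have [dA [rhoA [dB [rhoB [g [b [[uA iA] [uB iB] gP gb]]]]]]] :=
    @linked_modules C r r4 lam m.+1 dom m_r Lm.
  by apply: summand_tensor_natural iA uA iB uB gP gb _; rewrite tm.
have down k : (1 <= k <= r)%N -> dominant_integral (lam - eps C r k) ->
    target_weight lam l = lam - eps C r k -> admissible lam l.
  move=> k_r domk tk; have Lk : (2 <= k)%N -> dynkin (lam - eps C r k) k.-1 != 0.
    move=> k2; rewrite dynkinB ?dynkin_eps //; try lia.
    rewrite (_ : k.-1 == r = false); last by lia.
    rewrite (_ : k == k.-1 = false) ?prednK ?eqxx ?sub0r ?opprK //; try lia.
    by rewrite gt_eqF // ltr_wpDl // dominant_ge0 //; lia.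
  have [dA [rhoA [dB [rhoB [g [b [[uA iA] [uB iB] gP gb]]]]]]] :=
    @linked_modules C r r4 (lam - eps C r k) k domk k_r Lk.
  rewrite subrK in iA; have hP := vector_ops_adjoint uA uB gP.
  apply: (summand_tensor_natural (b := dual_index b)) iB uB iA uA hP _ _.
    rewrite dual_indexK; apply: contraNneq gb => z.
    by rewrite -[g b]trmxCK z ctr0.
  by rewrite tk.
(* Subtracting eps_k lowers the label k, and also the label r when k = r-1; no other label
   decreases. This is why label r of the theorem carries two conditions. *)
have lower k : (1 <= k <= r)%N ->
    (forall i, (1 <= i <= r)%N -> (i == k) || (i == r) && (k == r.-1) -> 0 < dynkin lam i) ->
    dominant_integral (lam - eps C r k).
  move=> k_r Lk i i_r; rewrite dynkinB ?dynkin_eps //; have [m mE] := dom i i_r.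
  have [ik|ik] := boolP ((i == k) || (i == r) && (k == r.-1)).
    have := Lk i i_r ik; rewrite mE ltr0n => m0; exists m.-1.
    have -> : m.-1%:R = m%:R - 1 :> C by rewrite -subn1 natrB.
    congr (_ - _).
    case: eqP => ir.
      by rewrite -natrD (_ : (_ + _)%N = 1%N) //; move: ik; do ![case: eqP => //=]; lia.
    rewrite (_ : k == i); last by lia.
    by rewrite (_ : k == i.+1 = false) ?subr0 //; lia.
  rewrite mE; case: eqP => ir.
    have a1 : (k == r.-1) = false by lia.
    have a2 : (k == r) = false by lia.
    by exists m; rewrite a1 a2 addr0 subr0.
  have a1 : (k == i) = false by lia.
  rewrite a1 sub0r opprK.
  by exists (m + (k == i.+1))%N; rewrite natrD.
have [[m [m_r lE E]]|[lE E]|[m [m_r lE E]]] := tuple_entries r4 hl;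
  rewrite {}lE /= in tE cond.
- rewrite m_r in tE cond; apply: (up m) => // m0; apply: lt0r_neq0.
  by move: cond; rewrite gtn_eqF.
- apply: (down r) => //; [lia|apply: lower => [|i i_r ik]; first by lia].
  by have -> : i = r by lia.
have e1 : (2 * r - 2 - m < r)%N = false by lia.
have e2 : (2 * r - 1 - (2 * r - 2 - m) = m.+1)%N by lia.
have e3 : (2 * r - 2 - m == 0)%N = false by lia.
have e4 : (2 * r - (2 * r - 2 - m) - 1 = m.+1)%N by lia.
rewrite e1 e2 in tE; rewrite e1 e3 e4 in cond.
apply: (down m.+1) => //; first by lia.
apply: lower => [|i i_r ik]; first by lia.
case: eqP cond => [e|ne]; last first.
  by have -> : i = m.+1 by lia.
by move=> [La Lb]; have [->|->] : i = r.-1 \/ i = r by lia.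
Qed.

(** Each label required to be positive is lowered by 1 in the target weight, so its vanishing would
    give a highest weight with a label -1. *)
Lemma admissible_label_condition (lam : 'rV[C]_r) lab l :
  dominant_integral lam -> labelled_tuple r lab l ->
  admissible lam l -> label_condition r (dynkin lam) lab.
Proof.
move=> dom hl [d1 [d2 [d3 [rho1 [rho2 [rho3 [_ _ [mod3 _ [v hv]] _]]]]]]].
rewrite (target_weightE lam hl) in hv.
have pos i : (1 <= i <= r)%N -> dynkin (shifted_weight lam lab) i = dynkin lam i - 1 ->
    0 < dynkin lam i.
  move=> i_r E; rewrite lt_def dominant_ge0 // andbT; apply/eqP => z.
  by apply: (highest_weight_pairing r4 mod3 hv i_r); rewrite E z sub0r.
have [[m [m_r lE _]]|[lE _]|[m [m_r lE _]]] := tuple_entries r4 hl;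
  rewrite {}lE /= in pos *.
- rewrite m_r in pos *; case: eqP => // /eqP m0; apply: pos; first by lia.
  rewrite dynkinD ?dynkin_eps //; try lia.
  rewrite (_ : m == r = false); last by lia.
  by rewrite (_ : m.+1 == m = false) ?eqxx ?sub0r //; lia.
- apply: pos; first by lia.
  rewrite dynkinB ?dynkin_eps ?eqxx //; try lia.
  by rewrite (_ : r == r.-1 = false) ?add0r //; lia.
have e1 : (2 * r - 2 - m < r)%N = false by lia.
have e2 : (2 * r - 1 - (2 * r - 2 - m) = m.+1)%N by lia.
have e3 : (2 * r - 2 - m == 0)%N = false by lia.
have e4 : (2 * r - (2 * r - 2 - m) - 1 = m.+1)%N by lia.
rewrite e1 e2 in pos; rewrite e1 e3 e4.
have own : 0 < dynkin lam m.+1.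
  apply: pos; first by lia.
  rewrite dynkinB ?dynkin_eps ?eqxx //; try lia.
  rewrite (_ : m.+1 == r = false); last by lia.
  by rewrite (_ : m.+1 == m.+2 = false) ?subr0 //; lia.
case: eqP => // e; have er : m.+1 = r.-1 by lia.
rewrite er in own pos; split=> //; apply: pos; first by lia.
rewrite dynkinB ?dynkin_eps ?eqxx //; try lia.
by rewrite (_ : r.-1 == r = false) ?addr0 //; lia.
Qed.

End Admissibility.

(** * Conclusion: admissibility against solvability *)

Lemma bethe_system_ext (C : numFieldType) (r : nat) (L : nat -> C)
    (T T' : nat -> seq C) : (4 <= r)%N ->
  (forall c, (c <= r)%N -> T c = T' c) -> bethe_system r L T -> bethe_system r L T'.
Proof.
move=> r4 E [T0 H]; split=> [|c c_r]; first by rewrite -E.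
rewrite -E; last by case/andP: c_r.
suff -> : nbrs r T' c = nbrs r T c by apply: H.
congr flatten; apply/eq_in_map => k k_c; rewrite E //.
by move: k_c; rewrite /nbr_nodes; do 2?case: ifP => ?; rewrite !inE; lia.
Qed.

Theorem theorem5p4 (R : realType) (r : nat) (hr : (4 <= r)%N)
    (lam : 'rV[R[i]]_r) (hlam : dominant_integral lam)
    (lab : label) (l : seq nat) (hl : labelled_tuple r lab l) :
  let Lam := [tuple lam; omega1 R[i] r] in
  let z := [tuple (0 : R[i]); 1] in
  (~ admissible lam l ->
     forall t : 'I_(sumn l) -> R[i], ~ bethe_solution Lam z t)
  /\ (admissible lam l ->
     exists t : 'I_(sumn l) -> R[i],
       [/\ bethe_solution Lam z t,
           forall t' : 'I_(sumn l) -> R[i],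
             bethe_solution Lam z t' -> same_solution t' t &
           represents (dynkin lam) r lab (representing_poly t)]).
Proof.
move=> Lam z; have lr := size_labelled_tuple hr hl.
have L0 c : (1 <= c <= r)%N -> 0 <= dynkin lam c by apply: dominant_ge0.
have [solve exist] := classify (@sqrtCK _) hr hl L0.
have sol_sys (t : 'I_(sumn l) -> R[i]) : bethe_solution Lam z t -> bethe_system r (dynkin lam) (node_roots t).
  by move=> sol; apply: (@bethe_solutionE _ _ hr l lr lam t).1 sol.
have sizes (t : 'I_(sumn l) -> R[i]) : tuple_sizes r (node_roots t) l.
  by move=> c; apply: size_node_roots.
have polys (t : 'I_(sumn l) -> R[i]) :
    represents_roots r (representing_poly t) (node_roots t).
  by move=> c /andP[c0 _]; apply: representing_polyE.
split=> [nadm t sol|adm].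
  apply: nadm; apply: (label_condition_admissible hr hlam hl).
  exact: (solve _ (sol_sys t sol) (sizes t)).1.
have [T sT szT] := exist (admissible_label_condition hr hlam hl adm).
have [t tT] := node_roots_surj hr lr (proj1 sT) szT.
have st : bethe_system r (dynkin lam) (node_roots t).
  by apply: (bethe_system_ext hr _ sT) => c c_r; rewrite tT.
have rep := (solve _ st (sizes t)).2 _ (polys t).
exists t; split=> // [|t' sol']; first exact: (@bethe_solutionE _ _ hr l lr lam t).2 st.
apply: (same_solution_of_polys hr lr) => c c_r.
(* Both solutions satisfy the same formulas, so their polynomials coincide at every node. *)
apply: (represents_inj hr hl _ rep) => //.
exact: (solve _ (sol_sys t' sol') (sizes t')).2 _ (polys t').
Qed.
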